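(* Let $\mathbb{F}_q$ be a finite field of characteristic $p\geq 5$, let $K=\mathbb{F}_q(t)$, let $d\geq 2$ be an integer coprime to $q$, and let $E_d/K$ be the elliptic curve $y^2+xy-t^d y=x^3$. Then the $L$-function of $E_d/K$ is \[ L(E_d/K,T)=\prod_{\mathbf{m}\in\mathcal{O}_q(Z_d)}\left(1-\theta_m(-1)\,\mathbf{J}(\mathbf{m})\,T^{|\mathbf{m}|}\right)\in\mathbb{Z}[T], \] where for each orbit $\mathbf{m}$, $m$ denotes any representative of $\mathbf{m}$.
   Context: $L(E_d/K,T)=\prod_{v\text{ good}}(1-a_vT^{\deg v}+q_vT^{2\deg v})^{-1}\prod_{v\text{ bad}}(1-a_vT^{\deg v})^{-1}$, product over places $v$ of $K$, where $q_v$ is the size of the residue field and $a_v=q_v+1-|\tilde{E}_v(\mathbb{F}_{q_v})|$ for the reduction $\tilde E_v$ of a minimal integral model at $v$. $Z_d=\mathbb{Z}/d\mathbb{Z}\smallsetminus\{0,d/3,2d/3\}$ if $3\mid d$ and $Z_d=\mathbb{Z}/d\mathbb{Z}\smallsetminus\{0\}$ otherwise; $q$ acts on $Z_d$ by multiplication, $\mathcal{O}_q(Z_d)$ is the set of orbits, and $|\mathbf{m}|$ is the orbit length (the least $k\geq1$ with $q^km\equiv m\bmod d$). Elements of $\mathbb{Z}/d\mathbb{Z}$ are identified with lifts in $\{0,\dots,d-1\}$. Fix a prime $\mathfrak{P}$ above $p$ in the ring of algebraic integers $\bar{\mathbb{Z}}$, so $\bar{\mathbb{Z}}/\mathfrak{P}=\bar{\mathbb{F}}_p\supset\mathbb{F}_q$,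 and let $\theta:\bar{\mathbb{F}}_p^\times\to\bar{\mathbb{Z}}^\times$ be the inverse of the reduction isomorphism from roots of unity of order prime to $p$. For $m\in Z_d$, $\theta_m:\mathbb{F}_{q^{|\mathbf{m}|}}^\times\to\bar{\mathbb{Q}}^\times$ is $\theta_m(x)=\theta(x)^{(q^{|\mathbf{m}|}-1)m/d}$, extended by $\theta_m(0)=0$. The Jacobi sum is $\mathbf{J}(\mathbf{m})=\sum_{x_1,x_2,x_3\in\mathbb{F}_{q^{|\mathbf{m}|}},\,x_1+x_2+x_3=1}\theta_m(x_1)\theta_m(x_2)\theta_m(x_3)$, which does not depend on the representative $m$ of $\mathbf{m}$. *)

(* Defs.v *)
From HB Require Import structures.
From mathcomp Require Import all_boot all_order all_algebra all_field.
From mathcomp Require Import finmap.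
From mathcomp Require Import boolp classical_sets cardinality fsbigop.

Set Implicit Arguments.
Unset Strict Implicit.
Unset Printing Implicit Defensive.
Import GRing.Theory.

Local Open Scope classical_set_scope.
Local Open Scope ring_scope.

(** * Weierstrass curves  y^2 + a1 x y + a3 y = x^3 + a2 x^2 + a4 x + a6 *)

Record weierstrass (K : Type) :=
  Weierstrass { a1 : K; a2 : K; a3 : K; a4 : K; a6 : K }.

HB.instance Definition _ (K : Type) := gen_eqMixin (weierstrass K).
HB.instance Definition _ (K : Type) := gen_choiceMixin (weierstrass K).

Section Weierstrass.
Variable K : fieldType.
Implicit Types W : weierstrass K.

Definition weq W (x y : K) : K :=
  y ^+ 2 + a1 W * x * y + a3 W * y
  - (x ^+ 3 + a2 W * x ^+ 2 + a4 W * x + a6 W).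

Definition disc W : K :=
  let b2 := a1 W ^+ 2 + 4 * a2 W in
  let b4 := 2 * a4 W + a1 W * a3 W in
  let b6 := a3 W ^+ 2 + 4 * a6 W in
  let b8 := a1 W ^+ 2 * a6 W + 4 * a2 W * a6 W - a1 W * a3 W * a4 W
            + a2 W * a3 W ^+ 2 - a4 W ^+ 2 in
  - b2 ^+ 2 * b8 - 8 * b4 ^+ 3 - 27 * b6 ^+ 2 + 9 * b2 * b4 * b6.

(** [W'] is obtained from [W] by the admissible change of variables
    x = u^2 x' + r,  y = u^3 y' + u^2 s x' + t  over K. *)
Definition isomorphic W W' : Prop :=
  exists u r s t : K, u != 0 /\
  [/\ u * a1 W' = a1 W + 2 * s,
      u ^+ 2 * a2 W' = a2 W - s * a1 W + 3 * r - s ^+ 2,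
      u ^+ 3 * a3 W' = a3 W + r * a1 W + 2 * t,
      u ^+ 4 * a4 W' = a4 W - s * a3 W + 2 * r * a2 W - (t + r * s) * a1 W
                       + 3 * r ^+ 2 - 2 * s * t
    & u ^+ 6 * a6 W' = a6 W + r * a4 W + r ^+ 2 * a2 W + r ^+ 3
                       - t * a3 W - t ^+ 2 - r * t * a1 W].

End Weierstrass.

(** * Places of the rational function field K = F(t)

    A place is given by its valuation ring: a proper subring [O] of K containing
    the constants, and containing x or 1/x for every x. *)

Notation ratfun F := {fraction {poly F}}.

Section Places.
Variable F : finFieldType.
Local Notation K := (ratfun F).
Implicit Types O : set K.

Definition is_place O : Prop :=
  [/\ forall c : F, O (tofrac c%:P),
      forall x y, O x -> O y -> O (x - y) /\ O (x * y),
      forall x, O x \/ O x^-1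
    & exists x, ~ O x].

Definition max_ideal O : set K := [set x | x = 0 \/ ~ O x^-1].

(** Elements of the residue field [O / max_ideal O] are represented by cosets. *)
Definition residue O (x : K) : set K := [set y | max_ideal O (y - x)].

Definition residue_field O : set (set K) := [set residue O x | x in O].

Definition residue_card O : nat := #|` fset_set (residue_field O)|.

(** The dimension over F of the residue field, as the exponent n such that the
    residue field has #|F|^n elements. *)
Definition degree O : nat := trunc_log #|F| (residue_card O).

Definition integral O (W : weierstrass K) : Prop :=
  [/\ O (a1 W), O (a2 W), O (a3 W), O (a4 W) & O (a6 W)].

(** The valuation of the discriminant is minimal among integral models; for
    nonzero a and b in K, v(a) <= v(b) means that b / a lies in O. *)
Definition is_minimal_model O (E W : weierstrass K) : Prop :=
  [/\ isomorphic E W, integral O W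
    & forall W', isomorphic E W' -> integral O W' -> O (disc W' / disc W)].

Definition minimal_model O (E : weierstrass K) : weierstrass K :=
  xget E [set W | is_minimal_model O E W].

(** The number of rational points on the projective cubic over the residue field
    obtained by reducing an integral [W]: the affine ones (a singular point
    included) and the point at infinity. *)
Definition reduction_card O (W : weierstrass K) : nat :=
  #|` fset_set [set z : set K * set K | exists x y,
        [/\ O x, O y, z = (residue O x, residue O y)
          & max_ideal O (weq W x y)]] |.+1.

(** The discriminant of a minimal model is a unit of [O], i.e. the reduced cubic is
    nonsingular. *)
Definition good_reduction O (E : weierstrass K) : Prop :=
  ~ max_ideal O (disc (minimal_model O E)).

Definition trace O (E : weierstrass K) : int :=
  (residue_card O)%:Z + 1 - (reduction_card O (minimal_model O E))%:Z.

Definition euler_factor O (E : weierstrass K) : {poly int} :=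
  1 - trace O E *: 'X^(degree O)
  + (if `[< good_reduction O E >] then
       (residue_card O)%:Z *: 'X^(2 * degree O) else 0).

(** The inverse of [P], modulo X^(n+1), as a power series, for P(0) = 1. *)
Definition trunc_inv (n : nat) (P : {poly int}) : {poly int} :=
  \sum_(k < n.+1) (1 - P) ^+ k.

(** The n-th coefficient of the L-function as a formal power series in T. The
    Euler factors at places of degree > n are 1 modulo T^(n+1), and there are
    finitely many places of degree <= n. *)
Definition Lfun (E : weierstrass K) (n : nat) : int :=
  (\big[*%R/1]_(O \in [set O | is_place O /\ (degree O <= n)%N])
     trunc_inv n (euler_factor O E))`_n.

(** y^2 + x y - t^d y = x^3 *)
Definition curveE (d : nat) : weierstrass K :=
  Weierstrass 1 0 (- tofrac ('X^d)) 0 0.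

End Places.

(** * The orbits of multiplication by q on Z_d *)

Section Orbits.
Variables (q d : nat).

Definition mul_by (m : 'Z_d) : 'Z_d := q%:R * m.

Definition indexZ : {set 'Z_d} :=
  [set m : 'Z_d | (m != 0)
     && ~~ ((3 %| d)%N && ((m == (d %/ 3)%N :> nat)
                             || (m == (2 * d %/ 3)%N :> nat)))]%SET.

Definition orbits : {set {set 'Z_d}} :=
  [set [set n in orbit mul_by m] | m in indexZ]%SET.

Definition orbit_length (m : 'Z_d) : nat := order mul_by m.

End Orbits.

(** * Jacobi sums *)

(** The ring of algebraic integers. *)
Definition Zbar := {x : algC | x \in Aint}.
HB.instance Definition _ := SubType.on Zbar.
HB.instance Definition _ := Choice.on Zbar.
HB.instance Definition _ :=
  [SubChoice_isSubComNzRing of Zbar by <:].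

Section Jacobi.
Variables (p q d : nat) (P : prime_idealr Zbar).
Local Notation Fbar := {ideal_quot P}.

(** The root of unity of order prime to p that reduces to x (for x nonzero). *)
Definition theta (x : Fbar) : Zbar :=
  xget 0 [set z : Zbar | (exists2 n, coprime n p & n.-primitive_root z)
                         /\ \pi_Fbar%qT z = x].

(** The field with q^n elements inside the quotient of the ring of algebraic
    integers by [P], an algebraic closure of the prime field; it does not depend on
    how the base field is embedded there. *)
Definition subfieldF (n : nat) : set Fbar := [set x | x ^+ (q ^ n) = x].

Definition theta_char (m : 'Z_d) (x : Fbar) : algC :=
  if x == 0 then 0
  else val (theta x) ^+ ((q ^ orbit_length q m - 1) * m %/ d)%N.

Definition jacobi (m : 'Z_d) : algC :=
  let k := orbit_length q m in
  \sum_(x \in [set x : Fbar * Fbar * Fbar |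
       [/\ subfieldF k x.1.1, subfieldF k x.1.2, subfieldF k x.2
         & x.1.1 + x.1.2 + x.2 = 1]])
    theta_char m x.1.1 * theta_char m x.1.2 * theta_char m x.2.

End Jacobi.

(* Main.v *)
Require Import Defs.
From HB Require Import structures.
From mathcomp Require Import all_boot all_order all_algebra all_solvable all_field.
From mathcomp Require Import finmap.
From mathcomp Require Import boolp classical_sets cardinality fsbigop.
From mathcomp Require Import zify ring.

Set Implicit Arguments.
Unset Strict Implicit.
Unset Printing Implicit Defensive.
Import Order.TTheory GRing.Theory Num.Theory.
Local Open Scope ring_scope.

(** Both sides have constant term 1, so it suffices to compare the coefficients of
    their logarithmic derivatives T L'/L (Newton sums), in characteristic 0.

    Left-hand side: the Euler factor of a place v of degree e, with reduction
    y^2 + a1 x y + a3 y = x^3 over k_v, is the zeta numerator of that cubic. With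
    f = x^3 + ((a1 x + a3)/2)^2, it is the generating function of the completely
    multiplicative function g |-> chi(prod_(g(b) = 0) f(b)) on monic polynomials, chi
    quadratic. Its quadratic coefficient is found by counting the Mumford pairs
    (u, v) with u | f - v^2, and it has degree 2. Hence its k-th Newton sum is the
    trace over the extension of degree k, and the k-th Newton sum of L is
    the sum over beta in F_(q^k) of the traces of y^2 + x y - beta^d y = x^3, plus the
    contribution of t = oo (y^2 - y = x^3 if 3 | d, a cusp otherwise).

    Counting the (x, y, beta) by means of the characters of order dividing d turns this
    into minus the sum of theta_m(-1) J(m) over F_(q^k), for the m with d | (q^k - 1) m;
    the cubic characters, excluded from Z_d, cancel against the place t = oo.

    Right-hand side: (q^k - 1) m = 0 mod d means |m| divides k, and by Davenport-Hasse
    theta_m(-1) J(m) over F_(q^k) is the (k/|m|)-th power of its value over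
    F_(q^|m|). The latter is a lifting of Jacobi sums: Newton sums again, for
    the function g |-> chi(g(0)) psi(g(1)), whose L-function is 1 + J T. *)

(** * Logarithmic derivatives modulo T^(n+1) *)

(** [Lfun] is given coefficient by coefficient, through truncated products over places, so
    identities of power series are stated modulo T^(n+1) and Newton sums are defined by their
    recursion. Integrality and polynomiality then come for free: the coefficients of L are integers
    by definition, and the right-hand side is a polynomial.

    Each L-series is shown to be a polynomial by twisting: a permutation of the monic polynomials of
    a given degree multiplies the character by a constant other than 1, so that coefficient
    vanishes. One coefficient is left to compute for a Jacobi sum, two for a fibre. Singular fibres
    need no separate treatment: a resultant makes the character completely multiplicative for every
    cubic, and the quadratic coefficient is q (1 - number of multiple roots), which is 0 exactly
    when the reduction is singular.

    Davenport-Hasse compares characters of different fields. They all live in one quotient of the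
    algebraic integers by P, where the subfields are nested and [theta] is common. Characteristic at
    least 5 serves to complete the square and to solve for r, s, t in a change of variables. *)

Section LogDer.
Variable R : comNzRingType.
Implicit Types (P Q A B C : {poly R}) (N M : nat -> R).

Definition eqmodX n A B := forall m, (m <= n)%N -> A`_m = B`_m.

Lemma eqmodX_trans n A B C : eqmodX n A B -> eqmodX n B C -> eqmodX n A C.
Proof. by move=> AB BC m le_mn; rewrite AB // BC. Qed.

Lemma eqmodX_sym n A B : eqmodX n A B -> eqmodX n B A.
Proof. by move=> AB m le_mn; rewrite AB. Qed.

Lemma eqmodXD n A B C D : eqmodX n A B -> eqmodX n C D ->
  eqmodX n (A + C) (B + D).
Proof. by move=> AB CD m le_mn; rewrite !coefD AB // CD. Qed.

Lemma eqmodXM n A B C D : eqmodX n A B -> eqmodX n C D ->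
  eqmodX n (A * C) (B * D).
Proof.
move=> AB CD m le_mn; rewrite !coefM; apply: eq_bigr => i _.
rewrite AB ?CD //; first exact: leq_trans (leq_subr _ _) le_mn.
by rewrite -ltnS (leq_trans (ltn_ord i)).
Qed.

(* [N k] is the coefficient of T^k in T P'/P, for k >= 1; [N 0] is ignored. *)
Definition logder n P N :=
  forall m, (m <= n)%N -> P`_m *+ m = \sum_(k < m) P`_k * N (m - k)%N.

Definition genfun n N := \poly_(k < n.+1) (if k == 0 then 0 else N k).

(** The recursion is the coefficientwise form of T P' = P G, with G the generating series of N.
    Written as a ring identity it passes to products, inverses and T^e. *)
Lemma logderP n P N :
  logder n P N <-> eqmodX n ('X * P^`()) (P * genfun n N).
Proof.
have E m : (m <= n)%N ->
    (('X * P^`())`_m = P`_m *+ m) * ((P * genfun n N)`_m = \sum_(k < m) P`_k * N (m - k)%N).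
  move=> le_mn; split.
    by rewrite coefXM coef_deriv; case: m {le_mn} => //=; rewrite mulr0n.
  rewrite coefM big_ord_recr /= subnn coef_poly /= mulr0 addr0.
  apply: eq_bigr => i _; rewrite coef_poly ltnS (leq_trans (leq_subr _ _) le_mn).
  by rewrite subn_eq0 leqNgt ltn_ord.
by split=> H m le_mn; move: (H m le_mn); rewrite !E.
Qed.

Lemma genfunD n N M : genfun n (fun k => N k + M k) = genfun n N + genfun n M.
Proof.
apply/polyP=> i; rewrite coefD !coef_poly; case: ifP => _; last by rewrite addr0.
by case: eqP => _; rewrite ?addr0.
Qed.

Lemma genfunN n N : genfun n (fun k => - N k) = - genfun n N.
Proof.
apply/polyP=> i; rewrite coefN !coef_poly; case: ifP => _; last by rewrite oppr0.
by case: eqP => _; rewrite ?oppr0.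
Qed.

Lemma logderM n P Q N M : logder n P N -> logder n Q M ->
  logder n (P * Q) (fun k => N k + M k).
Proof.
move=> /logderP HP /logderP HQ; apply/logderP; rewrite genfunD derivM.
have -> : 'X * (P^`() * Q + P * Q^`()) = ('X * P^`()) * Q + P * ('X * Q^`()) by ring.
have -> : P * Q * (genfun n N + genfun n M) =
  (P * genfun n N) * Q + P * (Q * genfun n M) by ring.
by apply: eqmodXD; apply: eqmodXM.
Qed.

Lemma eq_logder n P Q N M : eqmodX n P Q ->
    (forall k, (0 < k <= n)%N -> N k = M k) -> logder n P N -> logder n Q M.
Proof.
move=> PQ NM HP m le_mn; rewrite -PQ // HP //; apply: eq_bigr => i _.
rewrite PQ ?NM //; last exact: leq_trans (ltnW (ltn_ord i)) le_mn.
by rewrite subn_gt0 ltn_ord (leq_trans (leq_subr _ _) le_mn).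
Qed.

Lemma logder1 n : logder n 1 (fun=> 0).
Proof.
move=> m _; rewrite big1 => [|i _]; last by rewrite mulr0.
by rewrite coef1; case: m => [|m]; rewrite ?mulr0n ?mul0rn.
Qed.

Lemma logder_prod n (I : Type) (r : seq I) (p : pred I) (P : I -> {poly R}) (N : I -> nat -> R) :
  (forall i, p i -> logder n (P i) (N i)) ->
  logder n (\prod_(i <- r | p i) P i) (fun k => \sum_(i <- r | p i) N i k).
Proof.
move=> H; elim: r => [|i r IHr].
  rewrite big_nil; apply: (eq_logder _ _ (@logder1 n)) => // k _.
  by rewrite big_nil.
rewrite big_cons; case: ifP => pi.
  by apply: (eq_logder _ _ (logderM (H i pi) IHr)) => // k _; rewrite big_cons pi.
by apply: (eq_logder _ _ IHr) => // k _; rewrite big_cons pi.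
Qed.

(** Differentiate P Q = 1; the factor T restores the order lost by the derivative. Multiplying by Q
    takes the place of a division by P. *)
Lemma logder_inv n P Q N : eqmodX n (P * Q) 1 -> logder n P N ->
  logder n Q (fun k => - N k).
Proof.
move=> PQ1 /logderP HP; apply/logderP; rewrite genfunN.
have H1 : eqmodX n ('X * (P * Q)^`()) 0.
  move=> m le_mn; rewrite coefXM coef_deriv coef0; case: m le_mn => //= m le_mn.
  by rewrite PQ1 // coef1 mul0rn.
have H2 : eqmodX n (Q * ('X * (P * Q)^`())) (P * Q * (Q * genfun n N + 'X * Q^`())).
  rewrite derivM.
  have -> : Q * ('X * (P^`() * Q + P * Q^`())) = Q * Q * ('X * P^`()) + P * Q * ('X * Q^`()) by ring.
  have -> : P * Q * (Q * genfun n N + 'X * Q^`()) = Q * Q * (P * genfun n N) + P * Q * ('X * Q^`()) by ring.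
  by apply: eqmodXD => //; apply: eqmodXM.
have H3 : eqmodX n (Q * genfun n N + 'X * Q^`()) 0.
  apply: eqmodX_trans (eqmodX_trans (eqmodX_sym H2) _); last first.
    by have := eqmodXM (A := Q) (B := Q) (fun m _ => erefl) H1; rewrite mulr0.
  rewrite -[X in eqmodX _ X _]mul1r.
  by apply: eqmodXM => //; apply: eqmodX_sym.
have := eqmodXD (A := - (Q * genfun n N)) (fun m _ => erefl) H3.
by rewrite addKr addr0 mulrN.
Qed.

Lemma eqmodX_comp n A B e : (0 < e)%N -> eqmodX n A B ->
  eqmodX n (A \Po 'X^e) (B \Po 'X^e).
Proof.
move=> e_gt0 AB m le_mn; rewrite !coef_comp_poly_Xn //; case: ifP => // _.
by rewrite AB // (leq_trans (leq_div _ _)).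
Qed.

Lemma eqmodXMn n A B e : eqmodX n A B -> eqmodX n (A *+ e) (B *+ e).
Proof. by move=> AB m le_mn; rewrite !coefMn AB. Qed.

(** Chain rule: T (P(T^e))' is e times (T P')(T^e). A place of degree e enters L through T^e. *)
Lemma logder_comp n P N e : (0 < e)%N -> logder n P N ->
  logder n (P \Po 'X^e) (fun k => if (e %| k)%N then (N (k %/ e)%N) *+ e else 0).
Proof.
move=> e_gt0 /logderP HP; apply/logderP.
have -> : 'X * (P \Po 'X^e)^`() = (('X * P^`()) \Po 'X^e) *+ e.
  rewrite deriv_comp derivXn comp_polyM comp_polyX !mulrnAr; congr (_ *+ _).
  by case: e e_gt0 => // e _; rewrite /= mulrCA -exprS mulrC.
apply: eqmodX_trans (eqmodXMn _ (eqmodX_comp e_gt0 HP)) _.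
rewrite comp_polyM -mulrnAr; apply: eqmodXM => // m le_mn.
rewrite coefMn coef_comp_poly_Xn // !coef_poly !ltnS le_mn.
rewrite (leq_trans (leq_div _ _)) //.
case: ifP => [/dvdnP[j ->]|_]; last by rewrite mul0rn; case: eqP.
by rewrite mulnK // muln_eq0 (gtn_eqF e_gt0) orbF; case: eqP; rewrite ?mul0rn.
Qed.

Lemma logder_linear n (c : R) : logder n (1 - c *: 'X) (fun k => - c ^+ k).
Proof.
have E i : (1 - c *: 'X)`_i = if i is i'.+1 then (if i' is 0 then - c else 0) else 1.
  rewrite coefB coef1 coefZ coefX; case: i => [|[|i]] /=.
  - by rewrite mulr0 subr0.
  - by rewrite mulr1 sub0r.
  by rewrite mulr0 subr0.
move=> m _; case: m => [|m]; first by rewrite big_ord0 mulr0n.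
rewrite big_ord_recl subn0 !E mul1r.
case: m => [|m]; first by rewrite big_ord0 addr0 expr1.
rewrite big_ord_recl big1 => [|i _] /=; rewrite E /= ?mul0r ?mul0rn //.
by rewrite addr0 mulrNN -exprS addNr.
Qed.

Lemma logder_binomial n (c : R) e : (0 < e)%N ->
  logder n (1 - c *: 'X^e) (fun k => if (e %| k)%N then - (c ^+ (k %/ e) *+ e) else 0).
Proof.
move=> e_gt0.
have -> : 1 - c *: 'X^e = (1 - c *: 'X) \Po 'X^e.
  by rewrite comp_polyB comp_polyZ comp_polyX -polyC1 comp_polyC.
apply: (eq_logder _ _ (logder_comp e_gt0 (@logder_linear n c))) => // k _.
by case: ifP => // _; rewrite mulNrn.
Qed.

(** The error is (1 - P)^(n+1), divisible by T^(n+1) because 1 - P has no constant term. The sum is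
    the one in [trunc_inv]. *)
Lemma geometric_inverse n P : P`_0 = 1 ->
  eqmodX n (P * \sum_(k < n.+1) (1 - P) ^+ k) 1.
Proof.
move=> P0.
have -> : P * \sum_(k < n.+1) (1 - P) ^+ k = 1 - (1 - P) ^+ n.+1.
  by apply: oppr_inj; rewrite -mulNr opprB subrX1; congr (_ * _); ring.
have [Q DP] : exists Q, 1 - P = 'X * Q.
  exists (drop_poly 1 (1 - P)); rewrite -[LHS](poly_take_drop 1) expr1 mulrC.
  suff -> : take_poly 1 (1 - P) = 0 by rewrite add0r.
  apply/polyP=> i; rewrite coef_take_poly coef0; case: ltnP => //.
  by case: i => // _; rewrite coefB coef1 P0 subrr.
by move=> m le_mn; rewrite DP exprMn coefB mulrC coefMXn ltnS le_mn subr0.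
Qed.
(** With constant term 1, the recursion at k contains N k with coefficient 1 and can be solved for
    it. This reads off the Newton sums of a known polynomial. *)
Lemma logder_coef_uniq n P N M : P`_0 = 1 -> logder n P N -> logder n P M ->
  forall k, (0 < k <= n)%N -> N k = M k.
Proof.
move=> P0 HN HM; elim/ltn_ind=> -[//|k] IHk /= le_kn.
have := HN _ le_kn; rewrite HM // !big_ord_recl /= P0 !mul1r !subn0.
have -> : \sum_(i < k) P`_(bump 0 i) * M (k.+1 - bump 0 i)%N =
          \sum_(i < k) P`_(bump 0 i) * N (k.+1 - bump 0 i)%N.
  apply: eq_bigr => i _; rewrite -IHk // /bump add1n subSS.
    by rewrite ltnS leq_subr.
  by rewrite subn_gt0 ltn_ord (leq_trans (leq_subr _ _)) // ltnW.
by move/addIr.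
Qed.

End LogDer.

(** The recursion gives m P_m from the lower coefficients, and characteristic 0 allows division by
    m. *)
Lemma logder_uniq (R : numDomainType) n (P Q : {poly R}) N :
    P`_0 = Q`_0 -> logder n P N -> logder n Q N ->
  eqmodX n P Q.
Proof.
move=> PQ0 HP HQ; elim/ltn_ind=> m IHm le_mn.
have [->//|m_gt0] := posnP m.
apply: (@mulIf _ m%:R); first by rewrite pnatr_eq0 -lt0n.
rewrite !mulr_natr HP // HQ //; apply: eq_bigr => i _.
by rewrite IHm // (leq_trans (ltnW (ltn_ord i))).
Qed.

(** * Completely multiplicative functions on monic polynomials *)

Lemma reindex_seq (R : Type) (idx : R) (op : Monoid.com_law idx)
    (S T : eqType) (s : seq S) (t : seq T) (h : S -> T) (G : T -> R) :
    uniq s -> uniq t -> {in s, forall x, h x \in t} -> {in s &, injective h} ->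
    (forall y, y \in t -> exists2 x, x \in s & y = h x) ->
  \big[op/idx]_(y <- t) G y = \big[op/idx]_(x <- s) G (h x).
Proof.
move=> us ut hst h_inj h_surj; rewrite -(big_map h xpredT); apply: perm_big.
apply: uniq_perm; rewrite ?map_inj_in_uniq // => y.
by apply/idP/mapP => [/h_surj[x xs ->]|[x xs ->]]; [exists x | exact: hst].
Qed.

Section Monics.
Variable F : finFieldType.
Implicit Types (f g pi : {poly F}).

Definition polys n : seq {poly F} := [seq val v | v : {poly_n F}].

Lemma polys_uniq n : uniq (polys n).
Proof. by rewrite map_inj_uniq ?enum_uniq //; apply: val_inj. Qed.

Lemma mem_polys n g : (g \in polys n) = (size g <= n)%N.
Proof.
apply/mapP/idP => [[v _ ->]|szg]; first exact: size_npoly.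
by exists (NPoly szg); rewrite ?mem_enum.
Qed.

Lemma size_polys n : size (polys n) = (#|F| ^ n)%N.
Proof. by rewrite size_map -cardE card_npoly. Qed.

Definition monics n := [seq g <- polys n.+1 | (g \is monic) && (size g == n.+1)].

Lemma monics_uniq n : uniq (monics n).
Proof. exact/filter_uniq/polys_uniq. Qed.

Lemma mem_monics n g : (g \in monics n) = (g \is monic) && (size g == n.+1).
Proof. by rewrite mem_filter mem_polys andbC; case: eqP => [->|]; rewrite ?leqnn ?andbF. Qed.

Definition primes_le n := [seq g <- polys n.+1 | (g \is monic) && irreducibleb g].

Lemma primes_le_uniq n : uniq (primes_le n).
Proof. exact/filter_uniq/polys_uniq. Qed.

Definition prime_poly pi := (pi \is monic) && irreducibleb pi.

Lemma mem_primes_le n pi : (pi \in primes_le n) = prime_poly pi && (size pi <= n.+1)%N.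
Proof. by rewrite mem_filter mem_polys. Qed.

Definition deg pi := (size pi).-1.

Lemma prime_polyP pi : reflect (pi \is monic /\ irreducible_poly pi) (prime_poly pi).
Proof. by apply: (iffP andP) => -[? /irreducibleP]. Qed.

Lemma deg_prime_gt0 pi : prime_poly pi -> (0 < deg pi)%N.
Proof. by case/prime_polyP => _ [szpi _]; rewrite /deg; case: (size pi) szpi => [|[]]. Qed.

Lemma size_prime pi : prime_poly pi -> size pi = (deg pi).+1.
Proof. by case/prime_polyP => _ [szpi _]; rewrite /deg prednK // ltnW. Qed.

Lemma exists_prime_factor g : (1 < size g)%N -> exists2 pi, prime_poly pi & pi %| g.
Proof.
have [n] := ubnP (size g); elim: n g => // n IHn g lt_gn szg.
have [irr|/negP nirr] := boolP (irreducibleb g).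
  have g0 : g != 0 by rewrite -size_poly_gt0 ltnW.
  exists ((lead_coef g)^-1 *: g); last by rewrite dvdpZl ?invr_eq0 ?lead_coef_eq0.
  have l0 : (lead_coef g)^-1 != 0 by rewrite invr_eq0 lead_coef_eq0.
  apply/prime_polyP; split; first by rewrite monicE lead_coefZ mulVf // lead_coef_eq0.
  have /irreducibleP[h1 h2] := irr; split; first by rewrite size_scale.
  by move=> q szq; rewrite dvdpZr // => /(h2 _ szq) /eqp_trans; apply; rewrite eqp_sym eqp_scale.
move/negP: nirr; rewrite /irreducibleb szg /= => /forallPn[h].
rewrite negb_imply -ltnNge -Pdiv.Idomain.dvdpE => /andP[hg szh].
have lt_hg : (size h < size g)%N.
  by apply: leq_ltn_trans (size_npoly h) _; rewrite prednK // ltnW.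
have [pi pi_prime pih] := IHn h (leq_trans lt_hg lt_gn) szh.
by exists pi => //; apply: dvdp_trans pih hg.
Qed.

Lemma prime_dvd_eq pi rho : prime_poly pi -> prime_poly rho -> pi %| rho -> pi = rho.
Proof.
move=> /prime_polyP[mpi [szpi _]] /prime_polyP[mrho [_ irr]] pi_rho.
by apply/eqP; rewrite -eqp_monic // irr // gtn_eqF.
Qed.

Lemma prime_coprime pi g : prime_poly pi -> ~~ (pi %| g) -> coprimep pi g.
Proof. by case/prime_polyP => _ /irreducible_poly_coprime -> //. Qed.

Lemma prime_coprime_neq pi rho : prime_poly pi -> prime_poly rho -> pi != rho ->
  coprimep pi rho.
Proof.
by move=> ppi prho /eqP neq; apply: prime_coprime => //; apply/negP => /(prime_dvd_eq ppi prho).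
Qed.

Lemma size_monicM f g : f \is monic -> g \is monic -> size (f * g) = (deg f + deg g).+1.
Proof.
move=> mf mg; rewrite size_monicM ?monic_neq0 // /deg.
have := monic_neq0 mf; have := monic_neq0 mg; rewrite -!size_poly_gt0.
by case: (size f) => // a; case: (size g) => // b _ _; rewrite addnS.
Qed.

Lemma size_deg g : g \is monic -> size g = (deg g).+1.
Proof. by move=> mg; rewrite /deg prednK // size_poly_gt0 monic_neq0. Qed.

Lemma degM f g : f \is monic -> g \is monic -> deg (f * g) = (deg f + deg g)%N.
Proof. by move=> mf mg; rewrite /deg size_monicM. Qed.

Lemma degX f k : f \is monic -> deg (f ^+ k) = (k * deg f)%N.
Proof.
move=> mf; elim: k => [|k IHk]; first by rewrite expr0 /deg size_poly1.
by rewrite exprS degM ?monic_exp // IHk.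
Qed.

Lemma dvd_deg f g : f \is monic -> g \is monic -> f %| g -> (deg f <= deg g)%N.
Proof.
move=> mf mg fg; rewrite -ltnS -!size_deg //.
by apply: dvdp_leq => //; apply: monic_neq0.
Qed.

(** Factorization into primes in the only form needed: the multiplicity of pi is counted by the
    powers pi^j dividing g. Induction removes one prime factor at a time; the bound N keeps the
    ranges fixed meanwhile. *)
Lemma sum_prime_multiplicities N g : g \is monic -> (deg g <= N)%N ->
  (\sum_(pi <- primes_le N) (\sum_(1 <= j < N.+1) (pi ^+ j %| g)%R) * deg pi = deg g)%N.
Proof.
have [n] := ubnP (deg g); elim: n g => // n IHn g lt_gn mg gN.
have [sz1|sz1] := leqP (size g) 1.
  have -> : g = 1.
    apply/eqP; have := size_deg mg; rewrite -[_ == _]eqp_monic ?monic1 //.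
    by move=> E; rewrite -size_poly_eq1 E eqSS -leqn0 -ltnS -E.
  rewrite {2}/deg size_poly1 big_seq big1 // => pi; rewrite mem_primes_le => /andP[ppi _].
  rewrite big_nat big1 // => j /andP[j1 _]; apply/eqP; rewrite eqb0 dvdp1.
  have mpi : pi \is monic by case/prime_polyP: ppi.
  rewrite size_deg ?monic_exp // degX // eqSS muln_eq0 negb_or -!lt0n j1.
  exact: deg_prime_gt0.
have [rho prho /dvdpP[h Dg]] := exists_prime_factor sz1.
have mrho : rho \is monic by case/prime_polyP: prho.
have mh : h \is monic by move: mg; rewrite Dg monicMr.
have dg : deg g = (deg rho + deg h)%N by rewrite Dg degM // addnC.
have drho := deg_prime_gt0 prho.
have lt_hg : (deg h < deg g)%N by rewrite dg -[X in (X < _)%N]add0n ltn_add2r.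
rewrite dg -(IHn h) //; last 2 first.
- exact: leq_trans lt_hg _.
- exact: leq_trans (ltnW lt_hg) gN.
have rhoN : rho \in primes_le N.
  by rewrite mem_primes_le prho size_prime // ltnS (leq_trans _ gN) // dg leq_addr.
rewrite (bigD1_seq rho) ?primes_le_uniq //= (bigD1_seq rho (r := primes_le N)) ?primes_le_uniq //=.
rewrite addnA; congr (_ + _)%N; last first.
  rewrite big_seq_cond [RHS]big_seq_cond; apply: eq_bigr => pi /andP[].
  rewrite mem_primes_le => /andP[ppi _] neq; congr (_ * _)%N.
  apply: eq_bigr => j _; congr (nat_of_bool _); rewrite Dg Gauss_dvdpl //.
  by apply: coprimep_expl; apply: prime_coprime_neq.
rewrite -[X in (X + _)%N]mul1n -mulnDl; congr (_ * _)%N.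
(* The factor [rho] taken out of g accounts for j = 1; the other powers shift by one to [h], whose
   own term j = N vanishes for reasons of degree. *)
rewrite big_ltn ?ltnS ?(leq_trans _ gN) //; last by rewrite dg (leq_trans drho) // leq_addr.
rewrite expr1 Dg dvdp_mull ?dvdpp //; congr (_ + _)%N.
rewrite big_add1 /= big_nat_recr /=; last by rewrite (leq_trans _ gN) // (leq_ltn_trans _ lt_hg).
rewrite [X in (_ + X)%N](_ : _ = 0)%N ?addn0; last first.
  apply/eqP; rewrite eqb0; apply/negP => /dvd_deg; rewrite monic_exp // degX // => /(_ isT mh).
  apply/negP; rewrite -ltnNge (leq_trans lt_hg) // (leq_trans gN) //.
  by rewrite leq_pmulr.
apply: eq_big_nat => j /andP[j1 _]; congr (nat_of_bool _).
by rewrite exprS [h * _]mulrC dvdp_mul2l // monic_neq0.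
Qed.

Section Newton.
Variables (R : comNzRingType) (lam : {poly F} -> R).
Hypothesis lam1 : lam 1 = 1.
Hypothesis lamM : forall f g, f \is monic -> g \is monic -> lam (f * g) = lam f * lam g.

Definition Lcoef n := \sum_(g <- monics n) lam g.

(** The coefficient of T^k in T L'/L for the Euler product L of the factors 1 / (1 - lam(pi) T^(deg
    pi)). *)
Definition psum k := \sum_(pi <- primes_le k | (deg pi %| k)%N)
  lam pi ^+ (k %/ deg pi) *+ deg pi.

Lemma psum_widen n k : (0 < k <= n)%N ->
  psum k = \sum_(pi <- primes_le n | (deg pi %| k)%N) lam pi ^+ (k %/ deg pi) *+ deg pi.
Proof.
move=> /andP[k0 kn]; rewrite /psum -big_filter -[RHS]big_filter; apply: perm_big.
apply: uniq_perm; try exact/filter_uniq/primes_le_uniq.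
move=> pi.
rewrite mem_filter [RHS]mem_filter !mem_primes_le; case: dvdnP => //= -[j Dk]; congr (_ && _).
have [s0|s0] := posnP (size pi); first by rewrite s0.
have : (deg pi <= k)%N by rewrite dvdn_leq // Dk dvdn_mull.
by rewrite -(prednK s0) !ltnS -/(deg pi) => dk; rewrite dk (leq_trans dk).
Qed.

Lemma lamX f k : f \is monic -> lam (f ^+ k) = lam f ^+ k.
Proof.
by move=> mf; elim: k => [|k IHk]; rewrite ?expr0 // !exprS lamM ?monic_exp ?IHk.
Qed.

Lemma sum_multiples f n : f \is monic ->
  \sum_(g <- monics n | f %| g) lam g =
    if (deg f <= n)%N then lam f * Lcoef (n - deg f) else 0.
Proof.
move=> mf; case: leqP => [le_fn|lt_nf]; last first.
  rewrite big_seq_cond big_pred0 // => g; rewrite mem_monics.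
  apply/negP => /andP[/andP[mg /eqP szg] /(dvd_deg mf mg)].
  by rewrite [deg g]/deg szg leqNgt lt_nf.
rewrite /Lcoef big_distrr /= -[LHS]big_filter.
have mhP h : h \in monics (n - deg f) -> h \is monic by rewrite mem_monics => /andP[].
rewrite [LHS](reindex_seq _ (h := fun h => f * h) (s := monics (n - deg f))).
- by rewrite big_seq [RHS]big_seq; apply: eq_bigr => h /mhP mh; rewrite lamM.
- exact: monics_uniq.
- exact/filter_uniq/monics_uniq.
- move=> h; rewrite mem_monics => /andP[mh /eqP szh]; rewrite mem_filter mem_monics.
  rewrite dvdp_mulr ?dvdpp // monicMl // mh size_monicM // eqSS.
  by rewrite [deg h]/deg szh /= subnKC.
- by move=> h1 h2 _ _ /mulfI; apply; rewrite monic_neq0.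
move=> g; rewrite mem_filter mem_monics => /andP[/dvdpP[h Dg] /andP[mg szg]].
have mh : h \is monic by move: mg; rewrite Dg monicMr.
exists h; last by rewrite mulrC.
rewrite mem_monics mh size_deg // eqSS; move: szg.
by rewrite Dg size_monicM // eqSS => /eqP <-; rewrite addnK eqxx.
Qed.

(** Weight each monic g of degree n by its degree, written as a sum over the prime powers pi^j
    dividing g, and exchange the sums: the multiples of pi^j contribute lam(pi)^j times a lower
    coefficient. *)
Theorem newton n : Lcoef n *+ n = \sum_(k < n) Lcoef k * psum (n - k)%N.
Proof.
transitivity (\sum_(pi <- primes_le n) \sum_(1 <= j < n.+1)
    (\sum_(g <- monics n | pi ^+ j %| g) lam g) *+ deg pi).
  rewrite /Lcoef -sumrMnl.
  transitivity (\sum_(g <- monics n) \sum_(pi <- primes_le n) \sum_(1 <= j < n.+1)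
      (if pi ^+ j %| g then lam g *+ deg pi else 0)).
    rewrite big_seq [RHS]big_seq; apply: eq_bigr => g; rewrite mem_monics => /andP[mg /eqP szg].
    have dg : deg g = n by rewrite /deg szg.
    have E := @sum_prime_multiplicities n g mg; rewrite dg in E.
    rewrite -[in LHS](E (leqnn n)) -sumrMnr.
    apply: eq_bigr => pi _; rewrite mulnC mulrnA -sumrMnr; apply: eq_bigr => j _.
    by case: (_ %| _); rewrite ?mulr1n ?mulr0n.
  rewrite exchange_big; apply: eq_bigr => pi _; rewrite exchange_big.
  by apply: eq_bigr => j _; rewrite -sumrMnl -big_mkcond.
transitivity (\sum_(1 <= k < n.+1) Lcoef (n - k) * psum k); last first.
  rewrite big_add1 /= big_mkord (reindex_inj rev_ord_inj); apply: eq_bigr => i _ /=.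
  by rewrite subnSK // subKn // ltnW.
transitivity (\sum_(pi <- primes_le n) \sum_(1 <= k < n.+1 | (deg pi %| k)%N)
    Lcoef (n - k) * (lam pi ^+ (k %/ deg pi) *+ deg pi)); last first.
  under eq_bigr do rewrite big_mkcond.
  rewrite exchange_big; apply: eq_big_nat => k Hk.
  by rewrite (psum_widen Hk) mulr_sumr [RHS]big_mkcond.
rewrite big_seq [RHS]big_seq; apply: eq_bigr => pi; rewrite mem_primes_le => /andP[ppi _].
have mpi : pi \is monic by case/prime_polyP: ppi.
have d0 := deg_prime_gt0 ppi.
rewrite -[RHS]big_filter.
(* The multiples k of deg pi correspond to the exponents j = k / deg pi; powers pi^j of degree above
   n have no multiple of degree n. *)
rewrite [RHS](reindex_seq _ (h := fun j => (j * deg pi)%N)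
   (s := [seq j <- index_iota 1 n.+1 | (j * deg pi <= n)%N])).
- rewrite big_filter [RHS]big_mkcond; apply: eq_bigr => j _.
  rewrite sum_multiples ?monic_exp // degX // lamX // mulnK //.
  by case: ifP; rewrite ?mul0rn // mulrnAr mulrC.
- exact/filter_uniq/iota_uniq.
- exact/filter_uniq/iota_uniq.
- move=> j; rewrite !mem_filter !mem_index_iota => /andP[jn /andP[j1 _]].
  by rewrite dvdn_mull // muln_gt0 j1 d0 ltnS jn.
- by move=> i j _ _ /eqP; rewrite eqn_pmul2r // => /eqP.
move=> k; rewrite mem_filter mem_index_iota => /andP[/dvdnP[j ->] /andP[k1 kn]].
exists j => //; rewrite mem_filter mem_index_iota -ltnS kn /=.
move: k1; rewrite muln_gt0 => /andP[-> _] /=.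
by apply: leq_ltn_trans kn; rewrite leq_pmulr.
Qed.

Lemma Lcoef0 : Lcoef 0 = 1.
Proof.
rewrite /Lcoef (perm_big [:: 1]) /=; first by rewrite big_seq1.
apply: uniq_perm; rewrite ?monics_uniq // => g; rewrite inE mem_monics.
apply/andP/eqP => [[mg szg]|->]; last by rewrite monic1 size_poly1.
apply/eqP; rewrite -eqp_monic ?monic1 //.
by rewrite -size_poly_eq1.
Qed.

Lemma Lcoef1 : Lcoef 1 = \sum_(a : F) lam ('X - a%:P).
Proof.
rewrite /Lcoef (reindex_seq _ (h := fun a => 'X - a%:P) (s := enum F)) ?big_enum //=.
- exact: enum_uniq.
- exact: monics_uniq.
- by move=> a _; rewrite mem_monics monicXsubC size_XsubC.
- by move=> a b _ _ /addrI /oppr_inj /polyC_inj.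
move=> g; rewrite mem_monics => /andP[mg /eqP szg]; exists (- g`_0); rewrite ?mem_enum //.
apply/polyP => -[|[|i]]; rewrite coefB coefX coefC /= ?subr0 ?sub0r ?opprK //.
  by move/monicP: mg; rewrite lead_coefE szg.
by rewrite nth_default // szg.
Qed.

End Newton.

(** An injective self-map of a finite set permutes it, so the sum S satisfies S = w S. This is the
    source of every vanishing of higher coefficients. *)
Lemma Lcoef_eq0 (R : idomainType) (lam : {poly F} -> R) n (T : {poly F} -> {poly F}) w :
    {in monics n, forall g, T g \in monics n} -> {in monics n &, injective T} ->
    w != 1 -> {in monics n, forall g, lam (T g) = w * lam g} ->
  Lcoef lam n = 0.
Proof.
move=> stabT injT w1 lamT; have : Lcoef lam n = w * Lcoef lam n.
  rewrite {2}/Lcoef mulr_sumr big_seq -(eq_bigr _ lamT) -big_seq -(big_map T xpredT).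
  apply: perm_big; rewrite perm_sym; apply: uniq_perm; rewrite ?monics_uniq ?map_inj_in_uniq ?monics_uniq //.
  have u : uniq (map T (monics n)) by rewrite map_inj_in_uniq ?monics_uniq.
  have sub : {subset map T (monics n) <= monics n} by move=> _ /mapP[g gm ->]; apply: stabT.
  by have [] := uniq_min_size u sub; rewrite ?size_map.
move/eqP; rewrite -subr_eq0 -{1}[Lcoef _ _]mul1r -mulrBl mulf_eq0 subr_eq0 eq_sym (negPf w1).
by move/eqP.
Qed.

End Monics.

(** * Sums over a finite extension *)

Lemma expr_card_exp (F : finFieldType) (x : F) i : x ^+ (#|F| ^ i) = x.
Proof. by elim: i => [|i IHi]; rewrite ?expr1 // expnS exprM expf_card IHi. Qed.

Lemma prime_dvd_Xq (F : finFieldType) (pi : {poly F}) j : prime_poly pi ->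
  pi %| 'X^(#|F| ^ (j * deg pi)) - 'X.
Proof.
move=> /prime_polyP[mpi ipi]; have mi : monic_irreducible_poly pi by [].
have H : in_qpoly pi ('X^(#|F| ^ (j * deg pi)) - 'X) = 0.
  rewrite rmorphB rmorphXn /=.
  have := expr_card_exp (in_qpoly pi 'X : {poly %/ pi with mi}) j.
  by rewrite card_qfpoly -expnM mulnC => ->; rewrite subrr.
have /(congr1 val) /= := H; rewrite (mk_monicE mi) => H1.
by rewrite Pdiv.Idomain.dvdpE /Pdiv.CommonRing.rdvdp H1.
Qed.

Section Extension.
Variables (F E : finFieldType) (emb : {rmorphism F -> E}) (n : nat).
Hypothesis cardE : #|E| = (#|F| ^ n)%N.
Local Notation q := #|F|.
Local Notation "P ^i" := (map_poly emb P) (at level 2, format "P ^i").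
Implicit Types (P : {poly F}) (x y beta : E).

Lemma card_gt1 : (1 < q)%N.
Proof. exact: finNzRing_gt1. Qed.

Lemma ext_deg_gt0 : (0 < n)%N.
Proof. by have := finNzRing_gt1 E; rewrite cardE; case: n. Qed.

Lemma frobD x y i : (x + y) ^+ (q ^ i) = x ^+ (q ^ i) + y ^+ (q ^ i).
Proof.
have [p pr_p chF] := finPcharP F.
have chE : p \in [pchar E] by rewrite (fmorph_pchar emb).
apply: (exprDn_pchar _ _ (n := (q ^ i)%N)) => //.
rewrite pnatX; apply/orP; left.
by rewrite (eq_pnat _ (pcharf_eq chE)) (card_pprimeChar chF) pnatX pnat_id.
Qed.

Lemma frob_inj i : injective (fun x => x ^+ (q ^ i)).
Proof.
move=> x y /= exy; apply/eqP; rewrite -subr_eq0.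
have : (x - y) ^+ (q ^ i) == 0.
  apply/eqP/(addIr (y ^+ (q ^ i))).
  by rewrite -frobD subrK add0r.
by rewrite expf_eq0 => /andP[].
Qed.

Lemma frob_horner P beta i : (P^i.[beta]) ^+ (q ^ i) = P^i.[beta ^+ (q ^ i)].
Proof.
elim/poly_ind: P => [|P c IHP].
  by rewrite rmorph0 !horner0 expr0n expn_eq0 gtn_eqF // ltnW // card_gt1.
rewrite rmorphD rmorphM /= map_polyX map_polyC !hornerE frobD exprMn IHP.
by rewrite -[in LHS]rmorphXn expr_card_exp.
Qed.

Lemma root_prime_dvd pi P beta : prime_poly pi -> root pi^i beta -> root P^i beta -> pi %| P.
Proof.
move=> ppi rpi rP; apply: contraT => /(prime_coprime ppi).
rewrite -(coprimep_map emb) => /coprimep_root /(_ rpi).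
by rewrite -rootE rP.
Qed.

Lemma root_prime_period pi beta : prime_poly pi -> root pi^i beta ->
  beta ^+ (q ^ deg pi) = beta.
Proof.
move=> /(prime_dvd_Xq 1); rewrite mul1n => /dvdpP[Q DQ] rpi; apply/eqP; rewrite -subr_eq0.
have : ('X^(q ^ deg pi) - 'X)^i.[beta] = 0 by rewrite DQ rmorphM hornerM (rootP rpi) mulr0.
by rewrite rmorphB /= map_polyXn map_polyX !hornerE => ->.
Qed.

(** The polynomials of size at most deg pi take q^(deg pi) distinct values at beta, all of them
    roots of X^(q^i) - X. *)
Lemma root_prime_min pi beta i : prime_poly pi -> root pi^i beta -> (0 < i)%N ->
  beta ^+ (q ^ i) = beta -> (deg pi <= i)%N.
Proof.
move=> ppi rpi i_gt0 beta_i.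
rewrite -(leq_exp2l _ _ card_gt1) -size_polys -ltnS.
have szX : size ('X^(q ^ i) - 'X : {poly E}) = (q ^ i).+1.
  rewrite size_polyDl size_polyXn // size_polyN size_polyX ltnS.
  by apply: leq_trans card_gt1 _; rewrite -{1}(expn1 q) leq_exp2l // card_gt1.
rewrite -szX -(size_map (fun P => P^i.[beta])); apply: max_poly_roots.
- by rewrite -size_poly_eq0 szX.
- apply/allP => _ /mapP[P _ ->].
  by rewrite rootE !hornerE frob_horner beta_i subrr.
rewrite map_inj_in_uniq ?polys_uniq // => P Q.
rewrite !mem_polys => szP szQ PQ; apply/eqP; rewrite -subr_eq0.
apply: contraT => PQ0.
have /dvdp_leq : pi %| P - Q.
  by apply: root_prime_dvd ppi rpi _; rewrite rootE rmorphB hornerD hornerN PQ subrr.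
move=> /(_ PQ0); rewrite size_prime // => /leq_trans /(_ (size_polyD _ _)).
by rewrite size_polyN leq_max ltnNge szP ltnNge szQ.
Qed.

Lemma root_prime_deg pi beta : prime_poly pi -> root pi^i beta -> (deg pi %| n)%N.
Proof.
move=> ppi rpi; rewrite /dvdn; have [//|r_gt0] := posnP (n %% deg pi).
have Hper := root_prime_period ppi rpi.
have H j : beta ^+ (q ^ (j * deg pi)) = beta.
  by elim: j => [|j IHj]; rewrite ?expr1 // mulSn expnD exprM Hper IHj.
have : beta ^+ (q ^ (n %% deg pi)) = beta.
  by rewrite -{1}(H (n %/ deg pi)%N) -exprM -expnD -divn_eq -cardE expf_card.
move/(root_prime_min ppi rpi r_gt0); rewrite leqNgt ltn_mod.
by rewrite deg_prime_gt0.
Qed.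

(** Here pi divides X^#|E| - X, the product of the X - x over E, so it cannot be coprime to all
    these factors. *)
Lemma exists_root_prime pi : prime_poly pi -> (deg pi %| n)%N -> exists beta, root pi^i beta.
Proof.
move=> ppi /dvdnP[j Dn]; have := prime_dvd_Xq j ppi.
rewrite -Dn -cardE -(dvdp_map emb) rmorphB /= map_polyXn map_polyX finField_genPoly.
move=> dvdX; apply/existsP; apply: contraT; rewrite negb_exists => /forallP noroot.
have : coprimep pi^i (\prod_(x : E) ('X - x%:P)).
  elim/big_ind: _ => [|f g cf cg|x _]; first exact: coprimep1.
    by rewrite coprimepMr cf.
  by rewrite coprimep_XsubC noroot.
move/(coprimep_dvdl dvdX); rewrite coprimepp size_map_poly => /eqP sz1.
by case/prime_polyP: ppi => _ []; rewrite sz1.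
Qed.

Lemma conjugates_uniq pi beta : prime_poly pi -> root pi^i beta ->
  uniq [seq beta ^+ (q ^ i) | i <- iota 0 (deg pi)].
Proof.
move=> ppi rpi.
have H i j : (i < j < deg pi)%N -> beta ^+ (q ^ i) != beta ^+ (q ^ j).
  move=> /andP[ij je]; apply/eqP; rewrite -(subnK (ltnW ij)) expnD exprM.
  move/frob_inj => /esym /(root_prime_min ppi rpi); rewrite subn_gt0 => /(_ ij).
  by rewrite leqNgt (leq_ltn_trans _ je) // leq_subr.
rewrite map_inj_in_uniq ?iota_uniq // => i j; rewrite !mem_iota !add0n => ie je eij.
apply/eqP; case: ltngtP => // ij.
  by have := H i j; rewrite ij eij eqxx => /(_ je).
by have := H j i; rewrite ij eij eqxx => /(_ ie).
Qed.

Lemma root_conjugate pi beta i : root pi^i beta -> root pi^i (beta ^+ (q ^ i)).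
Proof. by move=> /rootP r; rewrite rootE -frob_horner r expr0n expn_eq0 gtn_eqF // ltnW // card_gt1. Qed.

Lemma prime_split pi beta : prime_poly pi -> root pi^i beta ->
  pi^i = \prod_(i < deg pi) ('X - (beta ^+ (q ^ i))%:P).
Proof.
move=> ppi rpi; rewrite -(big_mkord xpredT (fun i => 'X - (beta ^+ (q ^ i))%:P)).
rewrite /index_iota subn0 -(big_map (fun i => beta ^+ (q ^ i)) xpredT (fun x => 'X - x%:P)).
set rs := map _ _.
have mpi : pi^i \is monic by rewrite map_monic; case/prime_polyP: ppi.
rewrite [LHS](@all_roots_prod_XsubC _ _ rs).
- by rewrite (monicP mpi) scale1r.
- by rewrite size_map_poly size_prime // size_map size_iota.
- by apply/allP => _ /mapP[i _ ->]; apply: root_conjugate.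
by rewrite uniq_rootsE conjugates_uniq.
Qed.

Lemma card_roots pi : prime_poly pi -> (deg pi %| n)%N ->
  #|[pred beta | root pi^i beta]| = deg pi.
Proof.
move=> ppi /(exists_root_prime ppi)[beta rpi].
set rs := [seq beta ^+ (q ^ i) | i <- iota 0 (deg pi)].
have -> : deg pi = size rs by rewrite size_map size_iota.
rewrite -(card_uniqP (conjugates_uniq ppi rpi)); apply: eq_card => x; rewrite !inE.
rewrite (prime_split ppi rpi) -(big_mkord xpredT (fun i => 'X - (beta ^+ (q ^ i))%:P)).
rewrite /index_iota subn0 -(big_map (fun i => beta ^+ (q ^ i)) xpredT (fun x => 'X - x%:P)).
by rewrite root_prod_XsubC.
Qed.

(** This power of pi is the characteristic polynomial of beta over F: its value at a is the norm of
    a - beta. *)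
Lemma prime_split_pow pi beta : prime_poly pi -> root pi^i beta ->
  (pi ^+ (n %/ deg pi))^i = \prod_(i < n) ('X - (beta ^+ (q ^ i))%:P).
Proof.
move=> ppi rpi; have /dvdnP[j Dn] := root_prime_deg ppi rpi.
have per := root_prime_period ppi rpi.
rewrite Dn mulnK ?deg_prime_gt0 // rmorphXn /= (prime_split ppi rpi).
rewrite -!(big_mkord xpredT (fun i => 'X - (beta ^+ (q ^ i))%:P)).
elim: j {Dn} => [|j IHj]; first by rewrite mul0n big_nil.
rewrite exprS IHj mulSn [RHS](@big_cat_nat _ _ _ (deg pi)) ?leq_addr //=; congr (_ * _).
rewrite -[X in _ = \big[_/_]_(X <= _ < _) _]add0n big_addn addKn.
by apply: eq_bigr => i _; rewrite addnC expnD exprM per.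
Qed.

Lemma exists_min_prime beta : exists2 pi, prime_poly pi & root pi^i beta.
Proof.
have: exists2 P, P != 0 & root P^i beta.
  exists ('X^(q ^ n) - 'X).
    rewrite -size_poly_eq0 size_polyDl size_polyXn // size_polyN size_polyX ltnS.
    by apply: leq_trans card_gt1 _; rewrite -{1}(expn1 q) leq_exp2l ?card_gt1 // ext_deg_gt0.
  by rewrite rootE rmorphB /= map_polyXn map_polyX !hornerE -cardE expf_card subrr.
case=> P; have [k] := ubnP (size P); elim: k P => // k IHk P ltk P0 rP.
have szP : (1 < size P)%N.
  rewrite ltnNge; apply/negP => /size1_polyC DP; move: rP P0.
  by rewrite DP map_polyC rootC fmorph_eq0 polyC_eq0 => /eqP->; rewrite eqxx.
have [pi ppi /dvdpP[Q DP]] := exists_prime_factor szP.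
have [rpi|] := boolP (root pi^i beta); first by exists pi.
have Q0 : Q != 0 by apply: contraNneq P0 => Q0; rewrite DP Q0 mul0r.
move=> nrpi; apply: (IHk Q) => //; last first.
  by move: rP; rewrite DP rmorphM rootM (negPf nrpi) orbF.
move: ltk; rewrite DP size_mul // ?monic_neq0 //; last by case/prime_polyP: ppi.
rewrite (size_prime ppi) addnS /= ltnS; apply: leq_trans.
by rewrite -addn1 leq_add2l deg_prime_gt0.
Qed.

Lemma sum_over_primes (V : nmodType) (G : E -> V) :
  \sum_beta G beta =
  \sum_(pi <- primes_le F n | (deg pi %| n)%N) \sum_(beta | root pi^i beta) G beta.
Proof.
under [RHS]eq_bigr do rewrite big_mkcond.
rewrite exchange_big; apply: eq_bigr => beta _ /=.
have [pi ppi rpi] := exists_min_prime beta.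
have dpi := root_prime_deg ppi rpi.
rewrite big_mkcond (bigD1_seq pi) ?primes_le_uniq //=; last first.
  by rewrite mem_primes_le ppi size_prime // ltnS dvdn_leq // ext_deg_gt0.
rewrite dpi rpi big_seq_cond big1 ?addr0 // => rho /andP[].
rewrite mem_primes_le => /andP[prho _] /eqP neq; case: ifP => // _; case: ifP => // rrho.
by case: neq; apply/esym/(prime_dvd_eq ppi prho)/(root_prime_dvd ppi rpi).
Qed.

(** Group the elements of E by minimal polynomial. A prime pi of degree dividing n has deg pi roots,
    which is its weight in [psum]. *)
Lemma psum_ext (R : comNzRingType) (lam : {poly F} -> R) (Lam : E -> R) :
    (forall pi beta, prime_poly pi -> root pi^i beta -> Lam beta = lam pi ^+ (n %/ deg pi)) ->
  psum lam n = \sum_beta Lam beta.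
Proof.
move=> H; rewrite sum_over_primes /psum big_seq_cond [RHS]big_seq_cond.
apply: eq_bigr => pi; rewrite mem_primes_le => /andP[/andP[ppi _] dpi].
rewrite (eq_bigr (fun=> lam pi ^+ (n %/ deg pi))) => [|beta rb]; last exact: H.
by rewrite sumr_const card_roots.
Qed.

End Extension.

(** * Jacobi sums and their lifts *)

(** Every character, the trivial one included, vanishes at 0; the constant function 1 is not a
    [mult_char]. *)
Record mult_char (E : finFieldType) (chi : E -> algC) : Prop := MultChar {
  mchar0 : chi 0 = 0;
  mchar1 : chi 1 = 1;
  mcharM : {morph chi : x y / x * y} }.

Definition nontrivial (E : finFieldType) (chi : E -> algC) :=
  exists2 c, c != 0 & chi c != 1.

Section Characters.
Variable E : finFieldType.
Implicit Types (chi psi : E -> algC) (x y : E).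

Lemma mcharX chi x k : mult_char chi -> chi (x ^+ k) = chi x ^+ k.
Proof.
by case=> _ chi1 chiM; elim: k => [|k IHk]; rewrite ?expr0 // !exprS chiM IHk.
Qed.

Lemma mcharV chi x : mult_char chi -> x != 0 -> chi x^-1 * chi x = 1.
Proof. by case=> _ chi1 chiM x0; rewrite -chiM mulVf. Qed.

Lemma mchar_neq0 chi x : mult_char chi -> x != 0 -> chi x != 0.
Proof.
move=> mc x0; have := mcharV mc x0; apply: contra_eq_neq => ->.
by rewrite mulr0 eq_sym oner_neq0.
Qed.

Lemma mult_charM chi psi : mult_char chi -> mult_char psi ->
  mult_char (fun x => chi x * psi x).
Proof.
case=> c0 c1 cM [p0 p1 pM]; split; rewrite ?c0 ?mul0r ?c1 ?p1 ?mulr1 //.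
by move=> x y; rewrite cM pM mulrACA.
Qed.

Lemma sum_scale chi c : c != 0 -> \sum_x chi x = \sum_x chi (c * x).
Proof.
move=> c0; rewrite (reindex_inj (h := fun x => c * x)) //.
exact: mulfI.
Qed.

Lemma sum_nontrivial chi : mult_char chi -> nontrivial chi -> \sum_x chi x = 0.
Proof.
move=> mc [c c0 c1]; have /eqP := sum_scale chi c0.
under [X in _ == X -> _]eq_bigr do rewrite (mcharM mc).
rewrite -mulr_sumr -subr_eq0 -{1}[\sum_x _]mul1r -mulrBl mulf_eq0 subr_eq0 eq_sym.
by rewrite (negPf c1) => /eqP.
Qed.

Definition jacobi2 chi psi := \sum_x chi x * psi (1 - x).

Definition jacobi3 chi := \sum_x \sum_y chi x * chi y * chi (1 - x - y).

End Characters.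

Section Lift.
Variables (F E : finFieldType) (emb : {rmorphism F -> E}) (n : nat).
Hypothesis cardE : #|E| = (#|F| ^ n)%N.
Local Notation q := #|F|.
Local Notation "P ^i" := (map_poly emb P) (at level 2, format "P ^i").

(** Composition with the norm of E over F. The norm is described by its image in E, so no map from E
    down to F has to be built. *)
Definition lifts (chi : F -> algC) (chiE : E -> algC) :=
  forall x w, emb w = \prod_(i < n) x ^+ (q ^ i) -> chiE x = chi w.

Lemma eval_split pi beta (a : F) : prime_poly pi -> root pi^i beta ->
  emb ((pi ^+ (n %/ deg pi)).[a]) = \prod_(i < n) (emb a - beta) ^+ (q ^ i).
Proof.
move=> ppi rpi; rewrite -horner_map (prime_split_pow cardE ppi rpi) horner_prod.
apply: eq_bigr => i _; rewrite hornerXsubC.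
have := frob_horner emb (a%:P - 'X) beta i.
by rewrite rmorphB /= map_polyX map_polyC !hornerE => ->.
Qed.

Lemma liftsM chi psi chiE psiE : lifts chi chiE -> lifts psi psiE ->
  lifts (fun x => chi x * psi x) (fun x => chiE x * psiE x).
Proof. by move=> Hc Hp x w xw; rewrite (Hc _ w) // (Hp _ w). Qed.

(** Since X - a takes the value -a at 0, the L-function carries a sign: it is 1 + chi(-1) J T. The
    factor chi(-1)^n is cancelled at the end. *)
Theorem jacobi2_lift chi psi chiE psiE : mult_char chi -> mult_char psi ->
    mult_char chiE ->
    nontrivial chi -> lifts chi chiE -> lifts psi psiE ->
  jacobi2 chiE psiE = - (- jacobi2 chi psi) ^+ n.
Proof.
move=> mchi mpsi mchiE [c c0 c1] lchi lpsi.
pose lam (g : {poly F}) := chi g.[0] * psi g.[1].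
have lam1 : lam 1 = 1 by rewrite /lam !hornerE (mchar1 mchi) (mchar1 mpsi) mulr1.
have lamM f g : f \is monic -> g \is monic -> lam (f * g) = lam f * lam g.
  by move=> _ _; rewrite /lam !hornerM (mcharM mchi) (mcharM mpsi) mulrACA.
have chiNE x : chi (- x) = chi (-1) * chi x by rewrite -(mcharM mchi) mulN1r.
have L1 : Lcoef lam 1 = chi (-1) * jacobi2 chi psi.
  rewrite Lcoef1 /jacobi2 mulr_sumr; apply: eq_bigr => a _.
  by rewrite /lam !hornerXsubC sub0r chiNE mulrA.
have L2 k : Lcoef lam k.+2 = 0.
  (* The polynomial 1 - X is 1 at 0 and 0 at 1, so T multiplies g(0) by b and keeps g(1). Being of
     degree 1, it does not affect the leading term of a g of degree at least 2. *)
  pose T (b : F) (g : {poly F}) := g + ((b - 1) * g.[0]) *: (1 - 'X).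
  have T0 b g : (T b g).[0] = b * g.[0] by rewrite /T !hornerE; ring.
  have T1 b g : (T b g).[1] = g.[1] by rewrite /T !hornerE; ring.
  have szT (b : F) (g : {poly F}) : (size (((b - 1) * g.[0]) *: (1 - 'X)) <= 2)%N.
    rewrite (leq_trans (size_scale_leq _ _)) // -opprB size_polyN.
    by rewrite -[1]/(1%:P) size_XsubC.
  apply: (@Lcoef_eq0 _ _ _ _ (T c) (chi c)) => //.
  - move=> g; rewrite !mem_monics => /andP[mg /eqP szg].
    have lt_T : (size (((c - 1) * g.[0]) *: (1 - 'X)) < size g)%N.
      by rewrite szg ltnS (leq_trans (szT _ _)).
    by rewrite monicE lead_coefDl // size_polyDl // szg -monicE mg eqxx.
  - move=> g h _ _ Tgh.
    have gh0 : g.[0] = h.[0] by apply: (mulfI c0); rewrite -!T0 Tgh.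
    by apply: (addIr (((c - 1) * g.[0]) *: (1 - 'X))); rewrite {2}gh0.
  by move=> g _; rewrite /lam T0 T1 (mcharM mchi) mulrA.
have Hnewton : logder n (1 - (- Lcoef lam 1) *: 'X) (psum lam).
  have LE : forall k, (1 - (- Lcoef lam 1) *: 'X)`_k = Lcoef lam k.
    move=> [|[|k]]; rewrite scaleNr opprK coefD coef1 coefZ coefX /=.
    - by rewrite mulr0 addr0 Lcoef0.
    - by rewrite mulr1 add0r.
    by rewrite mulr0 addr0 L2.
  by move=> m _; rewrite LE newton //; apply: eq_bigr => i _; rewrite LE.
have n_gt0 := ext_deg_gt0 cardE.
have := logder_coef_uniq _ Hnewton (@logder_linear _ n _).
move=> /(_ _ n); rewrite n_gt0 leqnn => /(_ _ isT) psumE.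
have {}psumE : psum lam n = - (- Lcoef lam 1) ^+ n.
  by apply: psumE; rewrite scaleNr opprK coefD coef1 coefZ coefX mulr0 addr0.
have sumE : psum lam n = \sum_beta chiE (- beta) * psiE (1 - beta).
  apply: (psum_ext (emb := emb) cardE) => pi beta ppi rpi.
  have [mpi _] := prime_polyP _ ppi.
  rewrite -(lamX lam1 lamM) // /lam; congr (_ * _).
    by apply: lchi; rewrite (eval_split _ ppi rpi) rmorph0 sub0r.
  by apply: lpsi; rewrite (eval_split _ ppi rpi) rmorph1.
have chiEN1 : chiE (-1) = chi (-1) ^+ n.
  rewrite (lchi (-1) ((-1) ^+ n)) ?(mcharX _ _ mchi) //.
  rewrite rmorphXn rmorphN1 -[in LHS](card_ord n) -prodr_const.
  by apply: eq_bigr => i _; have := frob_horner emb (-1) 0 i; rewrite rmorphN1 !hornerE.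
have chiN1 : chi (-1) != 0 by rewrite mchar_neq0 // oppr_eq0 oner_eq0.
apply: (mulfI (expf_neq0 n chiN1)).
rewrite mulrN -exprMn mulrN -L1 -psumE sumE -chiEN1 mulr_sumr.
by apply: eq_bigr => x _; rewrite mulrA -(mcharM mchiE) mulN1r.
Qed.

End Lift.

Definition trivial_char (E : finFieldType) (chi : E -> algC) := forall x, x != 0 -> chi x = 1.

Section JacobiSums.
Variable E : finFieldType.
Implicit Types (chi psi : E -> algC) (x y : E).

Lemma mcharN chi x : mult_char chi -> chi (- x) = chi (-1) * chi x.
Proof. by move=> mc; rewrite -(mcharM mc) mulN1r. Qed.

Lemma mcharN1_sq chi : mult_char chi -> chi (-1) * chi (-1) = 1.
Proof. by move=> mc; rewrite -(mcharM mc) mulrNN mulr1 (mchar1 mc). Qed.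

Lemma sum_trivial chi : mult_char chi -> trivial_char chi -> \sum_x chi x = #|E|%:R - 1.
Proof.
move=> mc tc; rewrite (bigD1 0) //= (mchar0 mc) add0r.
rewrite (eq_bigr (fun=> 1)); last by move=> x /tc.
have := cardC1 (0 : E); rewrite sumr_const => ->.
by rewrite -subn1 natrB // ltnW // finNzRing_gt1.
Qed.

Lemma jacobi2_trivialr chi psi : mult_char chi -> mult_char psi ->
  nontrivial chi -> trivial_char psi -> jacobi2 chi psi = -1.
Proof.
move=> mc mp nc tp; rewrite /jacobi2 (bigD1 1) //= subrr (mchar0 mp) mulr0 add0r.
rewrite (eq_bigr chi); last first.
  by move=> x x1; rewrite tp ?mulr1 // subr_eq0 eq_sym.
have := sum_nontrivial mc nc; rewrite (bigD1 1) //= (mchar1 mc) => /eqP.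
by rewrite addrC addr_eq0 => /eqP.
Qed.

(** With x = 1/u the summand becomes psi(u - 1). The full sum of psi is 0, and only u = 0 is
    missing. *)
Lemma jacobi2_inverse chi psi : mult_char chi -> mult_char psi -> nontrivial psi ->
  trivial_char (fun x => chi x * psi x) -> jacobi2 chi psi = - psi (-1).
Proof.
move=> mc mp np tcp; rewrite /jacobi2 (reindex_inj invr_inj) /= (bigD1 0) //=.
rewrite invr0 (mchar0 mc) mul0r add0r (eq_bigr (fun u => psi (u - 1))).
  have := sum_nontrivial mp np; rewrite (reindex_inj (addIr (-1))) (bigD1 0) //= => /eqP.
  by rewrite add0r addrC addr_eq0 => /eqP.
move=> u u0; have -> : 1 - u^-1 = u^-1 * (u - 1) by rewrite mulrBr mulVf ?mulr1.
by rewrite (mcharM mp) mulrA tcp ?mul1r // invr_eq0.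
Qed.

(** For x != 1 the substitution of (1 - x) y for y splits off the factor J(chi, chi) and leaves
    chi^2(1 - x); the last summand is the contribution of x = 1. *)
Lemma jacobi3_eq chi : mult_char chi ->
  jacobi3 chi = jacobi2 chi chi * jacobi2 chi (fun x => chi x * chi x)
    + chi (-1) * \sum_y chi y * chi y.
Proof.
move=> mc; rewrite /jacobi3 (bigD1 1) //= addrC; congr (_ + _); last first.
  rewrite mulr_sumr; apply: eq_bigr => y _.
  by rewrite (mchar1 mc) subrr sub0r (mcharN y mc) mul1r mulrCA.
rewrite {2}/jacobi2 mulr_sumr [RHS](bigD1 1) //= subrr (mchar0 mc) !mulr0 add0r.
apply: eq_bigr => x x1; have x1' : 1 - x != 0 by rewrite subr_eq0 eq_sym.
rewrite (reindex_inj (mulfI x1')) /= /jacobi2 mulr_suml; apply: eq_bigr => y _.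
have -> : 1 - x - (1 - x) * y = (1 - x) * (1 - y) by ring.
rewrite !(mcharM mc); ring.
Qed.

Lemma jacobi3_square_nontrivial chi : mult_char chi -> nontrivial (fun x => chi x * chi x) ->
  jacobi3 chi = jacobi2 chi chi * jacobi2 chi (fun x => chi x * chi x).
Proof.
by move=> mc nc; rewrite jacobi3_eq // (sum_nontrivial (mult_charM mc mc)) // mulr0 addr0.
Qed.

(** The quadratic character is the exception to the product formula: the sum of chi^2 is #|E| - 1
    instead of 0. *)
Lemma jacobi3_square_trivial chi : mult_char chi -> nontrivial chi ->
  trivial_char (fun x => chi x * chi x) -> chi (-1) * jacobi3 chi = #|E|%:R.
Proof.
move=> mc nc tc; have mc2 := mult_charM mc mc.
rewrite jacobi3_eq // (sum_trivial mc2 tc) (jacobi2_trivialr mc mc2) //.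
rewrite (jacobi2_inverse mc mc) // mulrNN mulr1 -{2}[chi (-1)]mulr1 -mulrDr mulrA mcharN1_sq //.
by rewrite mul1r addrCA subrr addr0.
Qed.

(** The two-variable sum on the right is what a cubic character contributes to the point count of
    the fibre at infinity; the opposite sign is what excludes d/3 and 2d/3 from Z_d. *)
Lemma jacobi3_cubic chi : mult_char chi -> nontrivial (fun x => chi x * chi x) ->
  trivial_char (fun x => chi x * (chi x * chi x)) ->
  chi (-1) * jacobi3 chi = - (chi (-1) * jacobi2 chi chi).
Proof.
move=> mc nc tc; rewrite jacobi3_square_nontrivial //.
by rewrite (jacobi2_inverse mc (mult_charM mc mc)) // (mcharN1_sq mc) mulrN1 mulrN.
Qed.

End JacobiSums.

(** If chi^2 is nontrivial, the sum is a product of two two-variable sums, and the signs of their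
    lifts cancel. If chi is quadratic, both sides are cardinals. *)
Theorem jacobi3_lift (F E : finFieldType) (emb : {rmorphism F -> E}) n
    (chi : F -> algC) (chiE : E -> algC) :
    #|E| = (#|F| ^ n)%N -> mult_char chi -> mult_char chiE ->
    nontrivial chi -> nontrivial chiE -> lifts emb n chi chiE ->
    (nontrivial (fun x => chi x * chi x) /\ nontrivial (fun x => chiE x * chiE x)) \/
    (trivial_char (fun x => chi x * chi x) /\ trivial_char (fun x => chiE x * chiE x)) ->
  chiE (-1) * jacobi3 chiE = (chi (-1) * jacobi3 chi) ^+ n.
Proof.
move=> cardE mc mcE nc ncE lc [[n2 n2E]|[t2 t2E]]; last first.
  by rewrite !jacobi3_square_trivial // cardE natrX.
have chiEN1 : chiE (-1) = chi (-1) ^+ n.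
  rewrite (lc (-1) ((-1) ^+ n)) ?(mcharX _ _ mc) //.
  rewrite rmorphXn rmorphN1 -[in LHS](card_ord n) -prodr_const.
  by apply: eq_bigr => i _; have := frob_horner emb (-1) 0 i; rewrite rmorphN1 !hornerE.
rewrite !jacobi3_square_nontrivial //.
rewrite (jacobi2_lift cardE mc mc mcE nc lc lc).
rewrite (jacobi2_lift cardE mc (mult_charM mc mc) mcE nc lc (liftsM lc lc)).
by rewrite mulrNN -exprMn mulrNN chiEN1 -exprMn.
Qed.

Lemma card_sumr (T : finType) (P : pred T) : #|[pred x | P x]|%:R = \sum_x (P x)%:R :> algC.
Proof.
rewrite -sum1_card natr_sum big_mkcond /=; apply: eq_bigr => x _.
by rewrite inE; case: (P x).
Qed.

(** * Point counts through Jacobi sums *)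

Section PointCounts.
Variables (E : finFieldType) (d : nat) (I : finType) (P : pred I) (chi : I -> E -> algC).
Hypothesis mchi : forall i, P i -> mult_char (chi i).
Hypothesis nchi : forall i, P i -> nontrivial (chi i).
Hypothesis power_count : forall a, #|[pred t : E | t ^+ d == a]|%:R = 1 + \sum_(i | P i) chi i a.

(* With x = ac and y = ac^2 one has y + x - x^3/y = ac(1 + c - a), and
   (-c) + a + (1 + c - a) = 1. *)
Lemma sum_to_jacobi3 (psi : E -> algC) : mult_char psi -> nontrivial psi ->
  \sum_x \sum_(y | y != 0) psi (y + x - x ^+ 3 / y) = psi (-1) * jacobi3 psi.
Proof.
move=> mpsi npsi; rewrite (bigD1 0) //= (eq_bigr psi) ?add0r; last first.
  by move=> y y0; rewrite addr0 expr0n mul0r subr0.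
have := sum_nontrivial mpsi npsi; rewrite (bigD1 0) //= (mchar0 mpsi) add0r => ->.
rewrite add0r exchange_big /=.
have -> : jacobi3 psi = \sum_(c | c != 0) \sum_a psi (- c) * psi a * psi (1 - - c - a).
  rewrite /jacobi3 (reindex_inj oppr_inj) /= (bigD1 0) //= big1 ?add0r // => y _.
  by rewrite oppr0 (mchar0 mpsi) !mul0r.
transitivity (\sum_(c | c != 0) \sum_(a | a != 0) psi (a * c * (1 + c - a))).
  rewrite exchange_big /=.
  transitivity (\sum_(x | x != 0) \sum_(c | c != 0) psi (c * x + x - x ^+ 2 / c)).
    apply: eq_bigr => x x0; rewrite (reindex_inj (mulIf x0)) /=.
    apply: eq_big => [c|c]; first by rewrite mulf_eq0 (negPf x0) orbF.
    rewrite mulf_eq0 (negPf x0) orbF => c0; congr (psi _); field.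
    by rewrite c0.
  rewrite exchange_big [RHS]exchange_big /= [RHS]exchange_big /=; apply: eq_bigr => c c0.
  rewrite (reindex_inj (mulIf c0)) /=; apply: eq_big => a.
    by rewrite mulf_eq0 (negPf c0) orbF.
  by move=> _; congr (psi _); field.
rewrite mulr_sumr; apply: eq_bigr => c c0.
rewrite mulr_sumr [RHS](bigD1 0) //= (mchar0 mpsi) mulr0 mul0r mulr0 add0r.
apply: eq_bigr => a a0; rewrite opprK !(mcharM mpsi) (mcharN c mpsi).
rewrite -[psi a * psi c * _]mul1r -(mcharN1_sq mpsi); ring.
Qed.

(** For y != 0 the equation is t^d = y + x - x^3/y, and the solutions t are counted by characters.
    For y = 0 it forces x = 0 and leaves t free; these #|E| points complete #|E| (#|E| - 1) to a
    square. *)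
Lemma count_curve_family :
  \sum_t #|[pred z : E * E | z.2 ^+ 2 + z.1 * z.2 - t ^+ d * z.2 == z.1 ^+ 3]|%:R =
  #|E|%:R ^+ 2 + \sum_(i | P i) chi i (-1) * jacobi3 (chi i).
Proof.
have card0 : \sum_(y : E | y != 0) 1 = #|E|%:R - 1 :> algC.
  have := cardC1 (0 : E); rewrite sumr_const => ->.
  by rewrite -subn1 natrB // ltnW // finNzRing_gt1.
transitivity (\sum_x (\sum_(t : E) (0 == x ^+ 3)%:R + \sum_(y | y != 0)
    (1 + \sum_(i | P i) chi i (y + x - x ^+ 3 / y)))).
  under eq_bigr do rewrite card_sumr.
  rewrite exchange_big /=.
  rewrite -(pair_bigA _ (fun x y =>
    \sum_t (y ^+ 2 + x * y - t ^+ d * y == x ^+ 3)%:R)) /=.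
  apply: eq_bigr => x _; rewrite (bigD1 0) //=; congr (_ + _).
    by apply: eq_bigr => t _; rewrite expr0n !mulr0 subr0 addr0.
  apply: eq_bigr => y y0; rewrite -power_count card_sumr; apply: eq_bigr => t _.
  by congr ((_ : bool)%:R); apply/eqP/eqP => [<-|->]; field.
rewrite big_split /=.
rewrite (eq_bigr (fun x : E => (x == 0)%:R * #|E|%:R)); last first.
  by move=> x _; rewrite sumr_const eq_sym expf_eq0 mulr_natr; congr (_ *+ _); apply: eq_card. 
rewrite -mulr_suml (bigD1 0) //= eqxx big1 ?addr0 ?mul1r; last by move=> x /negPf ->.
under eq_bigr do rewrite big_split /= card0.
rewrite big_split /= sumr_const -mulr_natl.
rewrite [X in _ + (_ + X)](_ : _ = \sum_(i | P i) chi i (-1) * jacobi3 (chi i)); last first.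
  under eq_bigr do rewrite exchange_big /=.
  by rewrite exchange_big /=; apply: eq_bigr => i Pi; rewrite sum_to_jacobi3 //; [exact: mchi | exact: nchi].
by rewrite addrA; congr (_ + _); rewrite cardE; ring.
Qed.

(** The solutions x of x^3 = y^2 - y are counted by cubic characters, and y^2 - y = - y (1 - y). *)
Lemma count_cubic_twist : d = 3 ->
  #|[pred z : E * E | z.2 ^+ 2 - z.2 == z.1 ^+ 3]|%:R =
  #|E|%:R + \sum_(i | P i) chi i (-1) * jacobi2 (chi i) (chi i).
Proof.
move=> d3.
rewrite card_sumr.
rewrite -(pair_bigA _ (fun x y => (y ^+ 2 - y == x ^+ 3)%:R)) /= exchange_big /=.
transitivity (\sum_y (1 + \sum_(i | P i) chi i (y ^+ 2 - y))).
  apply: eq_bigr => y _; rewrite -power_count card_sumr d3.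
  by apply: eq_bigr => x _; rewrite eq_sym.
rewrite big_split /= sumr_const exchange_big /=; congr (_ + _).
apply: eq_bigr => i Pi; rewrite /jacobi2 mulr_sumr; apply: eq_bigr => y _.
by rewrite -!(mcharM (mchi Pi)); congr (chi i _); ring.
Qed.

End PointCounts.

(** * Power residues and the global trace *)

Lemma Zd_addE d (m1 m2 : 'Z_d) : (1 < d)%N -> (m1 + m2 : 'Z_d) = ((m1 + m2) %% d)%N :> nat.
Proof. by move=> d1; congr (_ %% _)%N; apply: Zp_cast. Qed.

Lemma Zd_lt d (m : 'Z_d) : (1 < d)%N -> (m < d)%N.
Proof. by move=> d1; apply: leq_trans (ltn_ord m) _; rewrite Zp_cast. Qed.

Section PowerResidues.
Variables (E : finFieldType) (om : E -> algC).
Hypothesis mom : mult_char om.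
Hypothesis om_inj : forall x, om x = 1 -> x = 1.
Local Notation M := (#|E|.-1).

Lemma card_units_gt0 : (0 < M)%N.
Proof. by rewrite -subn1 subn_gt0 finNzRing_gt1. Qed.

Lemma expr_units (x : E) : x != 0 -> x ^+ M = 1.
Proof.
move=> x0; apply: (mulIf x0); rewrite -exprSr prednK ?expf_card ?mul1r //.
exact: ltnW (finNzRing_gt1 E).
Qed.

Lemma exists_generator : exists g : E, M.-primitive_root g.
Proof.
have : has M.-primitive_root [seq x <- enum E | x != 0].
  apply: has_prim_root; first exact: card_units_gt0.
  - by apply/allP => x; rewrite mem_filter => /andP[x0 _]; apply/unity_rootP/expr_units.
  - exact/filter_uniq/enum_uniq.
  by rewrite -(cardC1 (0 : E)) cardE [enum (predC1 _)]/enum_mem -enumT; apply: eq_leq; congr size; apply: eq_filter.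
by case/hasP => g _ pg; exists g.
Qed.

Lemma prim_om g : M.-primitive_root g -> M.-primitive_root (om g).
Proof.
move=> pg; apply/andP; split; first exact: card_units_gt0.
apply/forallP => i; apply/eqP; rewrite unity_rootE.
have H k : (om g ^+ k == 1) = (M %| k)%N.
  rewrite -(mcharX _ _ mom) (prim_order_dvd pg).
  by apply/eqP/eqP => [/om_inj|->] //; rewrite (mchar1 mom).
rewrite H; apply/idP/eqP => [dv|->//].
by apply/eqP; rewrite eqn_leq ltn_ord dvdn_leq.
Qed.

Lemma om_units x : x != 0 -> om x ^+ M = 1.
Proof. by move=> x0; rewrite -(mcharX _ _ mom) expr_units // (mchar1 mom). Qed.

(** For e = 0 the value at 0 is 1, not 0. This is the term that counts the root t = 0 in
    [power_count] at a = 0. *)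
Definition om_pow e := fun x => om x ^+ e.

Lemma mult_om_pow e : (0 < e)%N -> mult_char (om_pow e).
Proof.
move=> e0; rewrite /om_pow; split; first by rewrite (mchar0 mom) expr0n gtn_eqF.
  by rewrite (mchar1 mom) expr1n.
by move=> x y; rewrite (mcharM mom) exprMn.
Qed.

Lemma nontrivial_om_pow e : ~~ (M %| e)%N -> nontrivial (om_pow e).
Proof.
move=> ndv; have [g pg] := exists_generator; exists g.
  apply/eqP => g0; have /eqP := prim_expr_order pg.
  by rewrite g0 expr0n gtn_eqF ?card_units_gt0 // eq_sym oner_eq0.
by rewrite -(prim_order_dvd (prim_om pg)).
Qed.

Lemma trivial_om_pow e : (M %| e)%N -> trivial_char (om_pow e).
Proof.
by case/dvdnP => k -> x x0; rewrite /om_pow mulnC exprM om_units // expr1n.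
Qed.

Section Exponent.
Variable d : nat.
Hypothesis d_gt1 : (1 < d)%N.
Local Notation admissible m := (d %| M * m)%N.
Local Notation ex m := (M * m %/ d)%N.

Lemma ex_mod m : admissible m -> (ex m) = (ex (m %% d) + M * (m %/ d))%N.
Proof.
move=> dm; by rewrite {1}(divn_eq m d) mulnDr mulnA divnMDl ?(ltnW d_gt1) // addnC.
Qed.

Lemma admissible_mod m : admissible (m %% d)%N = admissible m.
Proof.
by rewrite {2}(divn_eq m d) mulnDr addnC dvdn_addl // mulnA dvdn_mull.
Qed.

(** The character om^(ex m) thus has the same order as m in Z/d. Admissibility makes sense of it
    even when d does not divide #|E| - 1. *)
Lemma dvd_ex k m : admissible m -> (M %| k * ex m)%N = (d %| k * m)%N.
Proof.
move=> dm; rewrite -(@dvdn_pmul2r d) ?(ltnW d_gt1) // -mulnA divnK //.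
by rewrite mulnCA dvdn_pmul2l // card_units_gt0.
Qed.

Lemma admissibleD (m1 m2 : nat) : admissible m1 -> admissible ((m1 + m2) %% d) = admissible m2.
Proof. by move=> d1; rewrite admissible_mod mulnDr dvdn_addr. Qed.

Lemma om_pow_ex_mod m x : admissible m -> x != 0 -> om_pow (ex (m %% d)) x = om_pow (ex m) x.
Proof.
move=> dm x0; by rewrite /om_pow [in RHS](ex_mod dm) exprD (exprM _ M) om_units // expr1n mulr1.
Qed.

Lemma om_pow_exD (m1 m2 : nat) x : admissible m1 -> admissible m2 -> x != 0 ->
  om_pow (ex ((m1 + m2) %% d)) x = om_pow (ex m1) x * om_pow (ex m2) x.
Proof.
move=> d1 d2 x0; rewrite om_pow_ex_mod //; last by rewrite mulnDr dvdn_add.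
by rewrite mulnDr divnDl // /om_pow exprD.
Qed.

(** With D = gcd(d, #|E| - 1), one character of order D suffices as a test: it shows that D divides
    the discrete logarithm of a, and a Bezout relation provides the d-th root. *)
Lemma is_power_if (a : E) : a != 0 ->
  (forall m : 'Z_d, admissible m -> om_pow (ex m) a = 1) -> exists t, t ^+ d = a.
Proof.
move=> a0 H; have [g pg] := exists_generator.
have [i Da] := prim_rootP pg (expr_units a0).
have d0 : (0 < d)%N := ltnW d_gt1.
pose D := gcdn d M; have D0 : (0 < D)%N by rewrite gcdn_gt0 d0.
have Dd : (D %| d)%N := dvdn_gcdl _ _; have DM : (D %| M)%N := dvdn_gcdr _ _.
have aM : a ^+ (M %/ D) = 1.
  (* For D = 1 the residue d / D would be 0 in Z/d; otherwise it is admissible with exponent M /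
     D. *)
  have [D1|D1] := eqVneq D 1%N; first by rewrite D1 divn1 expr_units.
  have lt_m : (d %/ D < d)%N by rewrite ltn_Pdiv // ltn_neqAle eq_sym D1.
  pose m : 'Z_d := inZp (d %/ D).
  have Em : m = (d %/ D)%N :> nat by rewrite /= Zp_cast // modn_small.
  have Eex : (M * m = M %/ D * d)%N by rewrite Em muln_divA // mulnC -muln_divA // mulnC.
  have := H m; rewrite Eex dvdn_mull // mulnK // /om_pow -(mcharX _ _ mom) => /(_ isT).
  exact: om_inj.
have : (D %| i)%N.
  have := prim_order_dvd pg (i * (M %/ D)); rewrite exprM -Da aM eqxx.
  rewrite -{1}(divnK DM) [(_ * D)%N]mulnC dvdn_pmul2r //.
  by rewrite divn_gt0 // dvdn_leq // card_units_gt0.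
(* The relation is km d = kn M + D, so the d-th power of g^(l km) is g^(l D) = a. *)
case/dvdnP => l Di; have [km kn Dkm _] := egcdnP M d0.
exists (g ^+ (l * km)%N); rewrite -exprM -mulnA Dkm mulnDr exprD mulnA mulnC.
rewrite [g ^+ (M * _)%N]exprM (prim_expr_order pg) expr1n mul1r Da Di.
by rewrite /D.
Qed.

(** For a != 0 both sides are a constant times the indicator of d-th powers: on the right by
    orthogonality over the group of admissible m. The constants agree because both sides sum to M
    over the nonzero a, and 1 is a d-th power; neither has to be computed. *)
Lemma power_count a :
  #|[pred t : E | t ^+ d == a]|%:R = \sum_(m : 'Z_d | admissible m) om_pow (ex m) a.
Proof.
have d0 : (0 < d)%N := ltnW d_gt1.
have ex0 : ex (0%R : 'Z_d) = 0%N by rewrite muln0 div0n.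
have adm0 : admissible (0%R : 'Z_d) by rewrite muln0 dvdn0.
have ex_gt0 (m : 'Z_d) : admissible m -> m != 0 -> (0 < ex m)%N.
  move=> am m0; rewrite divn_gt0 // dvdn_leq // muln_gt0 card_units_gt0 lt0n.
  by apply: contraNneq m0 => m0; apply/eqP/val_inj.
have [->|a0] := eqVneq a 0.
  rewrite (bigD1 0) //= ex0 /om_pow expr0 big1 ?addr0; last first.
    by move=> m /andP[am m0]; rewrite (mchar0 mom) expr0n gtn_eqF // ex_gt0.
  rewrite -[RHS]/(1%:R); congr _%:R; rewrite -(card1 (0 : E)); apply: eq_card => t.
  by rewrite !inE expf_eq0 d0.
pose C := #|[pred t : E | t ^+ d == 1]|.
pose C' := #|[pred m : 'Z_d | admissible m]|.
pose pw (b : E) := [exists t, t ^+ d == b].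
have cntL b : b != 0 -> #|[pred t : E | t ^+ d == b]| = (pw b * C)%N.
  move=> b0; rewrite /pw; case: existsP => [[u /eqP Du]|npw]; last first.
    by apply/eqP; rewrite mul0n eq_card0 // => t; apply/negP => /= Ht; apply: npw; exists t.
  have u0 : u != 0 by apply: contraNneq b0 => u0; rewrite -Du u0 expr0n gtn_eqF.
  rewrite mul1n /C -[RHS](fintype.card_image (mulfI u0)); apply: eq_card => t; rewrite [LHS]inE.
  apply/idP/fintype.imageP => [/eqP Dt|[v]]; last by rewrite inE => /eqP Dv ->; rewrite exprMn Dv mulr1 Du.
  exists (u^-1 * t); last by rewrite mulVKf.
  by rewrite inE exprMn exprVn Du Dt mulVf.
have cntR b : b != 0 -> \sum_(m : 'Z_d | admissible m) om_pow (ex m) b = (pw b * C')%:R.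
  move=> b0; rewrite /pw; case: existsP => [[u /eqP Du]|npw].
    rewrite mul1n /C' -[in RHS]sum1_card natr_sum; apply: eq_bigr => m am.
    have u0 : u != 0 by apply: contraNneq b0 => u0; rewrite -Du u0 expr0n gtn_eqF.
    rewrite /om_pow -Du (mcharX _ _ mom) -exprM mulnC divnK // exprM.
    by rewrite om_units // expr1n.
  have [m1 am1 m1b] : exists2 m1 : 'Z_d, admissible m1 & om_pow (ex m1) b != 1.
    apply/exists_inP; apply: contraT; rewrite negb_exists_in => /forall_inP H.
    case: npw; have [m am|t Dt] := is_power_if b0; last by exists t; rewrite Dt.
    by apply/eqP; have := H m am; rewrite negbK.
  rewrite mul0n; set S := \sum_(m | _) _.
  have : S = om_pow (ex m1) b * S.
    rewrite {1}/S (reindex_inj (addrI m1)) mulr_sumr; apply: eq_big => m.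
      by rewrite Zd_addE // admissibleD.
    by rewrite Zd_addE // admissibleD // => am; rewrite om_pow_exD.
  move/eqP; rewrite -subr_eq0 -{1}[S]mul1r -mulrBl mulf_eq0 subr_eq0 eq_sym (negPf m1b).
  by move/eqP.
have P1 : (0 < \sum_(b : E | b != 0%R) pw b)%N.
  rewrite (bigD1 1) ?oner_neq0 //= addn_gt0 lt0b; apply/orP; left.
  by apply/existsP; exists 1; rewrite expr1n.
have sumC : ((\sum_(b : E | b != 0%R) pw b) * C = M)%N.
  transitivity (\sum_(b : E | b != 0%R) #|[pred t : E | t ^+ d == b]|)%N.
    by rewrite big_distrl; apply: eq_bigr => b /cntL.
  rewrite -(cardC1 (0 : E)) -[RHS]sum1_card [RHS](partition_big (fun t => t ^+ d) (fun b => b != 0)) /=.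
    apply: eq_bigr => b b0; rewrite -sum1_card; apply: eq_bigl => t; rewrite !inE.
    by case: eqP => [Dt|]; rewrite ?andbF ?andbT //; apply/esym; apply: contraNneq b0 => t0; rewrite -Dt t0 expr0n gtn_eqF.
  by move=> t t0; rewrite expf_neq0.
have sumC' : ((\sum_(b : E | b != 0%R) pw b) * C' = M)%N.
  apply/eqP; rewrite -(eqr_nat algC) big_distrl natr_sum /=.
  rewrite -(eq_bigr _ cntR) exchange_big (bigD1 0) //= [X in _ + X]big1 ?addr0; last first.
    move=> m /andP[am m0]; have mm := mult_om_pow (ex_gt0 m am m0).
    have nt : nontrivial (om_pow (ex m)).
      apply: nontrivial_om_pow; rewrite -[ex m]mul1n dvd_ex // mul1n.
      apply: contra m0 => /dvdnP[k Dk]; apply/eqP/val_inj => /=.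
      by have := Zd_lt m d_gt1; rewrite Dk; case: k {Dk} => // k; rewrite ltnNge mulSn leq_addr.
    by have := sum_nontrivial mm nt; rewrite (bigD1 0) //= (mchar0 mm) add0r.
  by rewrite ex0 -(cardC1 (0 : E)) -sum1_card natr_sum; apply/eqP; apply: eq_bigr.
rewrite cntL // cntR //; congr (_ * _)%:R; apply/eqP.
by rewrite -(eqn_pmul2l P1) sumC sumC'.
Qed.

End Exponent.
End PowerResidues.

Section GlobalTrace.
Variables (E : finFieldType) (om : E -> algC).
Hypothesis mom : mult_char om.
Hypothesis om_inj : forall x, om x = 1 -> x = 1.
Local Notation M := (#|E|.-1).

Definition Xchar d (m : 'Z_d) := om_pow om (M * m %/ d).

Definition Xindex d := [pred m : 'Z_d | (m != 0) && (d %| M * m)%N].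

Lemma Zd_neq0 d (m : 'Z_d) : (m != 0) = (0 < m)%N.
Proof. by rewrite lt0n -(inj_eq val_inj). Qed.

Lemma mult_Xchar d (m : 'Z_d) : (1 < d)%N -> Xindex d m -> mult_char (Xchar m).
Proof.
move=> d1 /andP[m0 dm]; apply: mult_om_pow => //; rewrite divn_gt0 ?(ltnW d1) //.
by rewrite dvdn_leq // muln_gt0 card_units_gt0 -Zd_neq0.
Qed.

Lemma Xchar_powE d (m : 'Z_d) k x : Xchar m x ^+ k = om_pow om (k * (M * m %/ d)) x.
Proof. by rewrite /Xchar /om_pow -exprM mulnC. Qed.

Lemma nontrivial_Xchar_pow d (m : 'Z_d) k : (1 < d)%N -> Xindex d m -> ~~ (d %| k * m)%N ->
  nontrivial (fun x => Xchar m x ^+ k).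
Proof.
move=> d1 /andP[m0 dm] ndv; have [|c c0 c1] := nontrivial_om_pow mom om_inj (e := k * (M * m %/ d)).
  by rewrite dvd_ex.
by exists c; rewrite // Xchar_powE.
Qed.

Lemma trivial_Xchar_pow d (m : 'Z_d) k : (1 < d)%N -> Xindex d m -> (d %| k * m)%N ->
  trivial_char (fun x => Xchar m x ^+ k).
Proof.
move=> d1 /andP[m0 dm] dv x x0; rewrite Xchar_powE.
by apply: trivial_om_pow => //; rewrite dvd_ex.
Qed.

Lemma Zd_ndvd d (m : 'Z_d) : (1 < d)%N -> m != 0 -> ~~ (d %| m)%N.
Proof. by move=> d1; rewrite Zd_neq0 => m0; rewrite gtnNdvd // Zd_lt. Qed.

Lemma nontrivial_Xchar d (m : 'Z_d) : (1 < d)%N -> Xindex d m -> nontrivial (Xchar m).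
Proof.
move=> d1 Xm; have [|c c0 c1] := nontrivial_Xchar_pow (k := 1) d1 Xm.
  by rewrite mul1n Zd_ndvd //; case/andP: Xm.
by exists c; rewrite // -[Xchar m c]expr1.
Qed.

Lemma power_countX d (a : E) : (1 < d)%N ->
  #|[pred t : E | t ^+ d == a]|%:R = 1 + \sum_(m | Xindex d m) Xchar m a.
Proof.
move=> d1; rewrite (power_count mom om_inj d1) (bigD1 0%R) ?muln0 ?dvdn0 //=; congr (_ + _).
  by rewrite /om_pow div0n expr0.
by apply: eq_bigl => m; rewrite andbC.
Qed.

(** The indices missing from Z_d are j d/3 for j = 1, 2; the exponents M (j d/3) / d and M j / 3
    coincide, so the characters are those attached to Z/3. *)
Lemma sum_cubic_indices d : (1 < d)%N -> (3 %| d)%N ->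
  \sum_(m | Xindex d m && (m \notin indexZ d)) Xchar m (-1) * jacobi2 (Xchar m) (Xchar m) =
  \sum_(j | Xindex 3 j) Xchar j (-1) * jacobi2 (Xchar j) (Xchar j).
Proof.
move=> d1 d3; case/dvdnP: (d3) => k Dk.
have k0 : (0 < k)%N by rewrite lt0n; apply: contraTneq d1 => k0; rewrite Dk k0.
have lt_d := @Zd_lt d _ d1.
have valZ i : (i < d)%N -> (inZp i : 'Z_d) = i :> nat by move=> id; rewrite /= Zp_cast // modn_small.
have lt_jk (j : 'Z_3) : (j * k < d)%N by rewrite Dk mulnC [(k * 3)%N]mulnC [(k * j)%N]mulnC ltn_pmul2r.
have valh (j : 'Z_3) : (inZp (j * k) : 'Z_d) = (j * k)%N :> nat by rewrite valZ.
have kd : (d %/ 3 = k)%N by rewrite Dk mulnK.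
have k2d : (2 * d %/ 3 = 2 * k)%N by rewrite Dk mulnA mulnK.
rewrite (reindex_onto (fun j : 'Z_3 => inZp (j * k) : 'Z_d) (fun m => inZp (m %/ k) : 'Z_3)) /=; last first.
  move=> m /andP[/andP[m0 _]]; rewrite inE m0 d3 kd k2d /= negbK => Hm.
  apply: val_inj; apply: etrans (valh (inZp (m %/ k))) _ => /=.
  by case/orP: Hm => /eqP Hm; rewrite Hm ?divnn ?k0 ?mulnK //= ?mul1n //.
have exE (j : 'Z_3) : (M * (inZp (j * k) : 'Z_d) %/ d)%N = (M * j %/ 3)%N.
  by rewrite valh Dk [(k * 3)%N]mulnC mulnA divnMr.
have admE (j : 'Z_3) : (d %| M * (inZp (j * k) : 'Z_d))%N = (3 %| M * j)%N.
  by rewrite valh Dk mulnA [(k * 3)%N]mulnC dvdn_pmul2r.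
apply: eq_big => j; last by move=> _; rewrite /Xchar exE.
have -> : (inZp ((inZp (j * k) : 'Z_d) %/ k) == j :> 'Z_3).
  by apply/eqP/val_inj; rewrite valh mulnK //= modn_small // ltn_ord.
rewrite andbT /indexZ finset.in_set d3 kd k2d !Zd_neq0 valh muln_gt0 k0 andbT.
rewrite admE.
case: j => [[|[|[|]]]] //= _; rewrite ?mul1n eqxx ?orbT /= ?andbT //.
Qed.

Lemma Xindex_partition d m : (1 < d)%N ->
  Xindex d m && (m \in indexZ d) = (m \in indexZ d) && (d %| M * m)%N.
Proof. by move=> d1; rewrite /= !inE; case: (m == 0); rewrite //= andbC. Qed.

Theorem trace_sum d : (1 < d)%N ->
  \sum_(t : E) (#|E|%:R -
     #|[pred z : E * E | z.2 ^+ 2 + z.1 * z.2 - t ^+ d * z.2 == z.1 ^+ 3]|%:R)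
  + (if (3 %| d)%N then #|E|%:R - #|[pred z : E * E | z.2 ^+ 2 - z.2 == z.1 ^+ 3]|%:R else 0)
  = - \sum_(m in indexZ d | (d %| M * m)%N) Xchar m (-1) * jacobi3 (Xchar m).
Proof.
move=> d1.
rewrite big_split /= sumrN (@count_curve_family E d _ (Xindex d) (@Xchar d)); last first.
- by move=> a; rewrite power_countX.
- by move=> m; apply: nontrivial_Xchar.
- by move=> m; apply: mult_Xchar.
rewrite sumr_const -[_ *+ #|_|]mulr_natr.
rewrite opprD addrA [_ * _%:R](_ : _ = #|E|%:R ^+ 2); last by rewrite expr2; congr (_ * _%:R); apply: eq_card.
rewrite subrr add0r (bigID (mem (indexZ d))) /= opprD -addrA.
rewrite (eq_bigl _ _ (fun m => Xindex_partition m d1)) -[RHS]addr0; congr (_ + _).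
case: ifP => d3; last first.
  rewrite big_pred0 ?oppr0 ?addr0 // => m; apply/negP => /andP[/andP[m0 _]].
  by rewrite inE m0 d3.
rewrite (@count_cubic_twist E 3 _ (Xindex 3) (@Xchar 3)) //; last first.
- by move=> a; rewrite power_countX.
- by move=> m; apply: mult_Xchar.
(* What remains pairs each cubic character of the family with the same character at t = oo;
   [jacobi3_cubic] cancels the pairs one by one. *)
rewrite opprD addNKr -(sum_cubic_indices d1 d3) -sumrN -sumrN -big_split /=.
apply: big1 => m /andP[Xm]; rewrite inE d3; case/andP: (Xm) => m0 _; rewrite m0 /= negbK => Hm.
have mX := mult_Xchar d1 Xm.
have d3m : (d %| 3 * m)%N.
  case/dvdnP: d3 => k Dk; case/orP: Hm => /eqP ->; rewrite Dk ?mulnA ?mulnK //.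
    by apply/dvdnP; exists 1%N; lia.
  by apply/dvdnP; exists 2%N; lia.
rewrite jacobi3_cubic // ?opprK ?subrr //.
- have [|c c0 c1] := nontrivial_Xchar_pow (k := 2) d1 Xm; last by exists c.
  apply/negP => d2m; have := Zd_ndvd d1 m0; rewrite -[X in (_ %| X)%N]mul1n.
  have -> : (1 * m = 3 * m - 2 * m)%N by rewrite -mulnBl.
  by rewrite dvdn_sub.
- by move=> x x0; have := trivial_Xchar_pow d1 Xm d3m x0; rewrite exprSr expr2 mulrC mulrA.
Qed.

End GlobalTrace.

(** * The zeta function of a fibre *)

Definition qchar (E : finFieldType) (z : E) : algC :=
  if z == 0 then 0 else if z ^+ (#|E|.-1)./2 == 1 then 1 else -1.

Section QuadraticCharacter.
Variable E : finFieldType.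
Hypothesis two_neq0 : (2 : E) != 0.
Local Notation M := (#|E|.-1).

Lemma neg1_neq1 : (-1 : E) != 1.
Proof. by rewrite eq_sym -addr_eq0. Qed.

Lemma odd_units : ~~ odd M.
Proof.
have N0 : (-1 : E) != 0 by rewrite oppr_eq0 oner_eq0.
have := expr_units N0; rewrite -signr_odd; case: odd => //.
by rewrite expr1 => /eqP; rewrite (negPf neg1_neq1).
Qed.

Lemma half_unitsK : (M./2 * 2)%N = M.
Proof. by rewrite muln2 -[RHS]odd_double_half (negPf odd_units). Qed.

Lemma euler_sign (z : E) : z != 0 -> z ^+ M./2 = 1 \/ z ^+ M./2 = -1.
Proof.
move=> z0; have /eqP : (z ^+ M./2) ^+ 2 = 1 by rewrite -exprM half_unitsK expr_units.
by rewrite sqrf_eq1 => /orP[] /eqP; [left | right].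
Qed.

Lemma mult_qchar : mult_char (@qchar E).
Proof.
split; rewrite /qchar ?eqxx ?oner_eq0 ?expr1n ?eqxx // => x y.
rewrite mulf_eq0; have [//=|x0] := eqVneq x 0; first by rewrite mul0r.
have [//=|y0] := eqVneq y 0; first by rewrite mulr0.
rewrite /= exprMn.
case: (euler_sign x0) => ->; case: (euler_sign y0) => ->;
  by rewrite !(mulrNN, mulr1, mul1r) ?eqxx ?(negPf neg1_neq1) !(mulrNN, mulr1, mul1r).
Qed.

Lemma qchar_sq (z : E) : qchar z ^+ 2 = (z != 0)%:R.
Proof. by rewrite /qchar; case: eqP => _; [rewrite expr0n | case: eqP => _; rewrite ?sqrrN expr1n]. Qed.

Lemma qchar_nonsquare : exists2 c : E, c != 0 & qchar c = -1.
Proof.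
have [g pg] := exists_generator E; have M0 := card_units_gt0 E.
have g0 : g != 0.
  by apply/eqP => g0; have /eqP := prim_expr_order pg; rewrite g0 expr0n gtn_eqF // eq_sym oner_eq0.
exists g; rewrite // /qchar (negPf g0) ifN // -(prim_order_dvd pg) gtnNdvd //.
  by have := half_unitsK; lia.
by have := half_unitsK; lia.
Qed.

Lemma card_sqrt (z : E) : #|[pred y : E | y ^+ 2 == z]|%:R = 1 + qchar z.
Proof.
rewrite /qchar; have [->|z0] := eqVneq z 0.
  rewrite addr0 -[RHS]/(1%:R) -(card1 (0 : E)); congr _%:R; apply: eq_card => y.
  by rewrite !inE expf_eq0.
case: eqP => [z1|zN1].
  have [g pg] := exists_generator E.
  have [i Dz] := prim_rootP pg (expr_units z0).
  have M2 : (0 < M./2)%N.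
    by have := card_units_gt0 E; have := half_unitsK; lia.
  have /dvdnP[j Di] : (2 %| i)%N.
    rewrite -(@dvdn_pmul2r M./2) // mulnC half_unitsK (prim_order_dvd pg).
    by rewrite exprM -Dz z1.
  have Dz2 : z = (g ^+ j) ^+ 2 by rewrite -exprM -Di.
  have gj0 : g ^+ j != 0 by apply: contraNneq z0 => e; rewrite Dz2 e expr0n.
  have gN : g ^+ j != - (g ^+ j) by rewrite -addr_eq0 -mulr2n -mulr_natl mulf_neq0.
  transitivity (#|pred2 (g ^+ j) (- g ^+ j)|%:R : algC); last by rewrite card2 gN.
  by congr _%:R; apply: eq_card => y; rewrite !inE Dz2 eqf_sqr.
rewrite subrr eq_card0 // => y; rewrite inE; apply/negP => /eqP Dz.
case: zN1; rewrite -Dz -exprM mulnC half_unitsK expr_units //.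
by apply: contraNneq z0 => y0; rewrite -Dz y0 expr0n.
Qed.

End QuadraticCharacter.

(** Since (q^n - 1)/2 = (1 + q + ... + q^(n-1)) (q - 1)/2, Euler's criterion for x in E is Euler's
    criterion for its norm. *)
Lemma lifts_qchar (F E : finFieldType) (emb : {rmorphism F -> E}) n :
  (2 : F) != 0 -> #|E| = (#|F| ^ n)%N -> lifts emb n (@qchar F) (@qchar E).
Proof.
move=> two0 cardE x w; rewrite prodrXr => Dw.
have n0 := ext_deg_gt0 cardE.
have E2 : (2 : E) != 0 by rewrite -(rmorph_nat emb) fmorph_eq0.
have S0 : (0 < \sum_(i < n) #|F| ^ i)%N.
  by rewrite -(prednK n0) big_ord_recl expn0.
have ME : (#|E|.-1)./2 = ((\sum_(i < n) #|F| ^ i) * (#|F|.-1)./2)%N.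
  apply: (can_inj doubleK); rewrite -!muln2 half_unitsK // -mulnA.
  by rewrite half_unitsK // cardE predn_exp mulnC.
rewrite /qchar -(fmorph_eq0 emb) Dw expf_eq0 S0 /=; case: eqP => // _.
by rewrite ME exprM -Dw -rmorphXn fmorph_eq1.
Qed.

(** * The quadratic character of a resultant *)

Lemma exists_companion (R : comNzRingType) n (f : {poly R}) :
  f \is monic -> size f = n.+2 -> exists C : 'M[R]_n.+1, char_poly C = f.
Proof.
move=> mf szf; have := companionmxK mf; move: (companionmx f).
by rewrite szf => C DC; exists C.
Qed.

Lemma det_horner_mx_XsubC (R : comNzRingType) n (C : 'M[R]_n.+1) a :
  \det (horner_mx C ('X - a%:P)) = (-1) ^+ n.+1 * (char_poly C).[a].
Proof.
have -> : (char_poly C).[a] = \det (a%:M - C).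
  rewrite -[LHS]/(horner_eval a (char_poly C)) -det_map_mx; congr (\det _).
  apply/matrixP => i j; rewrite !mxE rmorphB rmorphMn /=.
  by rewrite /horner_eval hornerX hornerC.
rewrite -detZ scaleN1r opprB rmorphB /= horner_mx_X horner_mx_C //.
Qed.

Section CubicCharacter.
Variables (F : finFieldType) (f : {poly F}) (C : 'M[F]_3).
Hypothesis two_neq0 : (2 : F) != 0.
Hypothesis char_C : char_poly C = f.

(** The resultant of g and f: det g(C) is the product of g over the roots of f, and the sign turns
    it into the product of f over the roots of g. No splitting field is needed, and multiplicativity
    is that of det. *)
Definition cubic_norm (g : {poly F}) := (-1) ^+ deg g * \det (horner_mx C g).

(* The value of the quadratic character at the product of f over the roots of g. *)
Definition cubic_lam (g : {poly F}) := qchar (cubic_norm g).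

Lemma monic_f : f \is monic.
Proof. by rewrite -char_C char_poly_monic. Qed.

Lemma size_f : size f = 4.
Proof. by rewrite -char_C size_char_poly. Qed.

Lemma cubic_lam1 : cubic_lam 1 = 1.
Proof.
by rewrite /cubic_lam /cubic_norm /deg size_poly1 rmorph1 det1 expr0 mulr1 (mchar1 (mult_qchar two_neq0)).
Qed.

Lemma cubic_lamM g h : g \is monic -> h \is monic ->
  cubic_lam (g * h) = cubic_lam g * cubic_lam h.
Proof.
move=> mg mh; rewrite /cubic_lam -(mcharM (mult_qchar two_neq0)); congr qchar.
by rewrite /cubic_norm degM // rmorphM det_mulmx exprD mulrACA.
Qed.

Lemma cubic_lam_XsubC a : cubic_lam ('X - a%:P) = qchar f.[a].
Proof.
rewrite /cubic_lam /cubic_norm det_horner_mx_XsubC char_C /deg size_XsubC /= expr1.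
by rewrite -signr_odd /= expr1 mulrA mulrNN !mul1r.
Qed.

(** Scaling the residue of g modulo f by a nonsquare c keeps g monic of degree at least 3 and
    multiplies det g(C) by c^3, on which the character is -1. *)
Lemma Lcoef_cubic_vanish k : Lcoef cubic_lam k.+3 = 0.
Proof.
have [c c0 cN] := qchar_nonsquare two_neq0.
pose T (g : {poly F}) := g + (c - 1) *: (g %% f).
have sz_small g : (size ((c - 1) *: (g %% f)) <= 3)%N.
  rewrite (leq_trans (size_scale_leq _ _)) //.
  by have := ltn_modpN0 g (monic_neq0 monic_f); rewrite size_f.
have T_mod g : T g %% f = c *: (g %% f).
  by rewrite /T modpD modpZl modp_id scalerBl scale1r addrC subrK.
have monicT g : g \in monics F k.+3 -> T g \in monics F k.+3.
  rewrite !mem_monics => /andP[mg /eqP szg].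
  have lt_T : (size ((c - 1) *: (g %% f)) < size g)%N by rewrite szg ltnS (leq_trans (sz_small _)).
  by rewrite monicE lead_coefDl // size_polyDl // szg -monicE mg eqxx.
apply: (@Lcoef_eq0 _ _ _ _ T (-1)) => //.
- move=> g h _ _ Tgh; have gh : g %% f = h %% f.
    by apply: (can_inj (scalerK c0)); rewrite -!T_mod Tgh.
  by apply: (addIr ((c - 1) *: (g %% f))); rewrite {2}gh.
- by rewrite eq_sym -addr_eq0 -mulr2n pnatr_eq0.
move=> g gm; have := monicT g gm; move: gm; rewrite !mem_monics.
move=> /andP[_ /eqP szg] /andP[_ /eqP szT].
have TC : horner_mx C (T g) = c *: horner_mx C g.
  have fC : horner_mx C f = 0 by rewrite -char_C Cayley_Hamilton.
  have modC h : horner_mx C h = horner_mx C (h %% f).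
    by rewrite {1}(divp_eq h f) rmorphD rmorphM /= fC mulr0 add0r.
  by rewrite modC T_mod horner_mxZ -modC.
rewrite /cubic_lam /cubic_norm TC detZ /deg szT szg mulrCA.
rewrite (mcharM (mult_qchar two_neq0)) (mcharX _ _ (mult_qchar two_neq0)) cN.
by congr (_ * _); ring.
Qed.

(** The norm of f(beta) is the product of f over the n conjugates of beta, which are the roots, with
    multiplicity, of pi^(n / deg pi). *)
Lemma cubic_lam_root (E : finFieldType) (emb : {rmorphism F -> E}) n pi beta :
    #|E| = (#|F| ^ n)%N -> prime_poly pi -> root (map_poly emb pi) beta ->
  qchar (map_poly emb f).[beta] = cubic_lam pi ^+ (n %/ deg pi).
Proof.
move=> cardE ppi rpi; have [mpi _] := prime_polyP _ ppi.
rewrite -(lamX cubic_lam1 cubic_lamM) // /cubic_lam.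
apply: (lifts_qchar (emb := emb) two_neq0 cardE).
have dn : deg (pi ^+ (n %/ deg pi)) = n.
  by rewrite degX // divnK // (root_prime_deg cardE ppi rpi).
have det_emb P : emb (\det (horner_mx C P)) = \det (horner_mx (map_mx emb C) (map_poly emb P)).
  by rewrite -map_horner_mx det_map_mx.
rewrite /cubic_norm dn rmorphM rmorphXn rmorphN1 /= det_emb.
rewrite (prime_split_pow cardE ppi rpi) rmorph_prod /=.
have -> : \det (\prod_(i < n) horner_mx (map_mx emb C) ('X - (beta ^+ (#|F| ^ i))%:P))
   = \prod_(i < n) \det (horner_mx (map_mx emb C) ('X - (beta ^+ (#|F| ^ i))%:P)).
  by elim/big_rec2: _ => [|i x y _ <-]; rewrite ?det1 // det_mulmx.
rewrite -[X in (-1) ^+ X]card_ord -prodr_const -big_split /=; apply: eq_bigr => i _.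
rewrite det_horner_mx_XsubC -map_char_poly char_C -signr_odd /= expr1 mulrA mulrNN !mul1r.
by rewrite frob_horner.
Qed.

End CubicCharacter.

Section ResidueMap.
Variables (F K : finFieldType) (red : {rmorphism {poly F} -> K}).

Definition const_map : F -> K := red \o polyC.
HB.instance Definition _ := GRing.RMorphism.on const_map.

Lemma horner_const_map (g : {poly F}) : (map_poly const_map g).[red 'X] = red g.
Proof.
elim/poly_ind: g => [|g c IHg]; first by rewrite !rmorph0 horner0.
by rewrite rmorphD rmorphM /= map_polyX map_polyC !hornerE IHg rmorphD rmorphM.
Qed.
End ResidueMap.

(** An abstract interface to F[X]/(pi): later arguments use only the surjection, its kernel and the
    cardinal. *)
Lemma exists_residue_field (F : finFieldType) (pi : {poly F}) : prime_poly pi ->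
  exists (K : finFieldType) (red : {rmorphism {poly F} -> K}),
    [/\ #|K| = (#|F| ^ deg pi)%N, forall x, exists g, red g = x
      & forall g, (red g == 0) = (pi %| g)].
Proof.
case/prime_polyP => mpi ipi; have mi : monic_irreducible_poly pi by [].
exists {poly %/ pi with mi}, (in_qpoly pi : {rmorphism {poly F} -> {poly %/ pi}}).
split; first exact: card_qfpoly.
  by move=> x; exists (val x); apply/val_inj/in_qpoly_small/size_mk_monic.
move=> g; rewrite Pdiv.Idomain.dvdpE /Pdiv.CommonRing.rdvdp.
have <- : val (in_qpoly pi g) = Pdiv.CommonRing.rmodp g pi by rewrite /= (mk_monicE mi).
by rewrite -[RHS](inj_eq val_inj).
Qed.

Section ResidueField.
Variables (F K : finFieldType) (red : {rmorphism {poly F} -> K}) (pi : {poly F}).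
Hypothesis ppi : prime_poly pi.
Hypothesis red_surj : forall x, exists g, red g = x.
Hypothesis red_eq0 : forall g, (red g == 0) = (pi %| g).

Lemma sum_residues (V : nmodType) (G : K -> V) :
  \sum_x G x = \sum_(g <- polys F (deg pi)) G (red g).
Proof.
have mpi : pi \is monic by case/prime_polyP: ppi.
have pi0 := monic_neq0 mpi.
rewrite -big_enum /=; apply: reindex_seq.
- exact: polys_uniq.
- exact: enum_uniq.
- by move=> g _; rewrite mem_enum.
- move=> g h; rewrite !mem_polys => szg szh ered; apply/eqP; rewrite -subr_eq0.
  apply: contraT => gh0; have /dvdp_leq : pi %| g - h by rewrite -red_eq0 rmorphB ered subrr.
  move=> /(_ gh0); rewrite size_prime // => /leq_trans /(_ (size_polyD _ _)).
  by rewrite size_polyN leq_max ltnNge szg ltnNge szh.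
move=> x _; have [g <-] := red_surj x; exists (g %% pi).
  by rewrite mem_polys -ltnS -size_prime // ltn_modp.
apply/eqP; rewrite -subr_eq0 -rmorphB red_eq0 {1}(divp_eq g pi) addrK.
by rewrite dvdp_mull.
Qed.

End ResidueField.

(** * Mumford pairs and the quadratic coefficient *)

Section Quadratics.
Variable F : finFieldType.
Implicit Types (f g u v : {poly F}) (a b : F).

Lemma sum_lines a (G : {poly F} -> algC) :
  \sum_(v <- polys F 2) G v = \sum_b \sum_m G (b%:P + m *: ('X - a%:P)).
Proof.
rewrite pair_bigA /= -[RHS]big_enum /=.
rewrite (reindex_seq _ (h := fun z : F * F => z.1%:P + z.2 *: ('X - a%:P)) (s := enum {: F * F})) //.
- exact: enum_uniq.
- exact: polys_uniq.
- move=> z _; rewrite mem_polys (leq_trans (size_polyD _ _)) // geq_max.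
  rewrite (leq_trans (size_polyC_leq1 _)) //=.
  by rewrite (leq_trans (size_scale_leq _ _)) // size_XsubC.
- move=> [b m] [b' m'] _ _ /= e; have := congr1 (fun p : {poly F} => p.[a]) e.
  rewrite /= !hornerE subrr !mulr0 !addr0 => eb; rewrite eb in e *.
  have := congr1 (fun p : {poly F} => p`_1) (addrI _ e).
  by rewrite !coefZ coefB coefX coefC /= subr0 !mulr1 => ->.
move=> v; rewrite mem_polys => szv; exists (v.[a], v`_1); rewrite ?mem_enum //=.
have Dv : v = (v`_0)%:P + v`_1 *: 'X.
  apply/polyP => -[|[|i]]; rewrite coefD coefC coefZ coefX /= ?mulr0 ?addr0 ?mulr1 ?add0r //.
  by rewrite nth_default // (leq_trans szv).
have -> : v.[a] = v`_0 + v`_1 * a by rewrite {1}Dv hornerD hornerZ hornerC hornerX.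
by rewrite {1}Dv -!mul_polyC polyCD polyCM; ring.
Qed.

Lemma dvd_XsubC_sq a g : (('X - a%:P) ^+ 2 %| g) = (g.[a] == 0) && (g^`().[a] == 0).
Proof.
have X0 : ('X - a%:P : {poly F}) != 0 by rewrite polyXsubC_eq0.
have [ga|ga] := boolP (g.[a] == 0); last first.
  apply/negP => /dvdpP[h Dg]; move: ga.
  by rewrite Dg expr2 mulrA hornerM hornerXsubC subrr mulr0 eqxx.
have /factor_theorem[h Dg] : root g a by [].
rewrite Dg expr2 dvdp_mul2r // dvdp_XsubCl rootE derivM derivXsubC mulr1.
by rewrite hornerD hornerM hornerXsubC subrr mulr0 add0r.
Qed.

(** The cofactor of a monic quadratic divisor of a cubic is some X - a, so these divisors correspond
    to the roots. *)
Lemma count_quadratic_divisors f : f \is monic -> size f = 4 ->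
  \sum_(u <- monics F 2) (u %| f)%R%:R = \sum_a (f.[a] == 0)%R%:R :> algC.
Proof.
move=> mf szf.
have X0 a : ('X - a%:P : {poly F}) != 0 by rewrite polyXsubC_eq0.
have fE a : f.[a] == 0 -> f %/ ('X - a%:P) * ('X - a%:P) = f.
  by move=> fa; rewrite divpK // dvdp_XsubCl.
have natE (T : Type) (r : seq T) (P : pred T) : \sum_(x <- r) (P x)%:R = \sum_(x <- r | P x) 1 :> algC.
  by rewrite [RHS]big_mkcond; apply: eq_bigr => x _; case: (P x).
rewrite -[RHS]big_enum /= !natE -big_filter -[RHS]big_filter.
rewrite (reindex_seq _ (h := fun a => f %/ ('X - a%:P)) (s := [seq a <- enum F | f.[a] == 0])) //.
- exact/filter_uniq/enum_uniq.
- exact/filter_uniq/monics_uniq.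
- move=> a; rewrite mem_filter => /andP[fa _]; rewrite mem_filter mem_monics.
  rewrite -{2}(fE a fa) dvdp_mulr ?dvdpp //=.
  have mq : f %/ ('X - a%:P) \is monic by move: mf; rewrite -{1}(fE a fa) monicMr ?monicXsubC.
  by rewrite mq /= size_divp // szf size_XsubC.
- move=> a b; rewrite !mem_filter => /andP[fa _] /andP[fb _] e.
  have := fE b fb; rewrite -e -{2}(fE a fa) => /mulfI.
  rewrite -size_poly_eq0 size_divp // szf size_XsubC => /(_ isT).
  by move/addrI/oppr_inj/polyC_inj.
move=> u; rewrite mem_filter mem_monics => /andP[/dvdpP[w Df] /andP[mu /eqP szu]].
have mw : w \is monic by move: mf; rewrite Df monicMr.
have szw : size w = 2.
  by have := szf; rewrite Df size_monicM // [deg u]/deg szu (size_deg mw) addn2 => -[->].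
have wm : w \in monics F 1 by rewrite mem_monics mw szw.
have Dw : w = 'X - (- w`_0)%:P.
  apply/polyP => -[|[|i]]; rewrite coefB coefX coefC /= ?subr0 ?sub0r ?opprK //.
    by move/monicP: mw; rewrite lead_coefE szw.
  by rewrite nth_default // szw.
exists (- w`_0).
  by rewrite mem_filter mem_enum andbT Df hornerM {1}Dw hornerXsubC subrr mul0r.
by rewrite -Dw Df mulKp // monic_neq0.
Qed.

End Quadratics.

Lemma sum_monics_const (F : finFieldType) n : \sum_(g <- monics F n) 1 = #|F|%:R ^+ n :> algC.
Proof.
rewrite (reindex_seq _ (h := fun v => 'X^n + v) (s := polys F n)) //.
- by rewrite big_const_seq count_predT size_polys iter_addr_0 natrX.
- exact: polys_uniq.
- exact: monics_uniq.
- move=> v; rewrite mem_polys => szv; rewrite mem_monics monicE lead_coefDl ?size_polyXn //.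
  by rewrite lead_coefXn eqxx size_polyDl ?size_polyXn //=.
- by move=> v w _ _ /addrI.
move=> g; rewrite mem_monics => /andP[mg /eqP szg]; exists (g - 'X^n); last by rewrite addrC subrK.
rewrite mem_polys; apply/leq_sizeP => j; rewrite leq_eqVlt => /orP[/eqP <-|lt_nj].
  by move/monicP: mg; rewrite lead_coefE szg /= coefB coefXn eqxx => ->; rewrite subrr.
by rewrite coefB coefXn gtn_eqF // subr0 nth_default // szg.
Qed.

Lemma sum_delta (T : finType) (a : T) (G : T -> algC) : \sum_x (x == a)%:R * G x = G a.
Proof.
by rewrite (bigD1 a) //= eqxx mul1r big1 ?addr0 // => x /negPf ->; rewrite mul0r.
Qed.

Section QuadraticCoefficient.
Variables (F : finFieldType) (f : {poly F}) (C : 'M[F]_3).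
Hypothesis two_neq0 : (2 : F) != 0.
Hypothesis char_C : char_poly C = f.
Local Notation lam := (cubic_lam C).
Local Notation q := (#|F|%:R : algC).

Definition multiple_root a := (f.[a] == 0) && (f^`().[a] == 0).

(* The number of Mumford pairs (u, v), deg v < 2, on y^2 = f. *)
Definition mumford (u : {poly F}) : algC := \sum_(v <- polys F 2) (u %| f - v ^+ 2)%R%:R.

(** Sum over u first. For fixed v, f - v^2 is a monic cubic whose quadratic divisors are counted by
    its roots a; then v(a) is a square root of f(a), and the slope of v is free. *)
Lemma sum_mumford : \sum_(u <- monics F 2) mumford u = q * (q + \sum_a qchar f.[a]).
Proof.
rewrite exchange_big /=.
transitivity (\sum_(v <- polys F 2) \sum_a (v.[a] ^+ 2 == f.[a])%R%:R : algC).
  rewrite big_seq [RHS]big_seq; apply: eq_bigr => v; rewrite mem_polys => szv.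
  have szv2 : (size (- v ^+ 2)%R < size f)%N.
    rewrite (size_f char_C) size_polyN expr2 ltnS (leq_trans (size_polyMleq _ _)) //.
    by have := leq_add szv szv; case: (_ + _)%N.
  rewrite count_quadratic_divisors; first last.
  - by rewrite size_polyDl // (size_f char_C).
  - by rewrite monicE lead_coefDl // -monicE (monic_f char_C).
  by apply: eq_bigr => a _; rewrite !hornerE subr_eq0 eq_sym.
rewrite exchange_big /= mulrDr.
transitivity (\sum_a \sum_b \sum_(m : F) (b ^+ 2 == f.[a])%R%:R : algC).
  apply: eq_bigr => a _; rewrite (sum_lines a); apply: eq_bigr => b _; apply: eq_bigr => m _.
  by rewrite hornerD hornerC hornerZ hornerXsubC subrr mulr0 addr0.
transitivity (\sum_a q * (1 + qchar f.[a])).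
  apply: eq_bigr => a _; rewrite exchange_big /= sumr_const -[LHS]mulr_natl.
  by congr (_ * _); rewrite -card_sqrt // card_sumr.
by rewrite -mulr_sumr big_split /= mulrDr sumr_const.
Qed.

(** Interpolation: v is determined by its values at a and b, which are independent square roots of
    f(a) and f(b). *)
Lemma mumford_split a b : a != b ->
  mumford (('X - a%:P) * ('X - b%:P)) = (1 + qchar f.[a]) * (1 + qchar f.[b]).
Proof.
move=> ab; have ba : b - a != 0 by rewrite subr_eq0 eq_sym.
rewrite /mumford (sum_lines a) -!card_sqrt // !card_sumr mulr_suml; apply: eq_bigr => x _.
rewrite mulr_sumr (reindex_inj (mulIf (invr_neq0 ba))) (reindex_inj (addIr (- x))) /=.
apply: eq_bigr => y _; rewrite -natrM mulnb; congr (nat_of_bool _)%:R.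
rewrite Gauss_dvdp; last by rewrite coprimep_XsubC2.
set v := _ + _ *: _.
have va : v.[a] = x by rewrite /v hornerD hornerC hornerZ hornerXsubC subrr mulr0 addr0.
have vb : v.[b] = y by rewrite /v hornerD hornerC hornerZ hornerXsubC divfK // addrC subrK.
by rewrite !dvdp_XsubCl !rootE !hornerD !hornerN !horner_exp va vb !subr_eq0 ![f.[_] == _]eq_sym.
Qed.

(** The conditions are v(a)^2 = f(a) and 2 v(a) v'(a) = f'(a). A nonzero v(a) determines the slope;
    v(a) = 0 requires a multiple root and leaves the slope free. *)
Lemma mumford_double a :
  mumford (('X - a%:P) ^+ 2) =
    (if f.[a] == 0 then q * (multiple_root a)%:R else 1 + qchar f.[a]).
Proof.
rewrite /mumford (sum_lines a).
transitivity (\sum_b \sum_m ((b ^+ 2 == f.[a]) && (2 * b * m == f^`().[a]))%R%:R : algC).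
  apply: eq_bigr => b _; apply: eq_bigr => m _; congr (nat_of_bool _)%:R.
  rewrite dvd_XsubC_sq !derivE !hornerE /= subrr !mulr0 !addr0 !subr_eq0.
  congr (_ && _); first by rewrite eq_sym.
  by rewrite eq_sym; congr (_ == _); ring.
rewrite /multiple_root; have [fa|fa] := eqVneq f.[a] 0.
  rewrite /= (bigD1 0) //= [X in _ + X]big1 ?addr0; last first.
    by move=> b b0; apply: big1 => m _; rewrite fa expf_eq0 (negPf b0).
  rewrite (eq_bigr (fun=> (f^`().[a] == 0)%R%:R)) ?sumr_const -?[LHS]mulr_natl // => m _.
  by rewrite fa expr0n mulr0 mul0r eqxx eq_sym.
rewrite -card_sqrt // card_sumr; apply: eq_bigr => b _.
case: eqP => [fb|_] /=; last by rewrite big1.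
have b2 : 2 * b != 0.
  by rewrite mulf_neq0 //; apply: contraNneq fa => b0; rewrite -fb b0 expr0n.
rewrite (bigD1 (f^`().[a] / (2 * b))) //= mulrC divfK // eqxx big1 ?addr0 // => m mN.
rewrite mulrC; case: eqP => // mE; case/eqP: mN.
by rewrite -mE mulfK.
Qed.

(** The v of degree less than 2 represent the field F[X]/(u), and the admissible ones are the square
    roots of f there. *)
Lemma mumford_irreducible u : u \in monics F 2 -> (forall a, ~~ root u a) ->
  mumford u = 1 + lam u.
Proof.
rewrite mem_monics => /andP[mu /eqP szu] noroot.
have pu : prime_poly u.
  by apply/prime_polyP; split=> //; apply: cubic_irreducible => //; rewrite szu.
have du : deg u = 2 by rewrite /deg szu.
have [K [red [cardK surj ker]]] := exists_residue_field pu.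
pose emb : {rmorphism F -> K} := const_map red.
have two_neq0K : (2 : K) != 0 by rewrite -(rmorph_nat emb) fmorph_eq0.
have ru : root (map_poly emb u) (red 'X).
  by rewrite rootE (horner_const_map red) ker dvdpp.
have := cubic_lam_root two_neq0 char_C cardK pu ru.
rewrite divnn (deg_prime_gt0 pu) expr1 => <-.
rewrite (horner_const_map red) -card_sqrt // card_sumr.
rewrite (sum_residues pu surj ker) du; apply: eq_bigr => v _; congr (nat_of_bool _)%:R.
by rewrite -ker rmorphB rmorphXn subr_eq0 eq_sym.
Qed.

(** One formula for the three types of u. Only the squares (X - a)^2 deviate from the expansion of
    (1 + chi f(a)) (1 + chi f(b)), and their defect is 1 - q or 1 according as a is a multiple root
    or not. *)
Lemma mumford_pointwise u : u \in monics F 2 ->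
  mumford u + \sum_a (u == ('X - a%:P) ^+ 2)%R%:R * (1 - q * (multiple_root a)%:R) =
  1 + \sum_a (root u a)%:R * qchar f.[a] + lam u.
Proof.
move=> um; have [noroot|] := boolP [forall a, ~~ root u a].
  have nr := forallP noroot; rewrite mumford_irreducible // big1 ?addr0; last first.
    move=> a _; case: eqP => [Du|_]; last by rewrite mul0r.
    by have := nr a; rewrite Du expr2 rootM root_XsubC eqxx.
  by rewrite big1 ?addr0 // => a _; rewrite (negPf (nr a)) mul0r.
rewrite negb_forall => /existsP[a]; rewrite negbK => /factor_theorem[w Dw].
move: um; rewrite mem_monics => /andP[mu /eqP szu].
have mX (c : F) := monicXsubC c.
have mw : w \is monic by move: mu; rewrite Dw monicMr.
have szw : size w = 2.
  by have := szu; rewrite Dw size_monicM // [deg ('X - _)]/deg size_XsubC (size_deg mw) addn1 => -[->].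
have Dw' : w = 'X - (- w`_0)%:P.
  apply/polyP => -[|[|i]]; rewrite coefB coefX coefC /= ?subr0 ?sub0r ?opprK //.
    by move/monicP: mw; rewrite lead_coefE szw.
  by rewrite nth_default // szw.
move: (- w`_0) Dw' Dw => b -> Du {w mw szw}.
have lamu : lam u = qchar f.[b] * qchar f.[a].
  by rewrite Du cubic_lamM // !(cubic_lam_XsubC char_C).
have rootu c : root u c = (c == b) || (c == a) by rewrite Du rootM !root_XsubC.
have squ c : u == ('X - c%:P) ^+ 2 -> (c == a) && (c == b).
  move=> /eqP E; have ra : root u a by rewrite rootu eqxx orbT.
  have rb : root u b by rewrite rootu eqxx.
  move: ra rb; rewrite E expr2 !rootM !root_XsubC !orbb.
  by rewrite ![_ == c]eq_sym => -> ->.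
rewrite lamu; have [ab|ab] := eqVneq a b.
  move: Du rootu squ; rewrite -ab -expr2 => Du rootu squ.
  have -> : \sum_c (u == ('X - c%:P) ^+ 2)%R%:R * (1 - q * (multiple_root c)%:R) =
      1 - q * (multiple_root a)%:R.
    rewrite -(sum_delta a (fun c => 1 - q * (multiple_root c)%:R)).
    apply: eq_bigr => c _; case: (eqVneq c a) => [->|ca]; first by rewrite Du eqxx.
    by have := squ c; case: (u == _) => [/(_ isT)|_]; rewrite ?(negPf ca) ?mul0r.
  have -> : \sum_c (root u c)%:R * qchar f.[c] = qchar f.[a].
    rewrite -(sum_delta a (fun c => qchar f.[c])).
    by apply: eq_bigr => c _; rewrite rootu orbb.
  rewrite Du -?expr2 mumford_double qchar_sq // /multiple_root.
  have [fa|fa] := eqVneq f.[a] 0.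
    by rewrite fa /qchar eqxx /= addr0 addr0 addrC subrK.
  by rewrite /= mulr0 subr0 addrAC.
rewrite big1 ?addr0; last first.
  move=> c _; have := squ c; case: (u == _) => [/(_ isT)|_]; last by rewrite mul0r.
  by case/andP => /eqP -> ab'; rewrite ab' in ab.
rewrite (eq_bigr (fun c => (c == a)%:R * qchar f.[c] + (c == b)%:R * qchar f.[c])); last first.
  move=> c _; rewrite rootu -mulrDl; case: (eqVneq c a) => [->|_]; last by rewrite orbF add0r.
  by rewrite (negPf ab) /= addr0.
rewrite big_split /= !sum_delta Du mulrC mumford_split //; ring.
Qed.

(** Sum [mumford_pointwise] over u: the terms q^2 and q times the character sum of f occur on both
    sides and cancel. *)
Lemma Lcoef2_cubic : Lcoef lam 2 = q * (1 - \sum_a (multiple_root a)%:R).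
Proof.
have H : \sum_(u <- monics F 2) (mumford u +
    \sum_a (u == ('X - a%:P) ^+ 2)%R%:R * (1 - q * (multiple_root a)%:R)) =
   \sum_(u <- monics F 2) (1 + \sum_a (root u a)%:R * qchar f.[a] + lam u).
  by rewrite big_seq [RHS]big_seq; apply: eq_bigr => u; apply: mumford_pointwise.
have H1 : \sum_(u <- monics F 2) \sum_a
     (u == ('X - a%:P) ^+ 2)%R%:R * (1 - q * (multiple_root a)%:R) =
     q - q * \sum_a (multiple_root a)%:R.
  rewrite exchange_big /=.
  transitivity (\sum_a (1 - q * (multiple_root a)%:R)); last first.
    by rewrite big_split /= sumr_const sumrN -mulr_sumr.
  apply: eq_bigr => a _; rewrite -mulr_suml (bigD1_seq (('X - a%:P) ^+ 2)) ?monics_uniq //=.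
    by rewrite eqxx big1 ?addr0 ?mul1r // => u /negPf ->.
  by rewrite mem_monics monic_exp ?monicXsubC // size_exp_XsubC.
have H2 : \sum_(u <- monics F 2) \sum_a (root u a)%:R * qchar f.[a] =
     q * \sum_a qchar f.[a].
  rewrite exchange_big mulr_sumr /=; apply: eq_bigr => a _; rewrite -mulr_suml; congr (_ * _).
  have := @sum_multiples F _ (fun=> 1 : algC) (fun _ _ _ _ => esym (mulr1 1)) _ 2 (monicXsubC a).
  rewrite [deg _]/deg size_XsubC /= mul1r /Lcoef sum_monics_const expr1 => <-.
  by rewrite [RHS]big_mkcond /=; apply: eq_bigr => u _; rewrite dvdp_XsubCl; case: root.
move: H; rewrite big_split /= sum_mumford H1 !big_split /= H2 sum_monics_const -/(Lcoef lam 2).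
set s := \sum_a qchar _; set mu := \sum_a _; move=> H.
apply: (addrI (q ^+ 2 + q * s)); rewrite -H; ring.
Qed.

End QuadraticCoefficient.

(** * Newton sums of one fibre *)

Definition affine_card (F : finFieldType) (a1 a3 : F) : nat :=
  #|[pred z : F * F | z.2 ^+ 2 + a1 * z.1 * z.2 + a3 * z.2 == z.1 ^+ 3]|.

Definition disc13 (F : fieldType) (a1 a3 : F) := a3 ^+ 3 * (a1 ^+ 3 - 27 * a3).

Section Fiber.
Variables (F : finFieldType) (a1 a3 : F).
Hypothesis two_neq0 : (2 : F) != 0.
Hypothesis three_neq0 : (3 : F) != 0.

(* (y + (a1 x + a3)/2)^2 for (x, y) on the curve *)
Definition completed_cubic : {poly F} := 'X^3 + ((a1 / 2) *: 'X + (a3 / 2)%:P) ^+ 2.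
Local Notation f := completed_cubic.

Lemma size_completed_sq : (size (((a1 / 2) *: 'X + (a3 / 2)%:P) ^+ 2)%R < size ('X^3 : {poly F})%R)%N.
Proof.
have sz : (size ((a1 / 2) *: 'X + (a3 / 2)%:P)%R <= 2)%N.
  rewrite (leq_trans (size_polyD _ _)) // geq_max (leq_trans (size_scale_leq _ _)) ?size_polyX //=.
  exact: leq_trans (size_polyC_leq1 _) _.
rewrite size_polyXn expr2 ltnS (leq_trans (size_polyMleq _ _)) //.
by have := leq_add sz sz; case: (_ + _)%N.
Qed.

Lemma monic_completed : f \is monic.
Proof. by rewrite monicE lead_coefDl ?size_completed_sq // lead_coefXn. Qed.

Lemma size_completed : size f = 4.
Proof. by rewrite size_polyDl ?size_completed_sq // size_polyXn. Qed.

Lemma completed_horner x : f.[x] = x ^+ 3 + ((a1 * x + a3) / 2) ^+ 2.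
Proof. by rewrite /f !hornerE /=; congr (_ + _ ^+ 2); field. Qed.

Lemma completed_deriv x : f^`().[x] = 3 * x ^+ 2 + a1 * ((a1 * x + a3) / 2).
Proof. by rewrite /f !derivE !hornerE /=; field. Qed.

Lemma affine_cardE : (affine_card a1 a3)%:R = #|F|%:R + \sum_x qchar f.[x] :> algC.
Proof.
rewrite /affine_card card_sumr.
rewrite -(pair_bigA _ (fun x y => (y ^+ 2 + a1 * x * y + a3 * y == x ^+ 3)%R%:R)) /=.
transitivity (\sum_x (1 + qchar f.[x])); last by rewrite big_split /= sumr_const.
apply: eq_bigr => x _; rewrite -card_sqrt // card_sumr.
rewrite (reindex_inj (addIr (- ((a1 * x + a3) / 2)))) /=; apply: eq_bigr => y _.
congr (nat_of_bool _)%:R; rewrite completed_horner -subr_eq0 -[RHS]subr_eq0; congr (_ == _).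
by field.
Qed.

(** There is at most one multiple root: 0 if a3 = 0, and -a1^2/9 otherwise; it is one precisely when
    the discriminant vanishes. *)
Lemma sum_multiple_roots :
  \sum_a (multiple_root f a)%:R = (disc13 a1 a3 == 0)%R%:R :> algC.
Proof.
pose r := if a3 == 0 then 0 else - a1 ^+ 2 / 9.
have nine_neq0 : (9 : F) != 0.
  by have -> : (9 : F) = 3 * 3; [ring | rewrite mulf_neq0].
suff H a : multiple_root f a = (a == r) && (disc13 a1 a3 == 0).
  under eq_bigr => a _ do rewrite H -mulnb natrM.
  by rewrite sum_delta.
rewrite /multiple_root completed_horner completed_deriv /r /disc13 mulf_eq0 expf_eq0 /= subr_eq0.
have [->|a3n0] := eqVneq a3 0.
  rewrite /= andbT; apply/andP/eqP => [[/eqP e1 /eqP e2]|->]; last first.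
    by split; apply/eqP; field.
  have : a ^+ 3 = a * (3 * a ^+ 2 + a1 * ((a1 * a + 0) / 2)) - 2 * (a ^+ 3 + ((a1 * a + 0) / 2) ^+ 2) by field.
  by rewrite e1 e2 !mulr0 subrr => /eqP; rewrite expf_eq0 => /eqP.
set h := (a1 * a + a3) / 2; have Eh : 2 * h = a1 * a + a3 by rewrite /h; field.
rewrite /=; apply/andP/andP => [[/eqP e1 /eqP e2]|[/eqP Da /eqP e1]]; last first.
  have n27 : (27 : F) != 0.
    by have -> : (27 : F) = 3 * 9; [ring | rewrite mulf_neq0].
  have D3 : a3 = a1 ^+ 3 / 27 by rewrite e1; field.
  by rewrite /h Da D3; split; apply/eqP; field; rewrite ?two_neq0 ?nine_neq0 ?n27.
have h0 : h != 0.
  apply: contraNneq a3n0 => h0; move: e1; rewrite h0 expr0n addr0 => /eqP; rewrite expf_eq0 /= => /eqP a0.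
  by move: Eh; rewrite h0 a0 !mulr0 add0r => <-.
(* With f(a) = a^3 + h^2 and f'(a) = 3 a^2 + a1 h, the combination 3 f(a) - a f'(a) is h (3 h - a1
   a). Together with 2 h = a1 a + a3 this gives h = -a3, and then a. *)
have E3 : 3 * h = a1 * a.
  apply: (mulfI h0); apply/eqP; rewrite -subr_eq0 -mulrBr.
  have -> : h * (3 * h - a1 * a) = 3 * (a ^+ 3 + h ^+ 2) - a * (3 * a ^+ 2 + a1 * h) by ring.
  by rewrite e1 e2 !mulr0 subrr.
have Dh : h = - a3.
  have -> : h = 3 * h - 2 * h by ring.
  by rewrite E3 Eh; ring.
have Ea : 9 * a = - a1 ^+ 2.
  apply: (mulIf a3n0); apply/eqP; rewrite -subr_eq0 -oppr_eq0.
  have -> : - (9 * a * a3 - - a1 ^+ 2 * a3) = 3 * a * (3 * - a3) + a1 ^+ 2 * (- a3) by ring.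
  rewrite -Dh E3.
  have -> : 3 * a * (a1 * a) + a1 ^+ 2 * h = a1 * (3 * a ^+ 2 + a1 * h) by ring.
  by rewrite e2 mulr0.
split; apply/eqP; first by rewrite -Ea mulrAC mulfV ?mul1r.
have -> : a1 ^+ 3 = - (9 * a1 * a) + a1 * (9 * a - - a1 ^+ 2) by ring.
rewrite Ea subrr mulr0 addr0 -[9 * a1 * a]mulrA -E3 Dh; ring.
Qed.

End Fiber.

Lemma map_completed_cubic (F E : finFieldType) (emb : {rmorphism F -> E}) (a1 a3 : F) :
  map_poly emb (completed_cubic a1 a3) = completed_cubic (emb a1) (emb a3).
Proof.
rewrite /completed_cubic rmorphD rmorphXn /= rmorphXn rmorphD /= map_polyZ /= map_polyX map_polyC /=.
by rewrite !fmorph_div !rmorph_nat.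
Qed.

(** The polynomial is the L-function of [cubic_lam], and N its Newton sums, that is, minus the
    traces. One sequence N serves every truncation n and every extension E. *)
Lemma fiber_logder (F : finFieldType) (a1 a3 : F) : (2 : F) != 0 -> (3 : F) != 0 ->   exists N : nat -> algC,
  (forall n, logder n (1 + ((affine_card a1 a3)%:R - #|F|%:R) *: 'X
     + (if disc13 a1 a3 == 0 then 0 else #|F|%:R) *: 'X^2) N) /\
  (forall (E : finFieldType) (emb : {rmorphism F -> E}) n, #|E| = (#|F| ^ n)%N ->
     N n = (affine_card (emb a1) (emb a3))%:R - #|E|%:R).
Proof.
move=> two_neq0 three_neq0.
have [C char_C] := exists_companion (monic_completed a1 a3) (size_completed a1 a3).
have lam1 := cubic_lam1 C two_neq0.
have lamM := cubic_lamM C two_neq0.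
exists (psum (cubic_lam C)); split=> [n|E emb n cardE]; last first.
  rewrite (psum_ext (emb := emb) cardE (Lam := fun beta => qchar (map_poly emb (completed_cubic a1 a3)).[beta])); last first.
    by move=> pi beta; apply: cubic_lam_root.
  have two_neq0E : (2 : E) != 0 by rewrite -(rmorph_nat emb) fmorph_eq0.
  rewrite map_completed_cubic affine_cardE // addrC addKr.
  by apply: eq_bigr.
set P := _ + _ *: 'X^2.
have PE k : P`_k = Lcoef (cubic_lam C) k.
  rewrite /P !coefD coef1 !coefZ coefX coefXn.
  case: k => [|[|[|k]]] /=.
  - by rewrite !mulr0 !addr0 Lcoef0.
  - rewrite mulr0 mulr1 addr0 add0r affine_cardE // addrC addKr Lcoef1.
    by apply: eq_bigr => a _; rewrite (cubic_lam_XsubC char_C).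
  - rewrite mulr0 mulr1 !add0r (Lcoef2_cubic two_neq0 char_C) sum_multiple_roots //.
    by case: eqP => _; rewrite ?subrr ?subr0 ?mulr0 ?mulr1.
  by rewrite !mulr0 !addr0 (Lcoef_cubic_vanish two_neq0 char_C).
by move=> m _; rewrite PE newton //; apply: eq_bigr => i _; rewrite PE.
Qed.

(** * Teichmueller characters *)

Section Reduction.
Variables (P : prime_idealr Zbar) (p : nat).
Hypotheses (pr_p : prime p) (pP : p%:R \in P).
Local Notation Fbar := {ideal_quot P}.
Implicit Types (w z : Zbar).

Definition redP : {rmorphism Zbar -> Fbar} := \pi_Fbar%qT.

Lemma redP_surj (x : Fbar) : exists z, redP z = x.
Proof. by exists (repr x); apply: reprK. Qed.

Lemma redP_eq0 z : (redP z == 0) = (z \in P).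
Proof. by rewrite -[0](rmorph0 redP) /redP /= piE Quotient.equivE subr0. Qed.

Lemma pchar_Fbar : p \in [pchar Fbar].
Proof. by rewrite inE pr_p -(rmorph_nat redP) redP_eq0. Qed.

Lemma Zbar_mul_eq0 w z : w * z = 0 -> (w = 0) \/ (z = 0).
Proof.
move=> /(congr1 val) /eqP; rewrite -[val (w * z)]/(val w * val z) mulf_eq0.
by case/orP => /eqP wz; [left | right]; apply: val_inj.
Qed.

Lemma Zbar_valX z m : val (z ^+ m) = val z ^+ m.
Proof. by elim: m => // m IHm; rewrite !exprS -IHm. Qed.

Lemma natr_coprime_Fbar m : coprime m p -> (m%:R : Fbar) != 0.
Proof.
move=> cmp; apply/negP => /eqP m0.
have p0 : (p%:R : Fbar) = 0 by apply: pcharf0 pchar_Fbar.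
have [m_gt0|] := posnP m; first by move: cmp; rewrite m_gt0 /coprime gcd0n => /eqP p1; have := pr_p; rewrite p1.
case/(egcdnP p) => km kn E _.
have /(congr1 (fun i => i%:R : Fbar)) := E.
rewrite (eqP cmp) natrD !natrM m0 p0 !mulr0 add0r => /eqP.
by rewrite eq_sym oner_eq0.
Qed.

(** Otherwise the sum of the w^i for i < m is 0, while its reduction is m, which is nonzero. *)
Lemma redP_unity w m : coprime m p -> w ^+ m = 1 -> redP w = 1 -> w = 1.
Proof.
move=> cmp wm rw; apply/eqP; rewrite -subr_eq0; apply/eqP.
have : (w - 1) * \sum_(i < m) w ^+ i = 0 by rewrite -subrX1 wm subrr.
case/Zbar_mul_eq0 => // /(congr1 redP); rewrite rmorph_sum rmorph0 /=.
under eq_bigr do rewrite rmorphXn /= rw expr1n.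
by rewrite sumr_const card_ord => /eqP; rewrite (negPf (natr_coprime_Fbar cmp)).
Qed.

Lemma redP_unity_inj w z m k : coprime m p -> coprime k p -> w ^+ m = 1 -> z ^+ k = 1 ->
  redP w = redP z -> w = z.
Proof.
move=> cm ck wm zk rwz; have k0 : (0 < k)%N.
  by case: k ck {zk} => //; rewrite /coprime gcd0n => /eqP p1; have := pr_p; rewrite p1.
have zV : z ^+ k.-1 * z = 1 by rewrite -exprSr prednK.
have : w * z ^+ k.-1 = 1.
  apply: (@redP_unity _ (m * k)); first by rewrite coprimeMl cm.
    by rewrite exprMn exprM wm expr1n mul1r -exprM mulnCA mulnC exprM mulnC exprM zk !expr1n.
  by rewrite rmorphM rwz -rmorphM mulrC zV rmorph1.
by move=> /(congr1 (fun t => t * z)); rewrite -mulrA zV mulr1 mul1r.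
Qed.

Lemma theta_eq z m : coprime m p -> z ^+ m = 1 -> theta p (redP z) = z.
Proof.
move=> cm zm; have m0 : (0 < m)%N.
  by case: m cm {zm} => //; rewrite /coprime gcd0n => /eqP p1; have := pr_p; rewrite p1.
apply: xget_unique.
  split=> //; have [k pk dk] := prim_order_exists m0 zm; exists k => //.
  exact: coprime_dvdl dk cm.
move=> y [[k ck pk] ry]; apply: redP_unity_inj ck cm _ zm ry.
exact: prim_expr_order pk.
Qed.

End Reduction.

Section FixedField.
Variables (P : prime_idealr Zbar) (p k : nat).
Hypotheses (pr_p : prime p) (pP : p%:R \in P) (k_gt0 : (0 < k)%N).
Local Notation Fbar := {ideal_quot P}.
Local Notation Q := (p ^ k)%N.
Local Notation N := (Q.-1).
Local Notation red := (redP P).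

Lemma Q_gt1 : (1 < Q)%N.
Proof. by rewrite -(expn0 p) ltn_exp2l // prime_gt1. Qed.

Lemma N_gt0 : (0 < N)%N.
Proof. by rewrite -subn1 subn_gt0 Q_gt1. Qed.

Lemma coprime_N : coprime N p.
Proof.
have : coprime N Q by rewrite -{2}(prednK (ltnW Q_gt1)) coprimenS.
by rewrite coprime_pexpr.
Qed.

Lemma Zbar_prim_root : exists z : Zbar, N.-primitive_root (val z).
Proof.
by have [z pz] := C_prim_root_exists N_gt0; exists (exist _ z (Aint_prim_root pz)).
Qed.

Definition fixed_elt : {pred Fbar} := fun x => x ^+ Q == x.

(** Lift x to y in the algebraic integers. The factorization of y^N - 1 into the y - z^i reduces to
    a vanishing product of the x - z^i in a domain. *)
Lemma fixed_eltP (z : Zbar) (x : Fbar) : N.-primitive_root (val z) ->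
  (x \in fixed_elt) = (x == 0) || (x \in [seq red (z ^+ i) | i <- iota 0 N]).
Proof.
move=> pz; rewrite unfold_in.
have zN : z ^+ N = 1 by apply: val_inj; rewrite Zbar_valX (prim_expr_order pz).
apply/eqP/orP => [xQ|[/eqP ->|/mapP[i _ ->]]]; first last.
- by rewrite -rmorphXn -exprM -[in LHS](prednK (ltnW Q_gt1)) mulnS exprD mulnC exprM zN expr1n mulr1.
- by rewrite expr0n gtn_eqF // ltnW // Q_gt1.
have [x0|x0] := eqVneq x 0; [by left | right].
have xN : x ^+ N = 1.
  have : x * (x ^+ N - 1) = 0 by rewrite mulrBr mulr1 -exprS prednK ?xQ ?subrr // ltnW // Q_gt1.
  by move/Quotient.rquot_IdomainAxiom; rewrite (negPf x0) subr_eq0 => /eqP.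
have [y Dx] := redP_surj x.
have factZ : \prod_(0 <= i < N) (y - z ^+ i) = y ^+ N - 1.
  apply: val_inj; rewrite (big_morph val (id1 := 1) (op1 := *%R)) //.
  rewrite -[RHS]/(val (y ^+ N) - 1) Zbar_valX.
  have := congr1 (fun f : {poly algC} => f.[val y]) (factor_Xn_sub_1 pz).
  rewrite /= !hornerE horner_prod => <-; apply: eq_bigr => i _.
  by rewrite hornerXsubC -Zbar_valX.
have : \prod_(0 <= i < N) (x - red (z ^+ i)) = 0.
  have : red (y ^+ N - 1) = 0 by rewrite rmorphB rmorphXn Dx xN rmorph1 subrr.
  by rewrite -factZ rmorph_prod => <-; apply: eq_bigr => i _; rewrite rmorphB Dx.
rewrite /index_iota subn0; elim: (iota 0 N) => [|i s IHs].
  by rewrite big_nil => /eqP; rewrite oner_eq0.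
rewrite big_cons => /Quotient.rquot_IdomainAxiom; rewrite subr_eq0 inE.
by case: eqP => //= _ /eqP /IHs.
Qed.

Lemma fixed_subring : subring_closed fixed_elt.
Proof.
have chP := pchar_Fbar pr_p pP.
have natQ : [pchar Fbar].-nat Q.
  by rewrite pnatX; apply/orP; left; rewrite (eq_pnat _ (pcharf_eq chP)) pnat_id.
split=> [|x y|x y]; rewrite !unfold_in ?expr1n // => /eqP xQ /eqP yQ.
  by rewrite exprDn_pchar // exprNn_pchar // xQ yQ.
by rewrite exprMn xQ yQ.
Qed.

HB.instance Definition _ := GRing.isSubringClosed.Build Fbar fixed_elt fixed_subring.

Definition fixed_type := {x : Fbar | x \in fixed_elt}.
HB.instance Definition _ := SubType.on fixed_type.
HB.instance Definition _ := Choice.on fixed_type.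
HB.instance Definition _ := [SubChoice_isSubComNzRing of fixed_type by <:].

Lemma fixed_expr (x : fixed_type) : x ^+ Q = x.
Proof. by apply: val_inj; rewrite [val _]rmorphXn /=; apply/eqP/(valP x). Qed.

(** The quotient by the prime ideal P serves only as a domain, so the inverse is a power, by
    Fermat. *)
Definition fixed_inv (x : fixed_type) := if x == 0 then 0 else x ^+ (Q - 2).

Lemma fixed_mulV (x : fixed_type) : x != 0 -> fixed_inv x * x = 1.
Proof.
move=> x0; rewrite /fixed_inv (negPf x0); have : x * (x ^+ (Q - 2) * x - 1) = 0.
  rewrite mulrBr mulr1 -exprSr -exprS -{2}(fixed_expr x).
  by rewrite -addn2 subnK ?Q_gt1 // subrr.
move/(congr1 val) => /Quotient.rquot_IdomainAxiom /orP[].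
  by rewrite -[X in _ == X]/(val (0 : fixed_type)) (inj_eq val_inj) (negPf x0).
by rewrite -[X in _ == X]/(val (0 : fixed_type)) (inj_eq val_inj) subr_eq0 => /eqP.
Qed.

Lemma fixed_inv0 : fixed_inv 0 = 0.
Proof. by rewrite /fixed_inv eqxx. Qed.

HB.instance Definition _ := GRing.ComNzRing_isField.Build fixed_type fixed_mulV fixed_inv0.

Definition fixed_root : Zbar := xchoose Zbar_prim_root.

Definition fixed_list : seq Fbar := 0 :: [seq red (fixed_root ^+ i) | i <- iota 0 N].

Definition fixed_seq : seq fixed_type := pmap insub fixed_list.

Lemma mem_fixed_list x : (x \in fixed_list) = (x \in fixed_elt).
Proof. by rewrite (fixed_eltP _ (xchooseP Zbar_prim_root)) inE. Qed.

Lemma mem_fixed_seq x : x \in fixed_seq.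
Proof. by rewrite mem_pmap_sub /= mem_fixed_list (valP x). Qed.

(** Finiteness comes from the explicit list: 0 and the reductions of the powers of a primitive N-th
    root of unity. *)
Definition fixed_rank (x : fixed_type) : 'I_(size fixed_seq) :=
  Ordinal (etrans (index_mem x fixed_seq) (mem_fixed_seq x)).

Definition fixed_unrank (i : 'I_(size fixed_seq)) : fixed_type := nth 0 fixed_seq i.

Lemma fixed_rankK : cancel fixed_rank fixed_unrank.
Proof. by move=> x; rewrite /fixed_unrank nth_index ?mem_fixed_seq. Qed.

HB.instance Definition _ := Countable.copy fixed_type (can_type fixed_rankK).
HB.instance Definition _ : isFinite fixed_type := CanIsFinite fixed_rankK.

Lemma fixed_list_uniq : uniq fixed_list.
Proof.
have pz := xchooseP Zbar_prim_root; rewrite -/fixed_root in pz.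
have zN : fixed_root ^+ N = 1 by apply: val_inj; rewrite Zbar_valX (prim_expr_order pz).
rewrite /= map_inj_in_uniq ?iota_uniq ?andbT => [|i j].
  apply/negP => /mapP[i _ /esym /eqP]; rewrite redP_eq0 => zi.
  have : fixed_root ^+ (i * N) \in P.
    rewrite -(prednK N_gt0) mulnS exprD mulrC; exact: idealMr.
  by rewrite mulnC exprM zN expr1n idealr1.
rewrite !mem_iota /= add0n => iN jN.
have zij l : (fixed_root ^+ l) ^+ N = 1 by rewrite -exprM mulnC exprM zN expr1n.
move/(redP_unity_inj pr_p pP coprime_N coprime_N (zij i) (zij j)) => /(congr1 val).
rewrite !Zbar_valX => /eqP; rewrite (eq_prim_root_expr pz).
by rewrite !modn_small // => /eqP.
Qed.

Lemma card_fixed : #|{: fixed_type}| = Q.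
Proof.
rewrite cardE -(size_map val) -(perm_size (s1 := fixed_list)).
  by rewrite /= size_map size_iota prednK // ltnW // Q_gt1.
apply: uniq_perm => [||x]; first exact: fixed_list_uniq.
  by rewrite (map_inj_uniq val_inj) enum_uniq.
rewrite mem_fixed_list; apply/idP/mapP => [xf|[y _ ->]]; last exact: (valP y).
by exists (Sub x xf); rewrite ?mem_enum // SubK.
Qed.

(** The field with p^k elements inside the quotient by P, with [theta] as a faithful character. From
    here on the field is an abstract finite field. *)
Lemma exists_teichmuller : exists (E : finFieldType) (inc : {rmorphism E -> Fbar}) (om : E -> algC),
  [/\ #|E| = Q, injective inc, forall x, x ^+ Q = x -> exists y, inc y = x &
   [/\ mult_char om, forall x, om x = 1 -> x = 1 &
    forall x, x != 0 -> om x = val (theta p (inc x))]].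
Proof.
pose om (x : fixed_type) : algC := if x == 0 then 0 else val (theta p (val x)).
have pz := xchooseP Zbar_prim_root; rewrite -/fixed_root in pz.
have zN : fixed_root ^+ N = 1 by apply: val_inj; rewrite Zbar_valX (prim_expr_order pz).
have repr_unit (x : fixed_type) : x != 0 -> exists w : Zbar, w ^+ N = 1 /\ red w = val x.
  move=> x0; have := valP x; rewrite (fixed_eltP _ pz) -[X in _ == X]/(val (0 : fixed_type)).
  rewrite (inj_eq val_inj) (negPf x0) => /mapP[i _ ->]; exists (fixed_root ^+ i); split=> //.
  by rewrite -exprM mulnC exprM zN expr1n.
have thetaE w : w ^+ N = 1 -> theta p (red w) = w by apply: theta_eq => //; apply: coprime_N.
exists fixed_type, val, om; split; first exact: card_fixed.
- exact: val_inj.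
- by move=> x /eqP xQ; exists (exist _ x xQ : fixed_type).
split.
- split; rewrite /om ?eqxx ?oner_eq0 //.
    by rewrite -[val 1](rmorph1 red) thetaE ?expr1n.
  move=> x y; rewrite mulf_eq0.
  have [x0|x0] := eqVneq x 0; first by rewrite mul0r.
  have [y0|y0] := eqVneq y 0; first by rewrite mulr0.
  have [w [wN Dw]] := repr_unit x x0; have [v [vN Dv]] := repr_unit y y0.
  rewrite /= -Dw -Dv -rmorphM !thetaE //.
  by rewrite exprMn wN vN mulr1.
- move=> x; rewrite /om; have [_ /eqP|x0] := eqVneq x 0; first by rewrite eq_sym oner_eq0.
  have [w [wN Dw]] := repr_unit x x0; rewrite -Dw thetaE // => w1; apply: val_inj.
  by rewrite -Dw (_ : w = 1) ?rmorph1 //; apply: val_inj.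
by move=> x x0; rewrite /om (negPf x0).
Qed.

End FixedField.

(** * Embeddings of finite fields *)

Lemma factor_rmorphism (A B C : comNzRingType) (r : {rmorphism A -> B}) (s : {rmorphism A -> C}) :
    (forall b, exists a, r a = b) -> (forall a, r a = 0 -> s a = 0) ->
  exists f : {rmorphism B -> C}, forall a, f (r a) = s a.
Proof.
move=> r_surj ker; have r_surjb b : exists a, r a == b by have [a <-] := r_surj b; exists a.
pose f b := s (xchoose (r_surjb b)).
have fr a : f (r a) = s a.
  apply/eqP; rewrite -subr_eq0 -rmorphB; apply/eqP/ker.
  by rewrite rmorphB (eqP (xchooseP (r_surjb (r a)))) subrr.
have fB : zmod_morphism f.
  by move=> x y; have [a <-] := r_surj x; have [b <-] := r_surj y; rewrite -rmorphB !fr rmorphB.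
have fM : monoid_morphism f.
  split; first by rewrite -(rmorph1 r) fr rmorph1.
  by move=> x y; have [a <-] := r_surj x; have [b <-] := r_surj y; rewrite -rmorphM !fr rmorphM.
pose mB := GRing.isZmodMorphism.Build B C f fB.
pose mM := GRing.isMonoidMorphism.Build B C f fM.
by pose fR : {rmorphism _ -> _} := HB.pack f mB mM; exists fR.
Qed.

Lemma lift_rmorphism (A B C : comNzRingType) (inc : {rmorphism B -> C}) (s : {rmorphism A -> C}) :
    injective inc -> (forall a, exists b, inc b = s a) ->
  exists f : {rmorphism A -> B}, forall a, inc (f a) = s a.
Proof.
move=> inc_inj surj; have surjb a : exists b, inc b == s a by have [b <-] := surj a; exists b.
pose f a := xchoose (surjb a).
have fE a : inc (f a) = s a by apply/eqP/(xchooseP (surjb a)).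
have fB : zmod_morphism f by move=> x y; apply: inc_inj; rewrite rmorphB !fE rmorphB.
have fM : monoid_morphism f.
  by split=> [|x y]; apply: inc_inj; rewrite ?rmorphM !fE ?rmorphM // !rmorph1.
pose mB := GRing.isZmodMorphism.Build A B f fB.
pose mM := GRing.isMonoidMorphism.Build A B f fM.
by pose fR : {rmorphism _ -> _} := HB.pack f mB mM; exists fR.
Qed.

Definition horner_emb (F E : finFieldType) (emb : {rmorphism F -> E}) (x : E) : {poly F} -> E :=
  horner_eval x \o map_poly emb.
HB.instance Definition _ F E emb x := GRing.RMorphism.on (@horner_emb F E emb x).

Lemma embed_residue_field (F K E : finFieldType) (red : {rmorphism {poly F} -> K})
    (emb : {rmorphism F -> E}) (pi : {poly F}) beta :
    (forall x, exists g, red g = x) -> (forall g, (red g == 0) = (pi %| g)) ->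
    root (map_poly emb pi) beta ->
  exists f : {rmorphism K -> E}, forall g, f (red g) = (map_poly emb g).[beta].
Proof.
move=> surj ker rpi.
have [|f Hf] := @factor_rmorphism _ _ _ red (horner_emb emb beta) surj; last by exists f.
move=> g /eqP; rewrite ker => /dvdpP[h ->].
have E0 : (map_poly emb (h * pi)).[beta] = 0 by rewrite rmorphM hornerM (rootP rpi) mulr0.
exact: E0.
Qed.

Lemma prime_field_emb (E : finFieldType) p : p \in [pchar E] ->
  exists f : {rmorphism 'F_p -> E}, True.
Proof.
move=> chE; exists (GRing.in_alg (pPrimeCharType chE) : {rmorphism 'F_p -> pPrimeCharType chE}).
by [].
Qed.

(** A generator g of the units generates F over the prime field, and the degree of its minimal
    polynomial divides that of E, which therefore contains a root to send g to. *)
Lemma finField_embed (F E : finFieldType) n : #|E| = (#|F| ^ n)%N ->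
  exists f : {rmorphism F -> E}, True.
Proof.
move=> cardE; have [p pr_p chF] := finPcharP F.
have cF := card_pprimeChar chF; set k := logn _ _ in cF.
have n0 : (0 < n)%N by have := finNzRing_gt1 E; rewrite cardE; case: n {cardE}.
have cE : #|E| = (p ^ (k * n))%N by rewrite cardE cF expnM.
have chE := card_finPcharP cE pr_p.
have [eF _] := prime_field_emb chF; have [eE _] := prime_field_emb chE.
have cFp : #|'F_p| = p by rewrite card_Fp.
have cF' : #|F| = (#|'F_p| ^ k)%N by rewrite cFp.
have cE' : #|E| = (#|'F_p| ^ (k * n))%N by rewrite cFp.
have [g pg] := exists_generator F.
have [pi ppi rg] := exists_min_prime eF cF' g.
have dk := root_prime_deg cF' ppi rg.
have [gam rgam] := exists_root_prime eE cE' ppi (dvdn_mulr _ dk).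
have surj x : exists h, horner_emb eF g h = x.
  have [->|x0] := eqVneq x 0; first by exists 0; rewrite rmorph0.
  have [i ->] := prim_rootP pg (expr_units x0).
  exists 'X^i; have E0 : (map_poly eF 'X^i).[g] = g ^+ i by rewrite map_polyXn hornerXn.
  exact: E0.
have [|f _] := @factor_rmorphism _ _ _ (horner_emb eF g) (horner_emb eE gam) surj; last by exists f.
move=> h h0; have rh : root (map_poly eF h) g by apply/rootP; exact: h0.
have [u Du] := dvdpP _ _ (root_prime_dvd ppi rg rh).
have E0 : (map_poly eE h).[gam] = 0 by rewrite Du rmorphM hornerM (rootP rgam) mulr0.
exact: E0.
Qed.

(** * Minimal models *)

Section ChangeOfVariables.
Variable K : fieldType.
Implicit Types W : weierstrass K.

Definition changed_by (u r s t : K) W W' :=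
  [/\ u * a1 W' = a1 W + 2 * s,
      u ^+ 2 * a2 W' = a2 W - s * a1 W + 3 * r - s ^+ 2,
      u ^+ 3 * a3 W' = a3 W + r * a1 W + 2 * t,
      u ^+ 4 * a4 W' = a4 W - s * a3 W + 2 * r * a2 W - (t + r * s) * a1 W
                       + 3 * r ^+ 2 - 2 * s * t
    & u ^+ 6 * a6 W' = a6 W + r * a4 W + r ^+ 2 * a2 W + r ^+ 3
                       - t * a3 W - t ^+ 2 - r * t * a1 W].

Definition c4 W : K := (a1 W ^+ 2 + 4 * a2 W) ^+ 2 - 24 * (2 * a4 W + a1 W * a3 W).

(** Weighted homogeneity: multiplied by u^6, the new equation involves only the u^i a_i', which the
    relations express directly. [c4_changed] and [disc_changed] rest on the same device. *)
Lemma weq_changed u r s t W W' x y : changed_by u r s t W W' ->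
  weq W (u ^+ 2 * x + r) (u ^+ 3 * y + u ^+ 2 * s * x + t) = u ^+ 6 * weq W' x y.
Proof.
case=> e1 e2 e3 e4 e6.
have -> : u ^+ 6 * weq W' x y = (u ^+ 3 * y) ^+ 2 + (u * a1 W') * (u ^+ 2 * x) * (u ^+ 3 * y)
   + (u ^+ 3 * a3 W') * (u ^+ 3 * y) - ((u ^+ 2 * x) ^+ 3 + (u ^+ 2 * a2 W') * (u ^+ 2 * x) ^+ 2
   + (u ^+ 4 * a4 W') * (u ^+ 2 * x) + u ^+ 6 * a6 W') by rewrite /weq; ring.
by rewrite e1 e2 e3 e4 e6 /weq; ring.
Qed.

Lemma c4_changed u r s t W W' : changed_by u r s t W W' -> u ^+ 4 * c4 W' = c4 W.
Proof.
case=> e1 e2 e3 e4 e6.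
have -> : u ^+ 4 * c4 W' = ((u * a1 W') ^+ 2 + 4 * (u ^+ 2 * a2 W')) ^+ 2
   - 24 * (2 * (u ^+ 4 * a4 W') + (u * a1 W') * (u ^+ 3 * a3 W')) by rewrite /c4; ring.
by rewrite e1 e2 e3 e4 /c4; ring.
Qed.

Definition disc_poly (a1 a2 a3 a4 a6 : K) : K :=
  let b2 := a1 ^+ 2 + 4 * a2 in
  let b4 := 2 * a4 + a1 * a3 in
  let b6 := a3 ^+ 2 + 4 * a6 in
  let b8 := a1 ^+ 2 * a6 + 4 * a2 * a6 - a1 * a3 * a4 + a2 * a3 ^+ 2 - a4 ^+ 2 in
  - b2 ^+ 2 * b8 - 8 * b4 ^+ 3 - 27 * b6 ^+ 2 + 9 * b2 * b4 * b6.

Lemma disc_changed u r s t W W' : changed_by u r s t W W' -> u ^+ 12 * disc W' = disc W.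
Proof.
case=> e1 e2 e3 e4 e6.
have -> : u ^+ 12 * disc W' = disc_poly (u * a1 W') (u ^+ 2 * a2 W') (u ^+ 3 * a3 W')
   (u ^+ 4 * a4 W') (u ^+ 6 * a6 W') by rewrite /disc /disc_poly; ring.
by rewrite e1 e2 e3 e4 e6 /disc /disc_poly; ring.
Qed.

Lemma disc_13 (a b : K) : disc (Weierstrass a 0 b 0 0) = disc13 a b.
Proof. by rewrite /disc /disc13 /=; ring. Qed.

Lemma changed_scaling (A B u0 : K) u r s t W' : u0 != 0 ->
  changed_by u r s t (Weierstrass A 0 B 0 0) W' ->
  changed_by (u / u0) (r / u0 ^+ 2) (s / u0) (t / u0 ^+ 3)
    (Weierstrass (A / u0) 0 (B / u0 ^+ 3) 0 0) W'.
Proof.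
move=> u00 [/= e1 e2 e3 e4 e6]; split=> /=.
- by rewrite mulrAC e1; field.
- by rewrite expr_div_n mulrAC e2; field.
- by rewrite expr_div_n mulrAC e3; field.
- by rewrite expr_div_n mulrAC e4; field.
by rewrite expr_div_n mulrAC e6; field.
Qed.

Lemma isomorphic_scaling (A B u0 : K) W : u0 != 0 ->
    isomorphic (Weierstrass A 0 B 0 0) W ->
  exists u r s t, u != 0 /\
    changed_by u r s t (Weierstrass (A / u0) 0 (B / u0 ^+ 3) 0 0) W.
Proof.
move=> u0n0 [u [r [s [t [un0 ch]]]]].
exists (u / u0), (r / u0 ^+ 2), (s / u0), (t / u0 ^+ 3).
by split; [rewrite mulf_neq0 ?invr_neq0 | apply: changed_scaling].
Qed.

Lemma isomorphic_scaled (A B u0 : K) : u0 != 0 ->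
  isomorphic (Weierstrass A 0 B 0 0) (Weierstrass (A / u0) 0 (B / u0 ^+ 3) 0 0).
Proof. by move=> u0n0; exists u0, 0, 0, 0; split=> //; split=> /=; field. Qed.

Lemma disc_ratio u r s t W W' : u != 0 -> disc W != 0 -> changed_by u r s t W W' ->
  disc W' / disc W = u^-1 ^+ 12 /\ disc W / disc W' = u ^+ 12.
Proof.
move=> un0 dn0 ch; have D := disc_changed ch.
have d'n0 : disc W' != 0 by apply: contraNneq dn0 => dW; rewrite -D dW mulr0.
split; last by rewrite -D mulfK.
by rewrite -D exprVn invfM mulrCA mulfV ?mulr1.
Qed.

Lemma pow12_inv (u : K) : u != 0 -> u = u^-1 ^+ 11 * u ^+ 12.
Proof. by move=> un0; rewrite exprVn [u ^+ 12]exprS mulrCA mulVf ?mulr1 // expf_neq0. Qed.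

End ChangeOfVariables.

Definition weierstrass_card (k : finFieldType) (W : weierstrass k) : nat :=
  #|[pred z : k * k | weq W z.1 z.2 == 0]|.

Lemma weierstrass_card13 (k : finFieldType) (a b : k) :
  weierstrass_card (Weierstrass a 0 b 0 0) = affine_card a b.
Proof.
apply: eq_card => -[x y]; rewrite !inE /weq /= -[RHS]subr_eq0; congr (_ == _); ring.
Qed.

Lemma weierstrass_card_changed (k : finFieldType) (u r s t : k) W W' : u != 0 ->
  changed_by u r s t W W' -> weierstrass_card W = weierstrass_card W'.
Proof.
move=> u0 ch; pose g (z : k * k) := (u ^+ 2 * z.1 + r, u ^+ 3 * z.2 + u ^+ 2 * s * z.1 + t).
pose h (z : k * k) := let x := (z.1 - r) / u ^+ 2 in (x, (z.2 - t - u ^+ 2 * s * x) / u ^+ 3).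
have gK : cancel g h by move=> [x y]; rewrite /g /h /=; congr pair; field.
have hK : cancel h g by move=> [x y]; rewrite /g /h /=; congr pair; field.
rewrite /weierstrass_card -[RHS](fintype.card_image (can_inj gK)); apply: eq_card => z.
rewrite -[z]hK fintype.mem_image; last exact: can_inj gK.
by case: (h z) => x y; rewrite !inE /= (weq_changed _ _ ch) mulf_eq0 expf_eq0 (negPf u0).
Qed.

Lemma card_fset_set_image (T : finType) (U : choiceType) (f : T -> U) (A : pred T) (B : set U) :
    injective f -> (forall y, B y <-> exists2 x, A x & y = f x) ->
  #|` fset_set B| = #|A|.
Proof.
move=> f_inj HB; have -> : B = [set` [fset f x | x in A]%fset]%classic.
  apply/seteqP; split=> y /=.
    by move=> /HB[x Ax ->]; apply/imfsetP; exists x.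
  by case/imfsetP => x /= Ax ->; apply/HB; exists x.
by rewrite set_fsetK card_imfset //= -cardE.
Qed.

(** A valuation ring with a concrete residue field. [red] is total on K, but is constrained only on
    O. Finite and infinite places are treated alike through it. *)
Record place_model (F : finFieldType) (O : set (ratfun F)) (k : finFieldType)
    (red : ratfun F -> k) : Prop := PlaceModel {
  pm_place : is_place O;
  pm_red1 : red 1 = 1;
  pm_redB : forall x y, O x -> O y -> red (x - y) = red x - red y;
  pm_redM : forall x y, O x -> O y -> red (x * y) = red x * red y;
  pm_surj : forall c, exists2 x, O x & red x = c;
  pm_max : forall x, O x -> (max_ideal O x <-> red x = 0) }.

Section PlaceModel.
Variables (F : finFieldType) (O : set (ratfun F)) (k : finFieldType) (red : ratfun F -> k).
Hypothesis pm : place_model O red.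
Local Notation K := (ratfun F).
Implicit Types (x y : K) (W : weierstrass K).

Lemma O_const (c : F) : O (tofrac c%:P).
Proof. by case: (pm_place pm). Qed.

Lemma O_B x y : O x -> O y -> O (x - y).
Proof. by case: (pm_place pm) => _ H _ _ Ox Oy; case: (H x y Ox Oy). Qed.

Lemma O_M x y : O x -> O y -> O (x * y).
Proof. by case: (pm_place pm) => _ H _ _ Ox Oy; case: (H x y Ox Oy). Qed.

Lemma O_0 : O 0.
Proof. by have := O_const 0; rewrite polyC0 tofrac0. Qed.

Lemma O_1 : O 1.
Proof. by have := O_const 1; rewrite polyC1 tofrac1. Qed.

Lemma O_N x : O x -> O (- x).
Proof. by move=> Ox; rewrite -sub0r; apply: O_B => //; apply: O_0. Qed.

Lemma O_D x y : O x -> O y -> O (x + y).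
Proof. by move=> Ox Oy; rewrite -[y]opprK; apply: O_B => //; apply: O_N. Qed.

Lemma O_X x n : O x -> O (x ^+ n).
Proof.
move=> Ox; elim: n => [|n IHn]; first by rewrite expr0; apply: O_1.
by rewrite exprS; apply: O_M.
Qed.

Lemma O_nat n : O n%:R.
Proof. by elim: n => [|n IHn]; [apply: O_0 | rewrite -addn1 natrD; apply: O_D => //; apply: O_1]. Qed.

Lemma O_total x : O x \/ O x^-1.
Proof. by case: (pm_place pm). Qed.

Lemma max_O x : max_ideal O x -> O x.
Proof. by case=> [->|nOV]; [apply: O_0 | case: (O_total x)]. Qed.

Lemma red_0 : red 0 = 0.
Proof. by rewrite -[0](subrr 1) (pm_redB pm) ?subrr //; apply: O_1. Qed.

Lemma red_N x : O x -> red (- x) = - red x.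
Proof. by move=> Ox; rewrite -sub0r (pm_redB pm) ?red_0 ?sub0r //; apply: O_0. Qed.

Lemma red_D x y : O x -> O y -> red (x + y) = red x + red y.
Proof. by move=> Ox Oy; rewrite -[y in LHS]opprK (pm_redB pm) ?red_N ?opprK //; apply: O_N. Qed.

Lemma red_X x n : O x -> red (x ^+ n) = red x ^+ n.
Proof.
move=> Ox; elim: n => [|n IHn]; first by rewrite !expr0 (pm_red1 pm).
by rewrite !exprS (pm_redM pm) ?IHn //; apply: O_X.
Qed.

Lemma red_nat n : red n%:R = n%:R.
Proof.
elim: n => [|n IHn]; first exact: red_0.
by rewrite -addn1 !natrD red_D ?IHn ?(pm_red1 pm) //; [apply: O_nat | apply: O_1].
Qed.

Lemma red_unit x : O x -> O x^-1 -> x != 0 -> red x != 0.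
Proof.
move=> Ox OV x0; apply/eqP => rx; have /eqP := pm_redM pm Ox OV.
by rewrite mulfV // rx mul0r (pm_red1 pm) oner_eq0.
Qed.

Definition fiber (c : k) : set K := [set y | O y /\ red y = c]%classic.

Lemma fiber_inj : injective fiber.
Proof.
move=> c c' e; have [x Ox rx] := pm_surj pm c.
have : fiber c x by [].
by rewrite e => -[_ <-]; rewrite rx.
Qed.

Lemma residueE x : O x -> residue O x = fiber (red x).
Proof.
move=> Ox; apply/seteqP; split=> y /=.
  move=> m; have Oyx := max_O m; have Oy : O y by rewrite -[y](subrK x); apply: O_D.
  split=> //; have /(pm_max pm Oyx) := m.
  by rewrite (pm_redB pm) // => /eqP; rewrite subr_eq0 => /eqP.
move=> [Oy ry]; apply/(pm_max pm (O_B Oy Ox)).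
by rewrite (pm_redB pm) // ry subrr.
Qed.

Lemma residue_cardE : residue_card O = #|k|.
Proof.
rewrite /residue_card (card_fset_set_image (f := fiber) (A := xpredT)) //; first exact: fiber_inj.
move=> z; split=> [[x Ox <-]|[c _ ->]]; first by exists (red x); rewrite ?residueE.
by have [x Ox <-] := pm_surj pm c; exists x; rewrite ?residueE.
Qed.

Definition red_weierstrass W : weierstrass k :=
  Weierstrass (red (a1 W)) (red (a2 W)) (red (a3 W)) (red (a4 W)) (red (a6 W)).

Ltac intO := repeat first [ assumption | apply: O_nat | apply: O_X | apply: O_1 | apply: O_N
  | apply: O_M | apply: O_B | apply: O_D ].

Ltac redE := repeat first
  [ rewrite red_nat | rewrite red_X; [|by intO]
  | rewrite (pm_redB pm); [|by intO|by intO] | rewrite red_N; [|by intO]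
  | rewrite (pm_redM pm); [|by intO|by intO] | rewrite red_D; [|by intO|by intO] ].

Lemma red_weq W x y : integral O W -> O x -> O y ->
  O (weq W x y) /\ red (weq W x y) = weq (red_weierstrass W) (red x) (red y).
Proof.
case=> i1 i2 i3 i4 i6 Ox Oy; split; rewrite /weq; first by intO.
by redE.
Qed.

Lemma integral_disc W : integral O W -> O (disc W).
Proof. by case=> i1 i2 i3 i4 i6; rewrite /disc; intO. Qed.

Lemma red_disc13 x y : O x -> O y -> red (disc13 x y) = disc13 (red x) (red y).
Proof. by move=> Ox Oy; rewrite /disc13; redE. Qed.

Lemma reduction_cardE W : integral O W ->
  reduction_card O W = (weierstrass_card (red_weierstrass W)).+1.
Proof.
move=> iW; rewrite /reduction_card; congr _.+1.
rewrite (card_fset_set_image (f := fun z : k * k => (fiber z.1, fiber z.2))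
  (A := [pred z | weq (red_weierstrass W) z.1 z.2 == 0])) //.
  by move=> [a b] [c d] [/fiber_inj -> /fiber_inj ->].
move=> z; split=> [[x [y [Ox Oy -> m]]]|[[a b] /= /eqP e ->]].
  have [Ow rw] := red_weq iW Ox Oy.
  exists (red x, red y); last by rewrite !residueE.
  by rewrite /= -rw; apply/eqP/(pm_max pm Ow).
have [x Ox rx] := pm_surj pm a; have [y Oy ry] := pm_surj pm b.
exists x, y; split=> //; first by rewrite !residueE // rx ry.
by have [Ow rw] := red_weq iW Ox Oy; apply/(pm_max pm Ow); rewrite rw rx ry.
Qed.

(** The constants 2 and 3 are units of O, so the relations for a1, a2, a3 can be solved in turn for
    s, r, t. *)
Lemma integral_change u r s t W W' :
    (2 : F) != 0 -> (3 : F) != 0 -> O u -> integral O W -> integral O W' ->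
  changed_by u r s t W W' -> [/\ O r, O s & O t].
Proof.
move=> n2 n3 Ou [i1 i2 i3 i4 i6] [j1 j2 j3 j4 j6] [e1 e2 e3 _ _].
have natK (n : nat) : (n%:R : K) = tofrac (n%:R)%:P by rewrite !rmorph_nat.
have half (n : nat) x : (n%:R : F) != 0 -> O (n%:R * x) -> O x.
  move=> n0 Onx; have -> : x = tofrac (n%:R^-1)%:P * (n%:R * x).
    by rewrite mulrA natK -tofracM -polyCM mulVf // tofrac1 mul1r.
  by apply: O_M => //; apply: O_const.
have Os : O s.
  apply: (half 2) => //; have -> : 2%:R * s = u * a1 W' - a1 W by rewrite e1; ring.
  by intO.
have Or : O r.
  apply: (half 3) => //.
  have -> : 3%:R * r = u ^+ 2 * a2 W' - a2 W + s * a1 W + s ^+ 2 by rewrite e2; ring.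
  by intO.
split=> //; apply: (half 2) => //.
have -> : 2%:R * t = u ^+ 3 * a3 W' - a3 W - r * a1 W by rewrite e3; ring.
by intO.
Qed.

Lemma red_changed u r s t W W' : O u -> O r -> O s -> O t -> integral O W -> integral O W' ->
  changed_by u r s t W W' ->
  changed_by (red u) (red r) (red s) (red t) (red_weierstrass W) (red_weierstrass W').
Proof.
move=> Ou Or Os Ot [i1 i2 i3 i4 i6] [j1 j2 j3 j4 j6] [e1 e2 e3 e4 e6].
move: e1 e2 e3 e4 e6.
do 5! (move/(congr1 red); redE => ?).
by split.
Qed.

Section MinimalModel.
Variables (A B u0 : K).
Hypotheses (two_neq0 : (2 : F) != 0) (three_neq0 : (3 : F) != 0) (u0_neq0 : u0 != 0).
Local Notation E := (Weierstrass A 0 B 0 0).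
Local Notation W0 := (Weierstrass (A / u0) 0 (B / u0 ^+ 3) 0 0).
Hypotheses (iA : O (A / u0)) (iB : O (B / u0 ^+ 3)).
Hypothesis disc_neq0 : disc W0 != 0.
(** Kraus-style criterion: a smaller integral model would divide c4 by u^4 and the discriminant by
    u^12 with u in the maximal ideal. Finite places use both conditions, infinity the
    discriminant. *)
Hypothesis minimal : forall u c D, max_ideal O u -> O c -> O D ->
  u ^+ 4 * c = c4 W0 -> u ^+ 12 * D = disc W0 -> False.

Lemma integral_W0 : integral O W0.
Proof. split; [exact: iA | exact: O_0 | exact: iB | exact: O_0 | exact: O_0]. Qed.

Lemma isomorphic_W0 W : isomorphic E W ->
  exists u r s t, u != 0 /\ changed_by u r s t W0 W.
Proof. exact (isomorphic_scaling u0_neq0). Qed.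

Lemma integral_c4 W : integral O W -> O (c4 W).
Proof. by case=> *; rewrite /c4; intO. Qed.

Lemma minimal_unit W : isomorphic E W -> integral O W ->
  exists u r s t, [/\ u != 0, O u^-1 & changed_by u r s t W0 W].
Proof.
move=> isoW iW; have [u [r [s [t [un0 ch]]]]] := isomorphic_W0 isoW.
exists u, r, s, t; split=> //; have [//|nOV] := pselect (O u^-1).
case: (@minimal u (c4 W) (disc W)) => //.
- by right.
- exact: integral_c4.
- exact: integral_disc.
- exact: c4_changed ch.
exact: disc_changed ch.
Qed.

Lemma minimal_W0 : is_minimal_model O E W0.
Proof.
split; [|exact: integral_W0|].
  exact (isomorphic_scaled A B u0_neq0).
move=> W isoW iW; have [u [r [s [t [un0 OV ch]]]]] := minimal_unit isoW iW.
rewrite (proj1 (disc_ratio un0 disc_neq0 ch)).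
exact (O_X 12 OV).
Qed.

(** [minimal_model] is an arbitrary choice, but it is joined to [W0] by a change with u a unit,
    which preserves the point count and the type of reduction. Minimality of either model excludes
    one sign of the valuation of u. *)
Lemma minimal_change : let W := minimal_model O E in
  [/\ integral O W & exists u r s t, [/\ u != 0, O u, O u^-1 & changed_by u r s t W0 W]].
Proof.
have [isoW iW minW] : is_minimal_model O E (minimal_model O E).
  by rewrite /minimal_model; apply: (xgetPex E); exists W0; apply: minimal_W0.
split=> //; have [u [r [s [t [un0 OV ch]]]]] := minimal_unit isoW iW.
exists u, r, s, t; split=> //.
have [isoW0 iW0 _] := minimal_W0.
have := minW _ isoW0 iW0; rewrite (proj2 (disc_ratio un0 disc_neq0 ch)) => Ou12.
have Ou : O u by rewrite (pow12_inv un0); exact (O_M (O_X 11 OV) Ou12).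
by [].
Qed.

Lemma red_W0 : red_weierstrass W0 = Weierstrass (red (A / u0)) 0 (red (B / u0 ^+ 3)) 0 0.
Proof. by rewrite /red_weierstrass /= red_0. Qed.

Lemma minimal_reduction_card :
  reduction_card O (minimal_model O E) = (affine_card (red (A / u0)) (red (B / u0 ^+ 3))).+1.
Proof.
have [iW [u [r [s [t [un0 Ou OV ch]]]]]] := minimal_change.
have [Or Os Ot] := integral_change two_neq0 three_neq0 Ou integral_W0 iW ch.
rewrite reduction_cardE // -weierstrass_card13 -red_W0; congr _.+1; apply/esym.
apply: weierstrass_card_changed (red_changed Ou Or Os Ot integral_W0 iW ch).
exact: red_unit.
Qed.

Lemma minimal_good_reduction :
  good_reduction O E <-> disc13 (red (A / u0)) (red (B / u0 ^+ 3)) != 0.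
Proof.
have [iW [u [r [s [t [un0 Ou OV ch]]]]]] := minimal_change.
have Od := integral_disc iW.
rewrite /good_reduction -red_disc13 // -disc_13 -(disc_changed ch).
rewrite (pm_redM pm) ?red_X //; last exact: O_X.
rewrite mulf_eq0 expf_eq0 /= (negPf (red_unit Ou OV un0)) /=.
split=> [nm|/eqP n m]; last by apply: n; apply/(pm_max pm Od).
by apply/eqP => e; apply/nm/(pm_max pm Od).
Qed.

Lemma degreeE e : #|k| = (#|F| ^ e)%N -> degree O = e.
Proof. by move=> ck; rewrite /degree residue_cardE ck trunc_expnK // finNzRing_gt1. Qed.

Lemma minimal_euler_factor (a := red (A / u0)) (b := red (B / u0 ^+ 3)) :
  map_poly intr (euler_factor O E) =
  (1 + ((affine_card a b)%:R - #|k|%:R) *: 'X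
     + (if disc13 a b == 0 then 0 else #|k|%:R) *: 'X^2) \Po 'X^(degree O) :> {poly algC}.
Proof.
rewrite /euler_factor /trace minimal_reduction_card residue_cardE -/a -/b.
rewrite !comp_polyD !comp_polyZ -polyC1 comp_polyC comp_polyX comp_Xn_poly -exprM.
rewrite rmorphD rmorphB /= map_polyC map_polyZ /= map_polyXn rmorph1.
congr (_ + _).
  rewrite -scaleNr; congr (_ + _ *: _).
  (* The point at infinity of the cubic cancels the 1 in the definition of the trace. *)
  rewrite -(addn1 (affine_card a b)) PoszD rmorphB !rmorphD rmorph1 /= -!pmulrn.
  by ring.
have [dz|dz] := eqVneq (disc13 a b) 0.
  rewrite asboolF ?rmorph0 ?scale0r // => /minimal_good_reduction.
  by rewrite -/a -/b dz eqxx.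
rewrite asboolT; last exact/minimal_good_reduction.
by rewrite map_polyZ /= map_polyXn mulnC.
Qed.

End MinimalModel.
End PlaceModel.

(** * Places of the rational function field *)

Section LocalRing.
Variables (F : finFieldType) (K : fieldType) (psi : {rmorphism {poly F} -> K}).
Hypothesis psi_inj : injective psi.
Hypothesis psi_frac : forall x, exists a b, b != 0 /\ x = psi a / psi b.
Implicit Types (a b f g pi : {poly F}) (x y : K).

Lemma psi_eq0 f : (psi f == 0) = (f == 0).
Proof. by rewrite -(rmorph0 psi) (inj_eq psi_inj). Qed.

Lemma psi_coprime_frac x : exists a b, [/\ b != 0, coprimep a b & x = psi a / psi b].
Proof.
have [a [b [b0 ->]]] := psi_frac x.
pose g := gcdp a b; have g0 : g != 0 by rewrite gcdp_eq0 (negPf b0) andbF.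
have Da : a = a %/ g * g by rewrite divpK // dvdp_gcdl.
have Db : b = b %/ g * g by rewrite divpK // dvdp_gcdr.
have b'0 : b %/ g != 0 by apply: contraNneq b0 => e; rewrite Db e mul0r.
exists (a %/ g), (b %/ g); split=> //; first by rewrite coprimep_div_gcd // b0 orbT.
by rewrite {1}Da {1}Db !rmorphM /= -mulf_div mulfV ?mulr1 // psi_eq0.
Qed.

(** The localization at pi of the image of [psi]. The embedding is a parameter because it is used
    once for t and once for 1/t. *)
Definition place_at pi : set K :=
  [set x | exists a b, ~~ (pi %| b) /\ x = psi a / psi b]%classic.

Lemma ndvd_neq0 pi b : ~~ (pi %| b) -> b != 0.
Proof. by apply: contraNneq => ->; rewrite dvdp0. Qed.

Lemma prime_ndvdM pi a b : prime_poly pi -> ~~ (pi %| a) -> ~~ (pi %| b) -> ~~ (pi %| a * b).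
Proof.
by move=> ppi na nb; rewrite Gauss_dvdpr // prime_coprime.
Qed.

Lemma prime_ndvd1 pi : prime_poly pi -> ~~ (pi %| 1).
Proof. by move=> ppi; rewrite dvdp1 size_prime // eqSS -lt0n deg_prime_gt0. Qed.

Lemma place_at_psi pi f : prime_poly pi -> place_at pi (psi f).
Proof. by move=> ppi; exists f, 1; rewrite prime_ndvd1 // rmorph1 divr1. Qed.

Lemma place_at_inv pi f : ~~ (pi %| f) -> place_at pi (psi f)^-1.
Proof. by move=> nf; exists 1, f; rewrite rmorph1 div1r. Qed.

Lemma place_at_ninv pi f : prime_poly pi -> f != 0 -> pi %| f -> ~ place_at pi (psi f)^-1.
Proof.
move=> ppi f0 pf [a [b [nb e]]]; have b0 := ndvd_neq0 nb.
case/negP: nb; suff -> : b = f * a by rewrite dvdp_mulr.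
apply: psi_inj; rewrite rmorphM; apply: (mulfI (invr_neq0 (_ : psi f != 0))).
  by rewrite psi_eq0.
by rewrite mulKf ?psi_eq0 // e mulfVK // psi_eq0.
Qed.

Lemma place_atB pi x y : prime_poly pi -> place_at pi x -> place_at pi y -> place_at pi (x - y).
Proof.
move=> ppi [a [b [nb ->]]] [c [e [ne ->]]]; exists (a * e - c * b), (b * e).
split; first exact: prime_ndvdM.
by rewrite -mulNr addf_div ?psi_eq0 ?ndvd_neq0 ?(ndvd_neq0 nb) ?(ndvd_neq0 ne) // rmorphB !rmorphM mulNr.
Qed.

Lemma place_atM pi x y : prime_poly pi -> place_at pi x -> place_at pi y -> place_at pi (x * y).
Proof.
move=> ppi [a [b [nb ->]]] [c [e [ne ->]]]; exists (a * c), (b * e).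
by split; [exact: prime_ndvdM | rewrite mulf_div !rmorphM].
Qed.

Lemma place_at_total pi x : prime_poly pi -> place_at pi x \/ place_at pi x^-1.
Proof.
move=> ppi; have [a [b [b0 cab ->]]] := psi_coprime_frac x.
have [pb|nb] := boolP (pi %| b); last by left; exists a, b.
right; exists b, a; rewrite invf_div; split=> //; apply/negP => pa.
have : pi %| gcdp a b by rewrite dvdp_gcd pa.
rewrite (eqp_dvdr _ (_ : gcdp a b %= 1)) ?(negPf (prime_ndvd1 ppi)) //.
by rewrite -size_poly_eq1.
Qed.

(** O is proper and contains the polynomials, so some polynomial, hence some prime pi, is not
    invertible in O. Polynomials prime to pi are invertible, and an element of O with pi in its
    reduced denominator would make pi invertible. *)
Lemma place_at_classify (O : set K) (x0 : K) :
    (forall c : F, O (psi c%:P)) -> (forall x y, O x -> O y -> O (x - y) /\ O (x * y)) ->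
    (forall x, O x \/ O x^-1) -> ~ O x0 -> O (psi 'X) ->
  exists2 pi, prime_poly pi & O = place_at pi.
Proof.
move=> Oc Oop Ot nOx0 OX.
have OM x y : O x -> O y -> O (x * y) by move=> Ox Oy; case: (Oop x y Ox Oy).
have O0 : O 0 by have := Oc 0; rewrite polyC0 rmorph0.
have ON x : O x -> O (- x) by move=> Ox; rewrite -sub0r; case: (Oop 0 x O0 Ox).
have OD x y : O x -> O y -> O (x + y).
  by move=> Ox Oy; rewrite -[y]opprK; case: (Oop x (- y) Ox (ON y Oy)).
have Opsi f : O (psi f).
  by elim/poly_ind: f => [|f c IHf]; rewrite ?rmorph0 // rmorphD rmorphM; apply/OD/Oc/OM.
have [f [f0 nf]] : exists f, f != 0 /\ ~ O (psi f)^-1.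
  have [a [b [b0 e]]] := psi_frac x0; exists b; split=> // Ob.
  by apply: nOx0; rewrite e; apply: OM.
have [pi ppi npi] : exists2 pi, prime_poly pi & ~ O (psi pi)^-1.
  have [n] := ubnP (size f); elim: n f f0 nf => // n IHn f f0 nf ltn.
  have szf : (1 < size f)%N.
    rewrite ltnNge; apply/negP => /size1_polyC Df; apply: nf.
    have c0 : f`_0 != 0 by move: f0; rewrite {1}Df polyC_eq0.
    suff -> : (psi f)^-1 = psi (f`_0)^-1%:P by apply: Oc.
    apply: (mulfI (_ : psi f != 0)); first by rewrite psi_eq0.
    by rewrite mulfV ?psi_eq0 // -rmorphM /= {1}Df -polyCM mulfV // rmorph1.
  have [pi ppi /dvdpP[g Df]] := exists_prime_factor szf.
  have [Opi|] := pselect (O (psi pi)^-1); last by exists pi.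
  have g0 : g != 0 by apply: contraNneq f0 => g0; rewrite Df g0 mul0r.
  apply: (IHn g g0).
    by move=> Og; apply: nf; rewrite Df rmorphM invfM; apply: OM.
  move: ltn; rewrite Df size_mul // ?monic_neq0 //; last by case/prime_polyP: ppi.
  rewrite (size_prime ppi) addnS /= ltnS; apply: leq_trans.
  by rewrite -addn1 leq_add2l deg_prime_gt0.
exists pi => //.
(* From u pi + v b = 1: if pi/b is in O, then 1/b = u pi/b + v is; if b/pi is in O, then so is 1/pi
   = u + v b/pi, which is excluded. *)
have Oinv b : ~~ (pi %| b) -> O (psi b)^-1.
  move=> nb; have := prime_coprime ppi nb => /Bezout_eq1_coprimepP[[u v] /= uv].
  have b0 : psi b != 0 by rewrite psi_eq0 (ndvd_neq0 nb).
  have pi0 : psi pi != 0 by rewrite psi_eq0 monic_neq0 //; case/prime_polyP: ppi.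
  have E : psi u * psi pi + psi v * psi b = 1 by rewrite -!rmorphM -rmorphD uv rmorph1.
  case: (Ot (psi pi / psi b)) => [Oz|]; last rewrite invf_div => Oz.
    have -> : (psi b)^-1 = psi u * (psi pi / psi b) + psi v.
      by rewrite mulrA -[psi v](mulfK b0) -mulrDl E mul1r.
    by apply: OD => //; apply: OM.
  case: npi; have -> : (psi pi)^-1 = psi u + psi v * (psi b / psi pi).
    by rewrite mulrA -[X in X + _](mulfK pi0) -mulrDl E mul1r.
  by apply: OD => //; apply: OM.
apply/seteqP; split=> x; last by case=> [a [b [nb ->]]]; apply: OM => //; apply: Oinv.
move=> Ox; have [a [b [b0 cab Dx]]] := psi_coprime_frac x.
exists a, b; split=> //; apply/negP => pb; case: npi.
have na : ~~ (pi %| a).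
  apply/negP => pa; have : pi %| gcdp a b by rewrite dvdp_gcd pa.
  rewrite (eqp_dvdr _ (_ : gcdp a b %= 1)) ?(negPf (prime_ndvd1 ppi)) //.
  by rewrite -size_poly_eq1.
have a0 : psi a != 0 by rewrite psi_eq0 (ndvd_neq0 na).
case/dvdpP: pb => c Db.
have cpi0 : psi b != 0 by rewrite psi_eq0.
suff -> : (psi pi)^-1 = x * psi c * (psi a)^-1 by apply: (OM _ _ _ (Oinv _ na)); exact: (OM _ _ Ox (Opsi c)).
move: cpi0; rewrite Dx Db rmorphM mulf_eq0 negb_or => /andP[c0 pi0].
by field; rewrite a0 c0 pi0.
Qed.

Lemma place_at_inj pi rho : prime_poly pi -> prime_poly rho -> place_at pi = place_at rho -> pi = rho.
Proof.
move=> ppi prho e; have rho0 : rho != 0 by rewrite monic_neq0 //; case/prime_polyP: prho.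
have [pr|nr] := boolP (pi %| rho); first exact: prime_dvd_eq.
have : place_at pi (psi rho)^-1 by apply: place_at_inv.
by rewrite e => /(place_at_ninv prho rho0 (dvdpp _)).
Qed.

Section Reduction.
Variables (k : finFieldType) (phi : {rmorphism {poly F} -> k}) (pi : {poly F}).
Hypothesis ppi : prime_poly pi.
Hypothesis phi_surj : forall c, exists f, phi f = c.
Hypothesis phi_eq0 : forall f, (phi f == 0) = (pi %| f).

(** Total on K: outside the local ring the default pair (0, 1) gives the value 0. *)
Definition place_red (x : K) : k :=
  let z := xget (0, 1) [set z : {poly F} * {poly F} | ~~ (pi %| z.2) /\ x = psi z.1 / psi z.2]%classic in
  phi z.1 / phi z.2.

Lemma place_redE a b : ~~ (pi %| b) -> place_red (psi a / psi b) = phi a / phi b.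
Proof.
move=> nb; rewrite /place_red; set S := (X in xget _ X).
have [|nz] := @xgetPex _ (0, 1) S; first by exists (a, b).
move: (xget _ _) nz => [c e] /= ne E.
have b0 := ndvd_neq0 nb; have e0 := ndvd_neq0 ne.
have : a * e = c * b.
  apply: psi_inj; rewrite !rmorphM; apply/eqP.
  by rewrite -eqr_div ?psi_eq0 // E.
move/(congr1 phi); rewrite !rmorphM => E'; apply/eqP.
by rewrite eqr_div ?phi_eq0 // E'.
Qed.

Lemma place_red_psi f : place_red (psi f) = phi f.
Proof.
have n1 := prime_ndvd1 ppi.
by rewrite -[psi f]divr1 -(rmorph1 psi) place_redE // rmorph1 divr1.
Qed.

Lemma place_redB x y : place_at pi x -> place_at pi y -> place_red (x - y) = place_red x - place_red y.
Proof.
move=> [a [b [nb ->]]] [c [e [ne ->]]].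
have b0 := ndvd_neq0 nb; have e0 := ndvd_neq0 ne.
have -> : psi a / psi b - psi c / psi e = psi (a * e - c * b) / psi (b * e).
  by rewrite -mulNr addf_div ?psi_eq0 // rmorphB !rmorphM mulNr.
rewrite !place_redE //; last exact: prime_ndvdM.
by rewrite -[in RHS]mulNr addf_div ?phi_eq0 // rmorphB !rmorphM mulNr.
Qed.

Lemma place_redM x y : place_at pi x -> place_at pi y -> place_red (x * y) = place_red x * place_red y.
Proof.
move=> [a [b [nb ->]]] [c [e [ne ->]]].
rewrite mulf_div -!rmorphM !place_redE //; last exact: prime_ndvdM.
by rewrite mulf_div !rmorphM.
Qed.

Lemma place_red_max x : place_at pi x -> (x = 0 \/ ~ place_at pi x^-1) <-> place_red x = 0.
Proof.
move=> [a [b [nb ->]]]; rewrite place_redE //.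
have b0 : psi b != 0 by rewrite psi_eq0 (ndvd_neq0 nb).
have pb0 : phi b != 0 by rewrite phi_eq0.
split.
  move=> H; apply/eqP; rewrite mulf_eq0 invr_eq0 (negPf pb0) orbF phi_eq0.
  apply/negPn/negP => na; case: H => [/eqP|].
    by rewrite mulf_eq0 invr_eq0 (negPf b0) orbF psi_eq0 (negPf (ndvd_neq0 na)).
  by apply; rewrite invf_div; exists b, a.
move/eqP; rewrite mulf_eq0 invr_eq0 (negPf pb0) orbF phi_eq0 => pa.
have [->|a0] := eqVneq a 0; first by left; rewrite rmorph0 mul0r.
right => H; apply: (place_at_ninv ppi a0 pa).
rewrite -[(psi a)^-1]mulr1 -(mulVf b0) mulrA [_ / psi b]mulrC -invfM mulrC.
have -> : psi b * (psi b * psi a)^-1 = (psi a / psi b)^-1 / psi b.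
  have pa0 : psi a != 0 by rewrite psi_eq0.
  by field; rewrite b0 pa0.
by apply: place_atM => //; apply: place_at_inv.
Qed.

End Reduction.
End LocalRing.

Lemma frac_numden (R : idomainType) (x : {fraction R}) :
  exists a b : R, b != 0 /\ x = tofrac a / tofrac b.
Proof.
pose r := repr x; exists (\n_r), (\d_r); split; first exact: denom_ratioP.
have d0 : tofrac (\d_r) != 0 by rewrite tofrac_eq0 denom_ratioP.
apply: (mulIf d0); rewrite mulfVK // -[x in LHS]reprK -/r.
unlock tofrac; rewrite -[LHS]FracField.pi_mul; apply/eqmodP.
rewrite /= FracField.equivfE /FracField.mulf.
by rewrite !numden_Ratio ?mulf_neq0 ?oner_neq0 ?denom_ratioP // !mulr1 mulrC.
Qed.

(** * The place at infinity *)

Section Infinity.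
Variables (F : finFieldType) (K : fieldType) (tau : {rmorphism {poly F} -> K}).
Hypothesis tau_inj : injective tau.
Hypothesis tau_frac : forall x, exists a b, b != 0 /\ x = tau a / tau b.

(* Substitution of 1/X: the place at infinity is the place at X along this map. *)
Definition psi_inf : {poly F} -> K := horner_eval (tau 'X)^-1 \o map_poly (tau \o polyC).
HB.instance Definition _ := GRing.RMorphism.on psi_inf.

Lemma tauX_neq0 : tau 'X != 0.
Proof. by rewrite -(rmorph0 tau) (inj_eq tau_inj) polyX_eq0. Qed.

Lemma psi_infC c : psi_inf c%:P = tau c%:P.
Proof. by rewrite /psi_inf /= map_polyC /horner_eval hornerC. Qed.

Lemma psi_infX : psi_inf 'X = (tau 'X)^-1.
Proof. by rewrite /psi_inf /= map_polyX /horner_eval hornerX. Qed.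

(** This is X^n f(1/X). A bound n on the degree, instead of the degree itself, keeps it an
    involution when X divides f. *)
Definition rev_poly n (f : {poly F}) := \poly_(i < n.+1) f`_(n - i).

Lemma rev_polyK n (f : {poly F}) : (size f <= n.+1)%N -> rev_poly n (rev_poly n f) = f.
Proof.
move=> szf; apply/polyP => i; rewrite !coef_poly; case: ltnP => [i_n|n_i].
  by rewrite ltnS leq_subr subKn.
by rewrite nth_default // (leq_trans szf).
Qed.

Lemma psi_inf_rev n (f : {poly F}) : (size f <= n.+1)%N -> tau 'X ^+ n * psi_inf f = tau (rev_poly n f).
Proof.
move=> szf; have sz' : (size (map_poly (tau \o polyC) f) <= n.+1)%N.
  by apply: leq_trans szf; apply: size_poly.
rewrite /psi_inf /= /horner_eval (horner_coef_wide _ sz') mulr_sumr.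
rewrite /rev_poly poly_def rmorph_sum /= (reindex_inj rev_ord_inj) /=.
apply: eq_bigr => i _; have i_n : (i <= n)%N by rewrite -ltnS.
rewrite subSS -mul_polyC rmorphM rmorphXn /=.
rewrite coef_map_id0 /=; last by rewrite rmorph0.
rewrite mulrCA; congr (_ * _).
by rewrite -{1}(subnKC i_n) exprD exprVn mulfK // expf_neq0 // tauX_neq0.
Qed.

Lemma psi_inf_inj : injective psi_inf.
Proof.
move=> f g e; apply/eqP; rewrite -subr_eq0; apply/eqP.
set h := f - g; have h0 : psi_inf h = 0 by rewrite rmorphB /= e subrr.
have szh : (size h <= (size h).+1)%N by [].
rewrite -(rev_polyK szh); suff -> : rev_poly (size h) h = 0.
  by apply/polyP => i; rewrite coef_poly !coef0; case: ifP.
by apply: tau_inj; rewrite -psi_inf_rev // h0 mulr0 rmorph0.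
Qed.

Lemma psi_inf_frac x : exists a b, b != 0 /\ x = psi_inf a / psi_inf b.
Proof.
have [a [b [b0 ->]]] := tau_frac x.
pose n := maxn (size a) (size b).
have sza : (size a <= n.+1)%N by rewrite leqW // leq_maxl.
have szb : (size b <= n.+1)%N by rewrite leqW // leq_maxr.
have sz_rev (f : {poly F}) : (size (rev_poly n f) <= n.+1)%N by apply: size_poly.
exists (rev_poly n a), (rev_poly n b); split.
  by apply: contraNneq b0 => e; rewrite -(rev_polyK szb) e; apply/eqP/polyP => i; rewrite coef_poly !coef0; case: ifP.
rewrite -{1}(rev_polyK sza) -{1}(rev_polyK szb) -!psi_inf_rev //.
by rewrite -mulf_div mulfV ?mul1r // expf_neq0 // tauX_neq0.
Qed.

End Infinity.

Section Places.
Variable F : finFieldType.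
Local Notation K := (ratfun F).
Local Notation tau := (@tofrac {poly F} : {rmorphism {poly F} -> K}).
Local Notation psi_oo := (psi_inf tau).

Lemma tofrac_inj : injective tau.
Proof. by move=> f g /eqP; rewrite tofrac_eq => /eqP. Qed.

Definition finite_place (pi : {poly F}) : set K := place_at tau pi.
Definition infinite_place : set K := place_at psi_oo 'X.

Lemma psi_ooXV : (psi_oo 'X)^-1 = tofrac 'X.
Proof. by apply: invr_inj; rewrite invrK; apply: psi_infX. Qed.

Lemma prime_X : prime_poly ('X : {poly F}).
Proof.
apply/prime_polyP; split; first exact: monicX.
by have := irredp_XsubC (0 : F); rewrite subr0.
Qed.

Lemma place_model_at (psi : {rmorphism {poly F} -> K}) (k : finFieldType)
    (phi : {rmorphism {poly F} -> k}) pi :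
    injective psi -> (forall x, exists a b, b != 0 /\ x = psi a / psi b) ->
    (forall c, psi c%:P = tofrac c%:P) -> prime_poly pi ->
    (forall c, exists f, phi f = c) -> (forall f, (phi f == 0) = (pi %| f)) ->
  place_model (place_at psi pi) (place_red psi phi pi).
Proof.
move=> psi_inj psi_frac psiC ppi surj ker.
have pi0 : pi != 0 by rewrite monic_neq0 //; case/prime_polyP: ppi.
split.
- split.
  + by move=> c; rewrite -psiC; apply: place_at_psi.
  + by move=> x y Ox Oy; split; [apply: place_atB | apply: place_atM].
  + by move=> x; apply: place_at_total.
  by exists (psi pi)^-1; apply: place_at_ninv.
- by rewrite -(rmorph1 psi) place_red_psi // rmorph1.
- by move=> x y; apply: place_redB.
- by move=> x y; apply: place_redM.
- by move=> c; have [f <-] := surj c; exists (psi f); [apply: place_at_psi | apply: place_red_psi].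
by move=> x; apply: place_red_max.
Qed.

(** If t is not in O, then 1/t is, and the classification applies along 1/t. The prime found there
    is X, for otherwise t, the inverse of the image of X, would lie in O. *)
Lemma is_place_classify O : is_place O ->
  O = infinite_place \/ exists2 pi, prime_poly pi & O = finite_place pi.
Proof.
case=> Oc Oop Ot [x0 nOx0].
have [OX|nOX] := pselect (O (tofrac 'X)).
  by right; apply: (place_at_classify tofrac_inj (@frac_numden _) Oc Oop Ot nOx0 OX).
left; have OXV : O (psi_oo 'X) by rewrite psi_infX; case: (Ot (tofrac 'X)).
have Oc' c : O (psi_oo c%:P) by rewrite psi_infC; apply: Oc.
have [pi ppi DO] := place_at_classify (psi_inf_inj tofrac_inj)
  (psi_inf_frac tofrac_inj (@frac_numden _)) Oc' Oop Ot nOx0 OXV.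
suff piX : pi = 'X by rewrite DO piX.
have [pX|nX] := boolP (pi %| 'X); first exact: prime_dvd_eq ppi prime_X pX.
case: nOX; rewrite DO -psi_ooXV.
exact (place_at_inv psi_oo nX).
Qed.

Lemma infinite_place_neq pi : prime_poly pi -> infinite_place <> finite_place pi.
Proof.
move=> ppi e; have : finite_place pi (tofrac 'X) by apply: place_at_psi.
rewrite -e -psi_ooXV.
by apply: (place_at_ninv (psi_inf_inj tofrac_inj) prime_X); rewrite ?polyX_eq0.
Qed.

End Places.

Arguments infinite_place F : clear implicits.

(** * Euler factors and the L-function *)

Definition fiber_poly (k : finFieldType) (a b : k) : {poly algC} :=
  1 + ((affine_card a b)%:R - #|k|%:R) *: 'X + (if disc13 a b == 0 then 0 else #|k|%:R) *: 'X^2.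

Section EulerFactors.
Variables (F : finFieldType) (d : nat).
Hypotheses (two_neq0 : (2 : F) != 0) (three_neq0 : (3 : F) != 0) (d_gt0 : (0 < d)%N).
Local Notation K := (ratfun F).
Local Notation tau := (@tofrac {poly F} : {rmorphism {poly F} -> K}).
Local Notation psi_oo := (psi_inf tau).

Section Finite.
Variables (pi : {poly F}) (k : finFieldType) (phi : {rmorphism {poly F} -> k}).
Hypothesis ppi : prime_poly pi.
Hypothesis cardk : #|k| = (#|F| ^ deg pi)%N.
Hypothesis phi_surj : forall c, exists f, phi f = c.
Hypothesis phi_eq0 : forall f, (phi f == 0) = (pi %| f).
Local Notation red := (place_red tau phi pi).

Lemma finite_place_model : place_model (finite_place pi) red.
Proof.
have tauC (c : F) : tau c%:P = tofrac c%:P by [].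
exact (place_model_at (@tofrac_inj F) (@frac_numden {poly F}) tauC ppi phi_surj phi_eq0).
Qed.

Lemma finite_degree : degree (finite_place pi) = deg pi.
Proof. exact (degreeE finite_place_model cardk). Qed.

Lemma nat_residue_neq0 m : (m%:R : F) != 0 -> (m%:R : k) != 0.
Proof. by rewrite -(rmorph_nat (const_map phi)) fmorph_eq0. Qed.

Lemma poly_1_27_neq0 : (1 + 27 * 'X^d : {poly F}) != 0.
Proof.
apply/negP => /eqP/(congr1 (fun f : {poly F} => f.[0])).
rewrite hornerD hornerM hornerXn expr0n gtn_eqF // mulr0 addr0 -polyC1 hornerC horner0 => /eqP.
by rewrite oner_eq0.
Qed.

Lemma disc_finite_neq0 : disc13 (1 : K) (- tofrac 'X^d) != 0.
Proof.
have -> : disc13 (1 : K) (- tofrac 'X^d) = - (tofrac ('X^d) ^+ 3 * tofrac (1 + 27 * 'X^d)).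
  rewrite /disc13 (rmorphD tau) (rmorphM tau) (rmorph_nat tau) rmorph1 /=; ring.
rewrite oppr_eq0 mulf_neq0 ?expf_neq0 //; rewrite tofrac_eq0; first by rewrite -size_poly_eq0 size_polyXn.
exact: poly_1_27_neq0.
Qed.

(** The equation is already minimal, with u0 = 1: for b = -t^d, c4 = 1 - 24 b and the discriminant
    b^3 (1 - 27 b) have no common zero modulo pi, as 3 is invertible. *)
Lemma finite_euler_factor :
  map_poly intr (euler_factor (finite_place pi) (curveE F d)) =
  fiber_poly 1 (- phi 'X ^+ d) \Po 'X^(deg pi).
Proof.
have pm := finite_place_model.
have O1 : finite_place pi 1 by apply: (O_1 pm).
have OX : finite_place pi (- tofrac ('X^d)).
  by apply: (O_N pm); apply: place_at_psi.
have rX : red (- tofrac ('X^d)) = - phi 'X ^+ d.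
  rewrite (red_N pm); last exact: place_at_psi.
  rewrite -rmorphXn; congr (- _).
  exact (place_red_psi (@tofrac_inj F) ppi phi_eq0 _).
have three_k := nat_residue_neq0 three_neq0.
rewrite -finite_degree /curveE /fiber_poly.
have := @minimal_euler_factor F (finite_place pi) k red pm 1 (- tofrac 'X^d) 1 two_neq0 three_neq0 (oner_neq0 _).
rewrite expr1n !divr1 (pm_red1 pm) rX; apply=> //.
  by rewrite disc_13 disc_finite_neq0.
move=> u c D um Oc OD Ec ED.
have Ou := max_O pm um; have ru : red u = 0 by apply/(pm_max pm Ou).
have rc4 : 1 - 24 * (- phi 'X ^+ d) = 0.
  have <- : red (c4 (Weierstrass 1 0 (- tofrac 'X^d) 0 0)) = 1 - 24 * (- phi 'X ^+ d).
    rewrite /c4 /= !mulr0 addr0 add0r mul1r expr1n expr1n.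
    rewrite (pm_redB pm) //; last by apply: (O_M pm) => //; apply: (O_nat pm).
    by rewrite (pm_redM pm) ?(red_nat pm) ?rX ?(pm_red1 pm) //; apply: (O_nat pm).
  by rewrite -Ec (pm_redM pm) ?(red_X pm) ?ru ?expr0n ?mul0r //; apply: (O_X pm).
have rdisc : disc13 1 (- phi 'X ^+ d) = 0.
  rewrite -(pm_red1 pm) -rX -(red_disc13 pm) // -disc_13 -ED.
  by rewrite (pm_redM pm) ?(red_X pm) ?ru ?expr0n ?mul0r //; apply: (O_X pm).
move: rc4 rdisc; move: (- phi 'X ^+ d) => b rc4 /eqP.
rewrite /disc13 expr1n mulf_eq0 expf_eq0 /= => /orP[/eqP b0|/eqP e].
  by move/eqP: rc4; rewrite b0 mulr0 subr0 oner_eq0.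
have /eqP : 3 * b = 0.
  have -> : 3 * b = (1 - 24 * b) - (1 - 27 * b) by ring.
  by rewrite rc4 e subrr.
rewrite mulf_eq0 (negPf three_k) /= => /eqP b0.
by move/eqP: rc4; rewrite b0 mulr0 subr0 oner_eq0.
Qed.

End Finite.

Section Infinite.

Definition eval0 : {poly F} -> F := horner_eval 0.
HB.instance Definition _ := GRing.RMorphism.on eval0.

Lemma eval0_surj c : exists f, eval0 f = c.
Proof. by exists c%:P; rewrite /eval0 /horner_eval hornerC. Qed.

Lemma eval0E f : eval0 f = f.[0].
Proof. by []. Qed.

Lemma eval0_eq0 f : (eval0 f == 0) = ('X %| f).
Proof. by have := dvdp_XsubCl f 0; rewrite polyC0 subr0 => ->. Qed.

Local Notation red := (place_red psi_oo eval0 'X).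

Lemma infinite_place_model : place_model (infinite_place F) red.
Proof.
have psiC (c : F) : psi_oo c%:P = tofrac c%:P by apply: psi_infC.
exact (place_model_at (psi_inf_inj (@tofrac_inj F)) (psi_inf_frac (@tofrac_inj F) (@frac_numden {poly F}))
   psiC (prime_X F) eval0_surj eval0_eq0).
Qed.

Lemma infinite_degree : degree (infinite_place F) = 1%N.
Proof. by apply: (degreeE infinite_place_model); rewrite expn1. Qed.

Local Notation e := ((d + 2) %/ 3)%N.
Local Notation r := (3 * e - d)%N.
Local Notation s := (psi_oo 'X).

(** Here e is d/3 rounded up, the least exponent for which scaling by u0 = t^e makes a3 integral at
    infinity; with s = 1/t the scaled coefficients are a1 = s^e and a3 = -s^r. *)
Lemma exponent_facts : [/\ (0 < e)%N, (3 * e = d + r)%N, (r <= 2)%N & (r == 0%N) = (3 %| d)%N].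
Proof.
have H1 : (d <= 3 * e)%N by have := divn_eq (d + 2) 3; have := ltn_pmod (d + 2) (isT : 0 < 3)%N; lia.
have H2 : (3 * e <= d + 2)%N by have := divn_eq (d + 2) 3; lia.
by split; lia.
Qed.

Lemma sE : s = (tofrac 'X)^-1.
Proof. exact: psi_infX. Qed.

Lemma s_neq0 : s != 0.
Proof. by rewrite sE invr_eq0 tofrac_eq0 polyX_eq0. Qed.

Let u0 : K := tofrac 'X ^+ e.

Lemma u0_neq0 : u0 != 0.
Proof. by rewrite expf_neq0 // tofrac_eq0 polyX_eq0. Qed.

Lemma infinite_a1 : 1 / u0 = psi_oo ('X ^+ e).
Proof. by rewrite div1r rmorphXn /= sE exprVn. Qed.

Lemma infinite_a3 : (- tofrac 'X^d) / u0 ^+ 3 = psi_oo (- 'X ^+ r).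
Proof.
have [_ E _ _] := exponent_facts.
rewrite rmorphN !rmorphXn /= sE exprVn mulNr -exprM mulnC E exprD invfM mulrA mulfV ?mul1r ?addKn //.
by rewrite expf_neq0 // tofrac_eq0 polyX_eq0.
Qed.

Lemma infinite_disc : disc13 (psi_oo ('X ^+ e)) (psi_oo (- 'X ^+ r)) =
  - (s ^+ (4 * r) * psi_oo (27 + 'X^d)).
Proof.
have [_ E _ _] := exponent_facts.
have E3 : s ^+ (e * 3) = s ^+ d * s ^+ r by rewrite -exprD -E mulnC.
rewrite /disc13 rmorphN !rmorphXn rmorphD rmorphXn rmorph_nat /= -exprM E3 [(4 * r)%N]mulnC exprM.
by ring.
Qed.

Lemma infinite_max u : infinite_place F u -> red u = 0 -> exists2 w, infinite_place F w & u = s * w.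
Proof.
move=> [a [b [nb Du]]] ru; have := ru; rewrite Du.
rewrite (place_redE (psi_inf_inj (@tofrac_inj F)) eval0_eq0) // => /eqP.
have eb0 : eval0 b != 0 by rewrite eval0_eq0.
rewrite mulf_eq0 invr_eq0 (negPf eb0) orbF eval0_eq0 => /dvdpP[c Da].
exists (psi_oo c / psi_oo b); first by exists c, b.
by rewrite Da rmorphM /= mulrA [s * _]mulrC.
Qed.

Lemma poly27 : (27 : {poly F}) = 27%:P.
Proof. by rewrite rmorph_nat. Qed.

Lemma twentyseven_neq0 : (27 : F) != 0.
Proof. by have -> : (27 : F) = 3 ^+ 3; [ring | rewrite expf_neq0]. Qed.

(** The discriminant -s^(4r) (27 + s^d) has valuation 4r, at most 8 and so below 12: after
    cancelling s^(4r), reduction would give 27 = 0. *)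
Lemma infinite_minimal u c D : max_ideal (infinite_place F) u -> infinite_place F c -> infinite_place F D ->
  u ^+ 12 * D = disc13 (psi_oo ('X ^+ e)) (psi_oo (- 'X ^+ r)) -> False.
Proof.
have pm := infinite_place_model; have [_ _ r2 _] := exponent_facts.
move=> um _ OD; have Ou := max_O pm um; have ru : red u = 0 by apply/(pm_max pm Ou).
have [w Ow ->] := infinite_max Ou ru; rewrite infinite_disc exprMn.
have -> : (s ^+ 12 = s ^+ (4 * r) * s ^+ (12 - 4 * r))%R by rewrite -exprD subnKC //; lia.
rewrite -mulrN -[_ * D]mulrA -[LHS]mulrA => /(mulfI (expf_neq0 (4 * r) s_neq0)) E.
have Os : infinite_place F s by apply: place_at_psi; apply: prime_X.
have rs : red s = 0.
  rewrite (place_red_psi (psi_inf_inj (@tofrac_inj F)) (prime_X F) eval0_eq0).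
  by apply: etrans (eval0E _) _; rewrite hornerX.
have OwD : infinite_place F (w ^+ 12 * D) by apply: (O_M pm) => //; apply: (O_X pm).
have OsX : infinite_place F (s ^+ (12 - 4 * r)) by apply: (O_X pm).
have := congr1 red E; rewrite (pm_redM pm OsX OwD) (red_X pm) // rs expr0n subn_eq0 leqNgt.
have -> : (4 * r < 12)%N by lia.
rewrite mul0r (red_N pm); last by apply: place_at_psi; apply: prime_X.
rewrite (place_red_psi (psi_inf_inj (@tofrac_inj F)) (prime_X F) eval0_eq0) => /esym/eqP.
rewrite oppr_eq0 => /eqP H27; have := etrans (esym (eval0E _)) H27.
rewrite hornerD hornerXn expr0n gtn_eqF // addr0 => /eqP.
by rewrite poly27 hornerC (negPf twentyseven_neq0).
Qed.

Lemma infinite_euler_factor :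
  map_poly intr (euler_factor (infinite_place F) (curveE F d)) =
  fiber_poly 0 (if (3 %| d)%N then - 1 else 0 : F) \Po 'X^1.
Proof.
have pm := infinite_place_model; have [e0 E r2 r0] := exponent_facts.
rewrite -[X in _ = _ \Po 'X^X]infinite_degree /curveE /fiber_poly.
have iA : infinite_place F (1 / u0) by rewrite infinite_a1; apply: place_at_psi; apply: prime_X.
have iB : infinite_place F (- tofrac 'X^d / u0 ^+ 3) by rewrite infinite_a3; apply: place_at_psi; apply: prime_X.
have rA : red (1 / u0) = 0.
  rewrite infinite_a1 (place_red_psi (psi_inf_inj (@tofrac_inj F)) (prime_X F) eval0_eq0).
  by apply: etrans (eval0E _) _; rewrite hornerXn expr0n gtn_eqF.
have rB : red (- tofrac 'X^d / u0 ^+ 3) = if (3 %| d)%N then - 1 else 0.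
  rewrite infinite_a3 (place_red_psi (psi_inf_inj (@tofrac_inj F)) (prime_X F) eval0_eq0).
  apply: etrans (eval0E _) _; rewrite hornerN hornerXn expr0n r0.
  by case: ifP; rewrite ?oppr0.
have := @minimal_euler_factor F (infinite_place F) F red pm 1 (- tofrac 'X^d) u0 two_neq0 three_neq0 u0_neq0 iA iB.
rewrite rA rB; apply.
  rewrite disc_13 infinite_a1 infinite_a3 infinite_disc oppr_eq0.
  apply: mulf_neq0; first exact (expf_neq0 (4 * r) s_neq0).
  rewrite (psi_eq0 (psi_inf_inj (@tofrac_inj F))).
  apply/negP => /eqP/(congr1 (fun f : {poly F} => f.[0])).
  rewrite hornerD hornerXn expr0n gtn_eqF // addr0 poly27 hornerC horner0 => /eqP.
  by rewrite (negPf twentyseven_neq0).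
move=> u c D um Oc OD _; rewrite disc_13 infinite_a1 infinite_a3.
exact: (infinite_minimal um Oc OD).
Qed.

End Infinite.
End EulerFactors.

(** The parametrization t -> (t^2, t^3) of the cusp is bijective, so infinity contributes nothing
    when 3 does not divide d. *)
Lemma affine_card_cusp (E : finFieldType) : affine_card (0 : E) 0 = #|E|.
Proof.
pose g (t : E) := (t ^+ 2, t ^+ 3).
have g_inj : injective g.
  move=> t u [e2 e3]; have [t0|t0] := eqVneq t 0.
    by move: e2; rewrite t0 expr0n => /esym/eqP; rewrite expf_eq0 => /eqP.
  have t20 : t ^+ 2 != 0 by rewrite expf_neq0.
  by apply: (mulfI t20); rewrite -exprSr e3 e2 -exprSr.
rewrite /affine_card -[RHS](fintype.card_image g_inj); apply: eq_card => -[x y].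
rewrite !inE /= !mul0r !addr0; apply/eqP/fintype.imageP => [e|[t _ [-> ->]]]; last by rewrite -!exprM.
have [x0|x0] := eqVneq x 0.
  exists 0 => //; rewrite /g !expr0n x0 /=; congr pair.
  by move/eqP: e; rewrite x0 expr0n expf_eq0 => /eqP.
exists (y / x) => //; rewrite /g !expr_div_n; congr pair.
  by rewrite e; field.
by rewrite [y ^+ 3]exprS e; field.
Qed.

(** * The logarithmic derivative of the L-function *)

Section LFunction.
Variables (F : finFieldType) (d : nat).
Hypotheses (two_neq0 : (2 : F) != 0) (three_neq0 : (3 : F) != 0) (d_gt0 : (0 < d)%N).
Local Notation curve := (curveE F d).
Local Notation euler O := (map_poly intr (euler_factor O curve) : {poly algC}).

Definition spread (N : nat -> algC) e : nat -> algC :=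
  fun k => if (e %| k)%N then N (k %/ e)%N *+ e else 0.

(** A root beta of pi in E embeds the residue field in E with t sent to beta, so the fibre over beta
    is a base change of the fibre at pi. *)
Lemma finite_place_logder pi : prime_poly pi -> exists N : nat -> algC,
  (forall n, logder n (euler (finite_place pi)) (spread N (deg pi))) /\
  (forall (E : finFieldType) (emb : {rmorphism F -> E}) k beta, #|E| = (#|F| ^ k)%N ->
     root (map_poly emb pi) beta -> N (k %/ deg pi)%N = (affine_card 1 (- beta ^+ d))%:R - #|E|%:R).
Proof.
move=> ppi; have [K [phi [cardK surj ker]]] := exists_residue_field ppi.
have two_K := nat_residue_neq0 phi two_neq0; have three_K := nat_residue_neq0 phi three_neq0.
have [N [HN HE]] := fiber_logder 1 (- phi 'X ^+ d) two_K three_K.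
exists N; split=> [n|E emb k beta cardE rb].
  rewrite (finite_euler_factor two_neq0 three_neq0 d_gt0 ppi cardK surj ker).
  by apply: logder_comp; [apply: deg_prime_gt0 | apply: HN].
have [f Hf] := embed_residue_field surj ker rb.
have Ef : f (- phi 'X ^+ d) = - beta ^+ d.
  by rewrite rmorphN rmorphXn /= Hf map_polyX hornerX.
rewrite (HE E f) ?rmorph1 ?Ef // cardE cardK -expnM mulnC divnK //.
exact (root_prime_deg cardE ppi rb).
Qed.

Lemma infinite_place_logder : exists N : nat -> algC,
  (forall n, logder n (euler (infinite_place F)) N) /\
  (forall (E : finFieldType) (emb : {rmorphism F -> E}) k, #|E| = (#|F| ^ k)%N ->
     N k = (affine_card 0 (if (3 %| d)%N then - 1 else 0 : E))%:R - #|E|%:R).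
Proof.
have [N [HN HE]] := fiber_logder 0 (if (3 %| d)%N then - 1 else 0 : F) two_neq0 three_neq0.
exists N; split=> [n|E emb k cardE].
  by rewrite (infinite_euler_factor two_neq0 three_neq0 d_gt0) comp_polyXr; apply: HN.
rewrite (HE E emb k cardE) rmorph0; congr ((affine_card 0 _)%:R - _).
by case: ifP; rewrite ?rmorph0 // rmorphN1.
Qed.

(** The infinite place, of degree 1, is listed even for n = 0; hence the hypothesis 0 < n below and
    the separate [Lfun0]. *)
Definition places_le n : seq (set (ratfun F)) :=
  infinite_place F :: [seq finite_place pi | pi <- primes_le F n].

Lemma finite_placeP pi : prime_poly pi -> is_place (finite_place pi) /\ degree (finite_place pi) = @deg F pi.
Proof.
move=> ppi; have [K [phi [cardK surj ker]]] := exists_residue_field ppi.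
split; first exact: pm_place (finite_place_model ppi surj ker).
exact: finite_degree ppi cardK surj ker.
Qed.

Lemma places_le_uniq n : uniq (places_le n).
Proof.
rewrite /= map_inj_in_uniq ?primes_le_uniq ?andbT => [|pi rho].
  apply/negP => /mapP[pi]; rewrite mem_primes_le => /andP[ppi _].
  exact: infinite_place_neq.
rewrite !mem_primes_le => /andP[ppi _] /andP[prho _].
exact (@place_at_inj F _ (@tofrac {poly F}) (@tofrac_inj F) pi rho ppi prho).
Qed.

Lemma mem_places_le n O : (0 < n)%N ->
  (is_place O /\ (degree O <= n)%N) <-> O \in places_le n.
Proof.
move=> n0; split=> [[plO degO]|].
  have [->|[pi ppi DO]] := is_place_classify plO; first by rewrite inE eqxx.
  rewrite inE DO map_f ?orbT // mem_primes_le ppi size_prime // ltnS.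
  by have [_ <-] := finite_placeP ppi; rewrite -DO.
rewrite inE => /orP[/eqP ->|/mapP[pi]].
  by split; [exact: pm_place (infinite_place_model F) | rewrite infinite_degree].
rewrite mem_primes_le => /andP[ppi spi] ->.
have [plO ->] := finite_placeP ppi; split=> //.
by move: spi; rewrite size_prime // ltnS.
Qed.

Definition Lprod n : {poly algC} := \prod_(O <- places_le n) map_poly intr (trunc_inv n (euler_factor O curve)).

Lemma Lfun_Lprod n : (0 < n)%N -> (Lfun curve n)%:~R = (Lprod n)`_n.
Proof.
move=> n0; rewrite /Lfun /Lprod.
have -> : [set O | is_place O /\ (degree O <= n)%N]%classic = [set` places_le n]%classic :> set (set (ratfun F)).
  by apply/seteqP; split=> O /= /(mem_places_le O n0).
by rewrite -fsbig_seq ?places_le_uniq // -rmorph_prod coef_map.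
Qed.

Lemma degree_gt0 (O : set (ratfun F)) : is_place O -> (0 < degree O)%N.
Proof.
move=> /is_place_classify[->|[pi ppi ->]]; first by rewrite infinite_degree.
by have [_ ->] := finite_placeP ppi; apply: deg_prime_gt0.
Qed.

Lemma Lfun0 : Lfun curve 0 = 1.
Proof.
rewrite /Lfun.
have -> : [set O | is_place O /\ (degree O <= 0)%N]%classic = set0 :> set (set (ratfun F)).
  by apply/seteqP; split=> // O /= [/degree_gt0]; rewrite leqn0 => /lt0n_neq0/negPf ->.
by rewrite fsbig_set0 coef1.
Qed.

Lemma euler_coef0 O : (0 < degree O)%N -> (euler O)`_0 = 1.
Proof.
move=> dO; have d0 : (0 == degree O)%N = false by rewrite ltn_eqF.
have d20 : (0 == 2 * degree O)%N = false by rewrite ltn_eqF ?muln_gt0.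
rewrite coef_map /euler_factor !coefD coefN coef1 coefZ coefXn d0 mulr0 subr0.
case: ifP => _; last by rewrite coef0 addr0.
by rewrite coefZ coefXn d20 mulr0 addr0.
Qed.

Lemma trunc_inv_logder n O N : (0 < degree O)%N -> logder n (euler O) N ->
  logder n (map_poly intr (trunc_inv n (euler_factor O curve)) : {poly algC}) (fun k => - N k).
Proof.
move=> dO; apply: logder_inv; rewrite /trunc_inv rmorph_sum /=.
under eq_bigr do rewrite rmorphXn rmorphB rmorph1.
exact/geometric_inverse/euler_coef0.
Qed.

Lemma Lprod_coef0 n : (Lprod n)`_0 = 1.
Proof.
rewrite /Lprod big_seq; apply: (big_ind (fun P : {poly algC} => P`_0 = 1)) => [|P Q P1 Q1|O].
- by rewrite coef1.
- by rewrite coef0M P1 Q1 mulr1.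
move=> Oin; have dO : (0 < degree O)%N.
  move: Oin; rewrite inE => /orP[/eqP ->|/mapP[pi]]; first by rewrite infinite_degree.
  rewrite mem_primes_le => /andP[ppi _] ->.
  by have [_ ->] := finite_placeP ppi; apply: deg_prime_gt0.
have e0 : (euler_factor O curve)`_0 = 1.
  by have /eqP := euler_coef0 dO; rewrite coef_map /= -[X in _ == X]/(1%:~R) eqr_int => /eqP.
rewrite coef_map /trunc_inv coef_sum big_ord_recl expr0 coef1 /= big1 ?addr0 // => i _.
by rewrite exprS coef0M coefB coef1 e0 subrr mul0r.
Qed.

(** The Euler factors enter inverted, which turns their Newton sums into traces. The deg pi roots of
    pi in E account for the multiplicity in [spread]. *)
Lemma Lfun_logder (Tr : nat -> algC) :
    (forall k, (0 < k)%N -> exists (E : finFieldType) (emb : {rmorphism F -> E}),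
       #|E| = (#|F| ^ k)%N /\
       Tr k = \sum_(t : E) (#|E|%:R - (affine_card 1 (- t ^+ d))%:R)
           + (if (3 %| d)%N then #|E|%:R - (affine_card 0 (- 1 : E))%:R else 0)) ->
  forall n, logder n (Lprod n) Tr.
Proof.
move=> HTr n.
have [Noo [HNoo HEoo]] := infinite_place_logder.
have /choice[N HN] : forall pi : {poly F}, exists N, prime_poly pi ->
  (forall n, logder n (euler (finite_place pi)) (spread N (deg pi))) /\
  (forall (E : finFieldType) (emb : {rmorphism F -> E}) k beta, #|E| = (#|F| ^ k)%N ->
     root (map_poly emb pi) beta -> N (k %/ deg pi)%N = (affine_card 1 (- beta ^+ d))%:R - #|E|%:R).
  move=> pi; have [ppi|npi] := boolP (prime_poly pi); last by exists (fun=> 0).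
  by have [N HN] := finite_place_logder ppi; exists N.
have H1 : logder n (Lprod n) (fun k => - Noo k +
    \sum_(pi <- primes_le F n | pi \in primes_le F n) - spread (N pi) (deg pi) k).
  rewrite /Lprod big_cons; apply: logderM.
    by apply: trunc_inv_logder; [rewrite infinite_degree | apply: HNoo].
  rewrite big_map big_seq; apply: logder_prod => pi; rewrite mem_primes_le => /andP[ppi _].
  have [Hl _] := HN pi ppi; have [_ dpi] := finite_placeP ppi.
  by apply: trunc_inv_logder; [rewrite dpi; apply: deg_prime_gt0 | apply: Hl].
apply: (eq_logder _ _ H1) => // k /andP[k0 kn].
have [E [emb [cardE ->]]] := HTr k k0.
rewrite addrC; congr (_ + _); last first.
  rewrite (HEoo E emb k cardE) opprB; case: ifP => // _.
  by rewrite affine_card_cusp subrr.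
rewrite (sum_over_primes emb cardE) -big_seq.
transitivity (\sum_(pi <- primes_le F n | (deg pi %| k)%N) - (N pi (k %/ deg pi)%N *+ deg pi)).
  rewrite [RHS]big_mkcond; apply: eq_bigr => pi _; rewrite /spread.
  by case: ifP; rewrite ?oppr0.
transitivity (\sum_(pi <- primes_le F k | (deg pi %| k)%N) - (N pi (k %/ deg pi)%N *+ deg pi)).
  rewrite -big_filter -[RHS]big_filter; apply: perm_big.
  apply: uniq_perm; try exact/filter_uniq/primes_le_uniq.
  move=> pi; rewrite mem_filter [RHS]mem_filter !mem_primes_le; case: dvdnP => //= -[j Dk].
  congr (_ && _); have [s0|s0] := posnP (size pi); first by rewrite s0.
  have : (deg pi <= k)%N by rewrite dvdn_leq // Dk dvdn_mull.
  by rewrite -(prednK s0) !ltnS -/(deg pi) => dk; rewrite dk (leq_trans dk).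
rewrite big_seq_cond [RHS]big_seq_cond; apply: eq_bigr => pi.
rewrite mem_primes_le => /andP[/andP[ppi _] dpi].
have [_ HNE] := HN pi ppi.
rewrite (eq_bigr (fun=> - N pi (k %/ deg pi)%N)) => [|beta rb]; last first.
  by rewrite (HNE E emb k beta cardE rb) opprB.
by rewrite sumr_const (card_roots emb cardE) // mulNrn.
Qed.

End LFunction.

(** * Orbits of multiplication by q *)

Lemma dvdn_order_iter (T : finType) (f : T -> T) (x : T) k :
  injective f -> (order f x %| k)%N = (iter k f x == x).
Proof.
move=> f_inj; have itM j : iter (j * order f x) f x = x.
  by elim: j => // j IH; rewrite mulSn iterD IH iter_order.
rewrite {2}(divn_eq k (order f x)) addnC iterD itM /dvdn.
apply/eqP/eqP => [->//|e].
by rewrite -(findex_iter (ltn_pmod k (order_gt0 f x))) e findex0.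
Qed.

Section ZdOrbits.
Variables (q d : nat).
Hypotheses (d_gt1 : (1 < d)%N) (coprime_dq : coprime d q).
Local Notation f := (@mul_by q d).

Lemma Zd_natM (m : 'Z_d) n : (n%:R * m)%R = ((n * m) %% d)%N :> nat.
Proof.
have -> : (n%:R * m : 'Z_d) = (n * m)%N%:R by rewrite natrM natr_Zp.
by rewrite val_Zp_nat.
Qed.

Lemma Zd_eq0 (m : 'Z_d) n : (n%:R * m == 0 :> 'Z_d) = (d %| n * m)%N.
Proof. by rewrite -[LHS]negbK Zd_neq0 -eqn0Ngt Zd_natM. Qed.

Lemma iter_mul_by k (m : 'Z_d) : iter k f m = (q ^ k)%:R * m.
Proof.
elim: k => [|k IHk] /=; first by rewrite expn0 mul1r.
by rewrite IHk /mul_by mulrA -natrM expnS.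
Qed.

Lemma mul_by_inj : injective f.
Proof.
move=> m n /eqP; rewrite -subr_eq0 -mulrBr Zd_eq0 Gauss_dvdr // => dmn.
by apply/eqP; rewrite -subr_eq0 -[m - n]mul1r (Zd_eq0 _ 1) mul1n.
Qed.

Lemma orbit_length_dvd (m : 'Z_d) k : (0 < q)%N ->
  (orbit_length q m %| k)%N = (d %| (q ^ k).-1 * m)%N.
Proof.
move=> q0; rewrite /orbit_length (dvdn_order_iter _ _ mul_by_inj) iter_mul_by.
rewrite -subr_eq0 -{2}[m]mul1r -mulrBl -Zd_eq0 -subn1 natrB //.
by rewrite expn_gt0 q0.
Qed.

(** The excluded d/3 and 2d/3 are the nonzero residues killed by 3, a condition visibly stable under
    multiplication by q. *)
Lemma indexZE (m : 'Z_d) : (m \in indexZ d) = (m != 0) && ~~ ((3 %| d) && (d %| 3 * m))%N.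
Proof.
rewrite inE; have [//|m0] := eqVneq m 0; rewrite /=.
have [/dvdnP[k Dk]|//] := boolP (3 %| d)%N; rewrite /=.
have kd : (d %/ 3 = k)%N by rewrite Dk mulnK.
have k2d : (2 * d %/ 3 = 2 * k)%N by rewrite Dk mulnA mulnK.
have dm : (d %| 3 * m)%N = (k %| m)%N by rewrite {1}Dk [(k * 3)%N]mulnC dvdn_pmul2l.
have lt_m : (m < k * 3)%N by rewrite -Dk Zd_lt.
rewrite Zd_neq0 in m0; rewrite kd k2d dm; congr negb.
apply/orP/dvdnP => [[]/eqP ->|[j Dj]].
- by exists 1%N; rewrite mul1n.
- by exists 2.
move: lt_m m0; rewrite Dj; case: j {Dj} => [|[|[|j]]].
- by [].
- by rewrite mul1n => _ _; left.
- by move=> _ _; right.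
by move=> lt_jk _; exfalso; nia.
Qed.

Lemma dvd_mul_by n (m : 'Z_d) : (d %| n * f m)%N = (d %| n * m)%N.
Proof. by rewrite -!Zd_eq0 /mul_by mulrA -natrM !Zd_eq0 -mulnA mulnCA Gauss_dvdr. Qed.

Lemma mul_by_indexZ (m : 'Z_d) : (f m \in indexZ d) = (m \in indexZ d).
Proof.
have eq0E (n : 'Z_d) : (n == 0) = (d %| 1 * n)%N by rewrite -Zd_eq0 mul1r.
by rewrite !indexZE !eq0E !dvd_mul_by.
Qed.

Lemma indexZ_neq0 (m : 'Z_d) : m \in indexZ d -> m != 0.
Proof. by rewrite inE => /andP[]. Qed.

Lemma iter_indexZ (m : 'Z_d) i : (iter i f m \in indexZ d) = (m \in indexZ d).
Proof. by elim: i => //= i <-; rewrite mul_by_indexZ. Qed.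

End ZdOrbits.

(** * Jacobi sums over the successive extensions *)

Section JacobiLevels.
Variables (p d : nat) (P : prime_idealr Zbar).
Hypothesis d_gt1 : (1 < d)%N.
Local Notation Fbar := {ideal_quot P}.

Definition teichmuller Q (E : finFieldType) (inc : {rmorphism E -> Fbar}) (om : E -> algC) :=
  [/\ #|E| = Q, injective inc, forall x, x ^+ Q = x -> exists y, inc y = x &
   [/\ mult_char om, forall x, om x = 1 -> x = 1 &
    forall x, x != 0 -> om x = val (theta p (inc x))]].

Definition signed_jacobi (E : finFieldType) (om : E -> algC) (m : 'Z_d) :=
  Xchar om m (-1) * jacobi3 (Xchar om m).

(** The exponent for E' is that for E times 1 + Q + ... + Q^(n-1), so the character attached to m
    over E' is the one over E composed with the norm. *)
Lemma signed_jacobi_lift Q n E inc om E' inc' om' (m : 'Z_d) :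
    @teichmuller Q E inc om -> @teichmuller (Q ^ n) E' inc' om' ->
    m != 0 -> (d %| Q.-1 * m)%N -> (0 < n)%N ->
  signed_jacobi om' m = signed_jacobi om m ^+ n.
Proof.
move=> [cE inc_inj _ [mom om_inj omE]] [cE' inc'_inj inc'_surj [mom' om_inj' omE']] m0 dm n0.
(* The embedding has to commute with the inclusions in the quotient by P; otherwise the two [theta]
   values could differ by a Frobenius twist. *)
have [f Hf] : exists f : {rmorphism E -> E'}, forall a, inc' (f a) = inc a.
  apply: lift_rmorphism => // a; apply: inc'_surj.
  by rewrite -rmorphXn -cE /= expr_card_exp.
have cardE : #|E'| = (#|E| ^ n)%N by rewrite cE' cE.
have M'E : (#|E'|.-1 = #|E|.-1 * \sum_(i < n) #|E| ^ i)%N by rewrite cardE predn_exp.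
have Xm : Xindex E d m by rewrite /= m0 cE.
have Xm' : Xindex E' d m by rewrite /= m0 M'E mulnAC dvdn_mulr ?cE.
have mX := mult_Xchar mom d_gt1 Xm; have mX' := mult_Xchar mom' d_gt1 Xm'.
apply: (jacobi3_lift (emb := f)) => //.
- exact: nontrivial_Xchar.
- exact: nontrivial_Xchar.
- move=> x w; have [->|x0] := eqVneq x 0.
    case: n n0 {cE' inc'_surj cardE M'E} => // n _; rewrite big_ord_recl expn0 expr1 mul0r => /eqP.
    by rewrite fmorph_eq0 => /eqP ->; rewrite !mchar0.
  rewrite -expr_sum => fw; have w0 : w != 0 by rewrite -(fmorph_eq0 f) fw expf_neq0.
  have omw : om w = om' x ^+ (\sum_(i < n) #|E| ^ i).
    by rewrite omE // -Hf -omE' ?fmorph_eq0 // fw (mcharX _ _ mom').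
  rewrite /Xchar /om_pow omw -exprM; congr (_ ^+ _).
  by rewrite M'E mulnAC [(_ * m * _)%N]mulnC -muln_divA ?cE.
(* Whether the character is quadratic depends on m alone, hence is the same at both levels. *)
have [d2|d2] := boolP (d %| 2 * m)%N; [right|left]; split.
- by move=> x x0; rewrite -expr2 (trivial_Xchar_pow mom d_gt1 Xm d2).
- by move=> x x0; rewrite -expr2 (trivial_Xchar_pow mom' d_gt1 Xm' d2).
- by have [c c0 c1] := nontrivial_Xchar_pow mom om_inj d_gt1 Xm d2; exists c.
- by have [c c0 c1] := nontrivial_Xchar_pow mom' om_inj' d_gt1 Xm' d2; exists c.
Qed.

(** The character of q m at x is that of m at x^q, and Frobenius permutes the terms of the Jacobi
    sum. *)
Lemma signed_jacobi_frob (F E : finFieldType) (emb : {rmorphism F -> E})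
    (om : E -> algC) (m : 'Z_d) :
    mult_char om -> (forall x, om x = 1 -> x = 1) ->
    coprime d #|F| -> Xindex E d m ->
  signed_jacobi om (mul_by #|F| m) = signed_jacobi om m.
Proof.
move=> mom om_inj cdF Xm; have [m0 dm] := andP Xm.
have qm0 : mul_by #|F| m != 0.
  rewrite -(inj_eq (mul_by_inj d_gt1 cdF)) in m0.
  by apply: contra_neq m0 => ->; rewrite /mul_by mulr0.
have dqm : (d %| #|E|.-1 * mul_by #|F| m)%N.
  by rewrite Zd_natM // /dvdn modnMmr -/(dvdn _ _) mulnCA dvdn_mull.
have Xqm : Xindex E d (mul_by #|F| m) by rewrite /= qm0.
have XE x : Xchar om (mul_by #|F| m) x = Xchar om m (x ^+ #|F|).
  have mX := mult_Xchar mom d_gt1 Xm; have mX' := mult_Xchar mom d_gt1 Xqm.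
  have [->|x0] := eqVneq x 0; first by rewrite expr0n gtn_eqF ?(mchar0 mX) ?(mchar0 mX') // ltnW ?card_gt1.
  rewrite (mcharX _ _ mX) Xchar_powE /Xchar Zd_natM //.
  rewrite om_pow_ex_mod //; last by rewrite mulnCA dvdn_mull.
  by rewrite mulnCA -muln_divA.
have FN1 : (-1 : E) ^+ #|F| = -1 by rewrite -(rmorphN1 emb) -rmorphXn /= expf_card.
have frobX : injective (fun x : E => x ^+ #|F|).
  by move=> x y; rewrite -[#|F|]expn1; apply: (frob_inj emb).
rewrite /signed_jacobi XE FN1; congr (_ * _); rewrite /jacobi3.
rewrite [RHS](reindex_inj frobX); apply: eq_bigr => x _.
rewrite [RHS](reindex_inj frobX); apply: eq_bigr => y _.
have D (u v : E) : (u + v) ^+ #|F| = u ^+ #|F| + v ^+ #|F|.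
  by rewrite -[#|F|]expn1 (frobD emb).
have -> : 1 - x ^+ #|F| - y ^+ #|F| = (1 - x - y) ^+ #|F|.
  by rewrite !D -[- x]mulN1r -[- y]mulN1r !exprMn FN1 expr1n !mulN1r.
by rewrite !XE.
Qed.

End JacobiLevels.

(** The sum over subsets of the quotient by P becomes a sum over the abstract field E; the third
    variable is 1 - x - y. *)
Lemma jacobi_signed (p q d : nat) (P : prime_idealr Zbar) (E : finFieldType)
    (inc : {rmorphism E -> {ideal_quot P}}) (om : E -> algC) (m : 'Z_d) : (1 < d)%N ->
    teichmuller p (q ^ orbit_length q m) inc om -> Xindex E d m ->
  theta_char p q m (-1 : {ideal_quot P}) * jacobi p q P m = signed_jacobi om m.
Proof.
move=> d1 [cE inc_inj inc_surj [mom om_inj omE]] Xm.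
have mX := mult_Xchar mom d1 Xm.
have thE x : theta_char p q m (inc x) = Xchar om m x.
  rewrite /theta_char; have [->|x0] := eqVneq x 0; first by rewrite rmorph0 eqxx (mchar0 mX).
  rewrite -(rmorph0 inc) (inj_eq inc_inj) (negPf x0) /Xchar /om_pow -omE //.
  by rewrite cE subn1.
rewrite /signed_jacobi -thE rmorphN1; congr (_ * _).
pose g (z : E * E) := (inc z.1, inc z.2, inc (1 - z.1 - z.2)).
have g_inj : injective g by move=> [x y] [x' y'] [/inc_inj -> /inc_inj ->].
rewrite /jacobi (@eq_fsbigl _ _ _ _ _ _ [set` [seq g z | z <- enum {: E * E}]]%classic).
  rewrite -fsbig_seq; last by rewrite map_inj_uniq ?enum_uniq.
  rewrite (big_map g xpredT) big_enum /jacobi3 pair_bigA.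
  by apply: eq_bigr => -[x y] _; rewrite /= !thE.
apply/seteqP; split=> [[[x y] z] /= [/inc_surj[a <-] /inc_surj[b <-] _ e]|z /= /mapP[[x y] _ ->] /=].
  apply/mapP; exists (a, b); first by rewrite mem_enum.
  by rewrite /g /= !rmorphB rmorph1 -e; congr (_, _, _); ring.
rewrite /subfieldF /= -!rmorphXn /= -cE !expf_card !rmorphB rmorph1; split=> //.
by ring.
Qed.

Section OrbitSum.
Variables (F : finFieldType) (p d a : nat) (P : prime_idealr Zbar) (rep : {set 'Z_d} -> 'Z_d).
Local Notation q := #|F|.
Local Notation len o := (orbit_length q (rep o)).
Hypotheses (pr_p : prime p) (pP : p%:R \in P) (cardF : q = (p ^ a)%N).
Hypotheses (d_gt1 : (1 < d)%N) (coprime_dq : coprime d q).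
Hypothesis rep_in : forall o, o \in orbits q d -> rep o \in o.

Lemma exists_teichmuller_level k : (0 < k)%N -> exists (E : finFieldType)
  (inc : {rmorphism E -> {ideal_quot P}}) (om : E -> algC), teichmuller p (q ^ k) inc om.
Proof.
move=> k0; have a0 : (0 < a)%N by have := card_gt1 F; rewrite cardF; case: a.
have [|E [inc [om H]]] := @exists_teichmuller P p (a * k) pr_p pP; first by rewrite muln_gt0 a0.
by exists E, inc, om; rewrite cardF -expnM.
Qed.

Definition orbit_set m := [set n in orbit (@mul_by q d) m]%SET.

Lemma orbit_setP m n : (orbit_set n == orbit_set m) = (n \in orbit_set m).
Proof.
have f_inj := mul_by_inj d_gt1 coprime_dq; have sym := fconnect_sym f_inj.
rewrite inE -fconnect_orbit sym; apply/eqP/idP => [/setP/(_ m)|nm].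
  by rewrite !inE -!fconnect_orbit connect0.
apply/setP => u; rewrite !inE -!fconnect_orbit.
exact: (same_connect sym).
Qed.

Lemma orbit_set_rep o : o \in orbits q d -> o = orbit_set (rep o).
Proof.
move=> oo; have := rep_in oo; case/finset.imsetP: oo => m _ ->.
by rewrite -orbit_setP => /eqP.
Qed.

Lemma rep_indexZ o : o \in orbits q d -> rep o \in indexZ d.
Proof.
move=> oo; have := rep_in oo; case/finset.imsetP: oo => m mZ ->.
rewrite inE -fconnect_orbit => /iter_findex <-.
by rewrite iter_indexZ.
Qed.

Lemma card_orbit_set m : #|orbit_set m| = orbit_length q m.
Proof. by rewrite cardsE /orbit_length -size_orbit; apply/card_uniqP/orbit_uniq. Qed.

(** An orbit consists of |m| indices with equal signed sums; this multiplicity is the one in the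
    Newton sums of 1 - c T^|m|, and the lift from F_(q^|m|) to F_(q^k) gives the power of c. *)
Lemma orbit_sum k (E : finFieldType) (inc : {rmorphism E -> {ideal_quot P}}) om :
    (0 < k)%N -> teichmuller p (q ^ k) inc om ->
  \sum_(m in indexZ d | (d %| #|E|.-1 * m)%N) signed_jacobi om m =
  \sum_(o in orbits q d) if (len o %| k)%N then
     (theta_char p q (rep o) (-1 : {ideal_quot P}) * jacobi p q P (rep o)) ^+ (k %/ len o) *+ len o
   else 0.
Proof.
move=> k0 T; have [cE _ _ [mom om_inj _]] := T.
have q0 : (0 < q)%N := ltnW (card_gt1 F).
have [emb _] := finField_embed cE.
rewrite big_mkcondr (partition_big orbit_set (mem (orbits q d))) /=; last first.
  by move=> m mZ; apply: imset_f.
apply: eq_bigr => o oo; have Do := orbit_set_rep oo; have rZ := rep_indexZ oo.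
have r0 : rep o != 0 by apply: indexZ_neq0.
have per_dvd : (len o %| k)%N = (d %| #|E|.-1 * rep o)%N by rewrite orbit_length_dvd // cE.
have in_o m : (m \in indexZ d) && (orbit_set m == o) = (m \in o).
  rewrite {1}Do orbit_setP -Do andbC; have [mo|//] := boolP (m \in o); rewrite /=.
  move: mo; rewrite Do inE -fconnect_orbit => /iter_findex <-.
  by rewrite iter_indexZ.
rewrite (eq_bigl _ _ in_o).
rewrite (eq_bigr (fun=> if (len o %| k)%N then signed_jacobi om (rep o) else 0)); last first.
  move=> m; rewrite {1}Do inE -fconnect_orbit => /iter_findex <-; rewrite per_dvd.
  elim: (findex _ _ _) => //= i <-; set n := iter _ _ _.
  rewrite dvd_mul_by //; case: ifP => // dn; apply: signed_jacobi_frob => //.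
  by rewrite /= dn andbT; apply: indexZ_neq0; rewrite iter_indexZ.
have card_o : #|o| = len o by rewrite {1}Do card_orbit_set.
rewrite sumr_const card_o; case: ifP => [lk|_]; last by rewrite mul0rn.
congr (_ *+ _).
have l0 : (0 < len o)%N by apply: order_gt0.
have [E1 [inc1 [om1 T1]]] := exists_teichmuller_level l0.
have dl : (d %| (q ^ len o).-1 * rep o)%N by rewrite -orbit_length_dvd.
rewrite (jacobi_signed d_gt1 T1); last by rewrite /= r0 (let: And4 e _ _ _ := T1 in e).
apply: (signed_jacobi_lift d_gt1 T1) => //.
- by rewrite -expnM mulnC divnK; [apply: T | ].
- by rewrite divn_gt0 // dvdn_leq.
Qed.

End OrbitSum.

(** * Comparison of the two sides *)

Theorem theorem3p1 (F : finFieldType) (p d : nat) (P : prime_idealr Zbar)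
    (rep : {set 'Z_d} -> 'Z_d) :
  p \in [pchar F] -> (5 <= p)%N -> (2 <= d)%N -> coprime d #|F| ->
  p%:R \in P ->
  (forall o, o \in orbits #|F| d -> rep o \in o) ->
  exists L : {poly int},
    (forall n, Lfun (curveE F d) n = L`_n) /\
    map_poly intr L =
      \prod_(o in orbits #|F| d)
        (1 - (theta_char p #|F| (rep o) (- 1 : {ideal_quot P})
              * jacobi p #|F| P (rep o)) *: 'X^(orbit_length #|F| (rep o)))
      :> {poly algC}.
Proof.
move=> pF p5 d1 cdq pP rep_in.
have pr_p := pcharf_prime pF; have cardF : #|F| = (p ^ logn p #|F|)%N := card_pprimeChar pF.
have nat_neq0 n : (0 < n < p)%N -> (n%:R : F) != 0.
  by move=> /andP[n0 np]; rewrite -(dvdn_pcharf pF) gtnNdvd.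
have two_neq0 : (2 : F) != 0 by apply: nat_neq0; rewrite (leq_trans _ p5).
have three_neq0 : (3 : F) != 0 by apply: nat_neq0; rewrite (leq_trans _ p5).
have d0 : (0 < d)%N := ltnW d1.
pose len o := orbit_length #|F| (rep o).
pose c o := theta_char p #|F| (rep o) (-1 : {ideal_quot P}) * jacobi p #|F| P (rep o).
pose R : {poly algC} := \prod_(o in orbits #|F| d) (1 - c o *: 'X^(len o)).
pose Tr k := \sum_(o in orbits #|F| d)
  if (len o %| k)%N then - (c o ^+ (k %/ len o) *+ len o) else 0.
have len0 o : (0 < len o)%N by apply: order_gt0.
have R_logder n : logder n R Tr.
  by apply: logder_prod => o _; apply: logder_binomial.
have R0 : R`_0 = 1.
  rewrite /R; apply: (big_ind (fun Q : {poly algC} => Q`_0 = 1)) => [|Q1 Q2 e1 e2|o _].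
  - by rewrite coef1.
  - by rewrite coef0M e1 e2 mulr1.
  have e0 : (0 == len o)%N = false by rewrite ltn_eqF.
  by rewrite coefB coef1 coefZ coefXn e0 mulr0 subr0.
(* For each k the same character sum over F_(q^k) is evaluated twice: by point counts, giving the
   traces, and by orbits, giving the Newton sums of R. *)
have L_logder n : logder n (Lprod F d n) Tr.
  apply: Lfun_logder => // k k0.
  have [E [inc [om T]]] := exists_teichmuller_level pr_p pP cardF k0.
  have [cE _ _ [mom om_inj _]] := T.
  have [emb _] := finField_embed cE; exists E, emb; split=> //.
  have -> : Tr k = - \sum_(m in indexZ d | (d %| #|E|.-1 * m)%N) signed_jacobi om m.
    rewrite (orbit_sum pr_p pP cardF d1 cdq rep_in k0 T) -sumrN.
    by apply: eq_bigr => o _; case: ifP => _; rewrite ?oppr0.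
  rewrite -(trace_sum mom om_inj d1); congr (_ + _).
    apply: eq_bigr => t _; congr (_ - _%:R); apply: eq_card => z.
    rewrite !inE /=; congr (_ == _); ring.
  case: ifP => // _; congr (_ - _%:R); apply: eq_card => z.
  rewrite !inE /=; congr (_ == _); ring.
have Lfun_R n : (Lfun (curveE F d) n)%:~R = R`_n.
  have [->|n0] := posnP n; first by rewrite Lfun0.
  rewrite Lfun_Lprod //; apply: (logder_uniq (n := n) _ (L_logder n) (R_logder n)) => //.
  by rewrite Lprod_coef0 // R0.
(* Cutting at the size of R loses nothing: the coefficients of L are those of R and vanish from
   there on. *)
exists (\poly_(i < size R) Lfun (curveE F d) i); split=> [n|].
  rewrite coef_poly; case: ltnP => // sn.
  by apply/eqP; rewrite -(intr_eq0 algC) Lfun_R nth_default.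
rewrite -[RHS]/R; apply/polyP => n; rewrite coef_map coef_poly /= -Lfun_R.
case: ltnP => // sn; by rewrite Lfun_R nth_default.
Qed.
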